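(* Let $p$ be an odd prime and let $H$ be a finite $p$-group of $p$-class $c$ with a GI-automorphism $\sigma$. Then $$\int_G|\mathrm{Sur}_\sigma(G,H)|\,d\mu_{BBH}=\sum_{G}\mu_{BBH,c}(G)\,|\mathrm{Sur}_\sigma(G,H)|=1,$$ where the sum is over isomorphism classes of Schur $\sigma$-ancestor groups $G$ of $p$-class $c$.
   Context: Fix an odd prime $p$. For a profinite group $G$, a GI-automorphism of $G$ is an automorphism $\sigma$ of $G$ that acts as inversion on some set of (topological) generators of $G$. Any two GI-automorphisms of a finitely generated pro-$p$ group $G$ are conjugate in $\mathrm{Aut}(G)$. For finitely generated pro-$p$ groups $G,H$ each admitting a GI-automorphism, fix one on each (both denoted $\sigma$); $\mathrm{Sur}_\sigma(G,H)$ is the set of continuous surjective homomorphisms $f:G\to H$ with $f\circ\sigma=\sigma\circ f$. Its cardinality does not depend on the choices. For a pro-$p$ group $G$, $d(G)=\dim H^1(G,\mathbb{Z}/p\mathbb{Z})$ and $r(G)=\dim H^2(G,\mathbb{Z}/p\mathbb{Z})$. A Schur $\sigma$-group is a finitely generated pro-$p$ group $G$ with finite abelianization, with $d(G)=r(G)$ (called its rank), and admitting a GI-automorphism. The lower $p$-central series is $P_0(G)=G$, and $P_{n+1}(G)$ is the closed subgroup generated by $[G,P_n(G)]$ and $P_n(G)^p$. Thus $P_1(G)=\Phi(G)$ is the Frattini subgroup. The $p$-class of a finite $p$-group $G$ is the smallest $c\ge0$ with $P_c(G)=\{1\}$. Put $Q_c(G)=G/P_c(G)$. A Schur $\sigma$-ancestor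 group is a finite $p$-group isomorphic to $Q_c(G)$ for some Schur $\sigma$-group $G$ and some $c$. Let $\Omega$ be the $\sigma$-algebra on the set of isomorphism classes of Schur $\sigma$-groups generated by the sets $\{G : Q_c(G)\cong P\}$, for all finite $p$-groups $P$ and all integers $c\ge 0$. Let $F_g$ be the free pro-$p$ group on $x_1,\dots,x_g$ with GI-automorphism $\sigma(x_i)=x_i^{-1}$. Let $X=\{s\in\Phi(F_g):\sigma(s)=s^{-1}\}$, and let $\mu$ be the natural profinite probability measure on $X$, i.e. the limit of the uniform measures on the finite sets $X_c=\{s\in\Phi(Q_c(F_g)):\sigma(s)=s^{-1}\}$ (the pushforward of $\mu$ to each $X_c$ is uniform). The product measure on $X^g$ is also denoted $\mu$. Let $$\mu_{CL}(g)=p^{-g^2}\prod_{k=1}^g(1-p^{-k})^{-2}\prod_{i=1}^\infty(1-p^{-i}).$$ The probability measure $\mu_{BBH}$ on isomorphism classes of Schur $\sigma$-groups is defined, for $A$ a set of isomorphism classes of rank $g$ Schur $\sigma$-groups, by $$\mu_{BBH}(A)=\mu_{CL}(g)\,\mu\big(\{(r_1,\dots,r_g)\in X^g : F_g/\langle\langle r_1,\dots,r_g\rangle\rangle\in A\}\big)$$ whenever the set on the right is measurable, and in general by adding over ranks $g\ge 0$. Here $\langle\langle\cdot\rangle\rangle$ denotes the closed normal subgroup generated. (The quotient fails to be a Schur $\sigma$-group of rank $g$ only with probability $0$.) The sets in $\Omega$ are measurable for $\mu_{BBH}$. For a finite $p$-group $P$, $\mu_{BBH,c}(P)=\mu_{BBH}(\{G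 : Q_c(G)\cong P\})$. *)

(* Defs.v *)
From HB Require Import structures.
From mathcomp Require Import all_boot all_order all_algebra finmap.
From mathcomp Require Import all_classical all_reals all_analysis.

Set Implicit Arguments.
Unset Strict Implicit.
Unset Printing Implicit Defensive.

Import GRing.Theory numFieldNormedType.Exports.

Local Open Scope classical_set_scope.
Local Open Scope quotient_scope.
Local Open Scope group_scope.

HB.mixin Record isTopologicalGroup G & Group G & Topological G := {
  mulg_continuous : continuous (fun xy : G * G => xy.1 * xy.2);
  invg_continuous : continuous (fun x : G => x^-1)
}.

(* The carriers live in a universe of their own, strictly below the one of
   [choiceType]: this is what lets us form below the type of isomorphism
   classes of topological groups and equip it with a measurable structure. *)
#[short(type="topGroupType")]
HB.structure Definition TopologicalGroup :=
  {G of Group G & Topological G & isTopologicalGroup G}.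

Section Subgroups.
Variable G : topGroupType.
Implicit Types (A N : set G).

Definition closed_subgroup A :=
  [/\ closed A, A 1 & forall x y, A x -> A y -> A (x * y^-1)].

Definition conj_invariant A := forall x y, A x -> A (x ^ y).

Definition closed_gen A : set G := smallest closed_subgroup A.

Definition closed_normal_gen A : set G :=
  smallest (fun N => closed_subgroup N /\ conj_invariant N) A.

Record closedNormal := ClosedNormal {
  cn_set :> set G;
  cn_subgroup : closed_subgroup cn_set;
  cn_normal : conj_invariant cn_set }.

Lemma mulg_left_continuous (a : G) : continuous (fun x : G => a * x).
Proof.
move=> x; apply: (@continuous_comp _ _ _ (fun x : G => (a, x))
  (fun xy : G * G => xy.1 * xy.2)); last exact: mulg_continuous.
by apply: cvg_pair => /=; [exact: cvg_cst|exact: cvg_id].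
Qed.

Lemma mulg_right_continuous (a : G) : continuous (fun x : G => x * a).
Proof.
move=> x; apply: (@continuous_comp _ _ _ (fun x : G => (x, a))
  (fun xy : G * G => xy.1 * xy.2)); last exact: mulg_continuous.
by apply: cvg_pair => /=; [exact: cvg_id|exact: cvg_cst].
Qed.

Lemma conjg_continuous (y : G) : continuous (fun x : G => x ^ y).
Proof.
move=> x; rewrite /conjg.
apply: (@continuous_comp _ _ _ (fun x : G => x * y) (fun x : G => y^-1 * x)).
  exact: mulg_right_continuous.
exact: mulg_left_continuous.
Qed.

Lemma closed_subgroup_bigcap (I : Type) (D : set I) (f : I -> set G) :
  (forall i, D i -> closed_subgroup (f i)) ->
  closed_subgroup (\bigcap_(i in D) f i).
Proof.
move=> fD; split.
- by apply: closed_bigI => i /fD[].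
- by move=> i /fD[].
- by move=> x y fx fy i Di; have [_ _] := fD i Di; apply; [exact: fx|exact: fy].
Qed.

Lemma closed_gen_subgroup A : closed_subgroup (closed_gen A).
Proof. by apply: closed_subgroup_bigcap => N []. Qed.

Lemma closed_gen_conj A : conj_invariant A -> conj_invariant (closed_gen A).
Proof.
move=> Aconj x y Ax.
have [cl g1 gM] := closed_gen_subgroup A.
suff : closed_gen A `<=` [set z | closed_gen A (z ^ y)] by exact.
apply: smallest_sub.
  split.
  - by apply: closed_comp => // z _; exact: conjg_continuous.
  - by rewrite /= conj1g.
  - by move=> a b /= Aa Ab; rewrite conjMg conjVg; exact: gM.
by move=> a Aa; apply: sub_gen_smallest; exact: Aconj.
Qed.

Lemma closed_normal_genP A : closed_subgroup (closed_normal_gen A) /\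
  conj_invariant (closed_normal_gen A).
Proof.
split; first by apply: closed_subgroup_bigcap => N [[]].
by move=> x y Ax N [[Nsub Nconj] AN]; exact/Nconj/(Ax N).
Qed.

Definition closed_normal_closure A : closedNormal :=
  ClosedNormal (closed_normal_genP A).1 (closed_normal_genP A).2.

Fixpoint lower_pcentral_set (p n : nat) : set G :=
  if n is m.+1 then
    closed_gen ([set [~ x, y] | x in [set: G] & y in lower_pcentral_set p m]
                `|` [set y ^+ p | y in lower_pcentral_set p m])
  else [set: G].

Lemma closed_subgroupT : closed_subgroup [set: G].
Proof. by split => //; exact: closedT. Qed.

Lemma lower_pcentral_subproof p n :
  closed_subgroup (lower_pcentral_set p n) /\
  conj_invariant (lower_pcentral_set p n).
Proof.
elim: n => [|n [_ IH]] /=; first by split => //; exact: closed_subgroupT.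
split; first exact: closed_gen_subgroup.
apply: closed_gen_conj => _ z [[a _ [b Pb <-]]|[b Pb <-]].
  by left; exists (a ^ z) => //; exists (b ^ z); [exact: IH|rewrite conjRg].
by right; exists (b ^ z); [exact: IH|rewrite conjXg].
Qed.

Definition lower_pcentral p n : closedNormal :=
  ClosedNormal (lower_pcentral_subproof p n).1 (lower_pcentral_subproof p n).2.

Definition Frattini p : set G := lower_pcentral p 1.

Lemma derived_subproof :
  let D := closed_gen [set [~ x, y] | x in [set: G] & y in [set: G]] in
  closed_subgroup D /\ conj_invariant D.
Proof.
split; first exact: closed_gen_subgroup.
apply: closed_gen_conj => _ z [a _ [b _ <-]].
by exists (a ^ z) => //; exists (b ^ z); rewrite ?conjRg.
Qed.

Definition derived : closedNormal :=
  ClosedNormal derived_subproof.1 derived_subproof.2.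

End Subgroups.

Arguments Frattini : clear implicits.

Section Quotient.
Variables (G : topGroupType) (N : closedNormal G).

Let N1 : cn_set N 1. Proof. by case: (cn_subgroup N). Qed.
Let NV x : cn_set N x -> cn_set N x^-1.
Proof.
by move=> Nx; have [_ _ /(_ _ _ N1 Nx)] := cn_subgroup N; rewrite mul1g.
Qed.
Let NM x y : cn_set N x -> cn_set N y -> cn_set N (x * y).
Proof.
move=> Nx /NV Ny; have [_ _ /(_ _ _ Nx Ny)] := cn_subgroup N.
by rewrite invgK.
Qed.

Definition lcoset_of (x : G) : G -> Prop := fun y => cn_set N (x^-1 * y).

(* The quotient [G / N] does not use [{eq_quot _}] or [quotient_topology],
   whose universes are too large for the carrier of a [topGroupType]. *)
Definition quot : Type := {A : G -> Prop | exists x, A = lcoset_of x}.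

Definition quot_pi (x : G) : quot :=
  exist _ (lcoset_of x) (ex_intro _ x erefl).

Definition quot_repr (A : quot) : G := projT1 (cid (svalP A)).

Lemma quot_reprK : cancel quot_repr quot_pi.
Proof.
move=> A; apply: eq_sig_hprop => /= [?|]; first exact: Prop_irrelevance.
by rewrite /quot_repr; case: cid => x /= ->.
Qed.

HB.instance Definition _ := @isQuotient.Build G quot quot_repr quot_pi quot_reprK.
HB.instance Definition _ := gen_eqMixin quot.
HB.instance Definition _ := gen_choiceMixin quot.

Definition quot_open (U : set quot) := open (quot_pi @^-1` U).

Lemma quot_openT : quot_open setT.
Proof. by rewrite /quot_open preimage_setT; exact: openT. Qed.
Lemma quot_openI : setI_closed quot_open.
Proof. by move=> U V; exact: openI. Qed.
Lemma quot_open_bigU (I : Type) (f : I -> set quot) :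
  (forall i, quot_open (f i)) -> quot_open (\bigcup_i f i).
Proof. by move=> fo; apply: bigcup_open => i _; exact: fo. Qed.

HB.instance Definition _ := @isOpenTopological.Build quot quot_open
  quot_openT quot_openI quot_open_bigU.

Lemma quot_piE (x y : G) : (\pi_quot x = \pi_quot y) <-> cn_set N (x^-1 * y).
Proof.
rewrite !unlock /=; split=> [[] /(congr1 (fun A : G -> Prop => A y))|Nxy].
  by rewrite /lcoset_of mulVg => ->.
apply: eq_sig_hprop => /= [?|]; first exact: Prop_irrelevance.
rewrite /lcoset_of; apply/funext => z; apply/propext; split=> Nz.
  have -> : y^-1 * z = (x^-1 * y)^-1 * (x^-1 * z).
    by rewrite invgM invgK mulgA mulgK.
  exact/NM/Nz/NV.
have -> : x^-1 * z = (x^-1 * y) * (y^-1 * z) by rewrite mulgA mulgK.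
exact: NM.
Qed.

Definition quot_one : quot := \pi_quot 1.
Definition quot_mul (a b : quot) : quot := \pi_quot (repr a * repr b).
Definition quot_inv (a : quot) : quot := \pi_quot (repr a)^-1.

Lemma quot_mulE (x y : G) : quot_mul (\pi_quot x) (\pi_quot y) = \pi_quot (x * y).
Proof.
have Nx : cn_set N ((repr (\pi_quot x))^-1 * x) by apply/quot_piE; rewrite reprK.
have Ny : cn_set N ((repr (\pi_quot y))^-1 * y) by apply/quot_piE; rewrite reprK.
apply/quot_piE; set a := repr _ in Nx *; set b := repr _ in Ny *.
have -> : (a * b)^-1 * (x * y) = (a^-1 * x) ^ b * (b^-1 * y).
  by rewrite /conjg invgM -!mulgA mulVKg.
by apply: NM => //; apply: cn_normal.
Qed.

Lemma quot_invE (x : G) : quot_inv (\pi_quot x) = \pi_quot x^-1.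
Proof.
have Nx : cn_set N ((repr (\pi_quot x))^-1 * x) by apply/quot_piE; rewrite reprK.
apply/quot_piE; set a := repr _ in Nx *.
have -> : a^-1^-1 * x^-1 = ((a^-1 * x) ^ a^-1)^-1.
  by rewrite /conjg !invgM !invgK -!mulgA mulgV mulg1.
by apply/NV/cn_normal.
Qed.

Let quotP (a : quot) : exists x, a = \pi_quot x.
Proof. by exists (repr a); rewrite reprK. Qed.

Lemma quot_mulA : associative quot_mul.
Proof.
move=> a b c; have [[x ->] [[y ->] [z ->]]] := (quotP a, (quotP b, quotP c)).
by rewrite !quot_mulE mulgA.
Qed.
Lemma quot_mul1 : left_id quot_one quot_mul.
Proof. by move=> a; have [x ->] := quotP a; rewrite quot_mulE mul1g. Qed.
Lemma quot_1mul : right_id quot_one quot_mul.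
Proof. by move=> a; have [x ->] := quotP a; rewrite quot_mulE mulg1. Qed.
Lemma quot_mulV : left_inverse quot_one quot_inv quot_mul.
Proof. by move=> a; have [x ->] := quotP a; rewrite quot_invE quot_mulE mulVg. Qed.
Lemma quot_Vmul : right_inverse quot_one quot_inv quot_mul.
Proof. by move=> a; have [x ->] := quotP a; rewrite quot_invE quot_mulE mulgV. Qed.

HB.instance Definition _ := @isGroup.Build quot quot_one quot_inv quot_mul
  quot_mulA quot_mul1 quot_1mul quot_mulV quot_Vmul.

Local Notation pq := (\pi_quot : G -> quot).

Lemma quot_pi_unlock : pq = quot_pi.
Proof. by apply/funext => x; rewrite unlock. Qed.

Lemma quot_pi_continuous : continuous pq.
Proof. by apply/continuousP => U oU; rewrite quot_pi_unlock; exact: oU. Qed.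

Lemma quot_pi_open (U : set G) : open U -> open (pq @` U).
Proof.
move=> oU; suff : open (pq @^-1` (pq @` U)) by rewrite quot_pi_unlock.
have -> : pq @^-1` (pq @` U) =
    \bigcup_(n in N) ((fun x : G => x * n) @^-1` U).
  apply/seteqP; split => x /=.
    move=> [u Uu ux]; exists (x^-1 * u) => /=; first exact/quot_piE.
    by rewrite mulVKg.
  by move=> [n Nn /= Uxn]; exists (x * n) => //; apply/esym/quot_piE; rewrite mulKg.
apply: bigcup_open => n _; apply: open_comp => // x _.
exact: mulg_right_continuous.
Qed.

Lemma quot_pi_nbhs (x : G) (U : set G) :
  nbhs x U -> nbhs (pq x) (pq @` U).
Proof.
rewrite nbhsE => -[V [oV Vx] VU]; rewrite nbhsE.
exists (pq @` V); last exact: image_subset.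
by split; [exact: quot_pi_open|exists x].
Qed.

Lemma quot_mul_continuous : continuous (fun ab : quot * quot => ab.1 * ab.2).
Proof.
move=> [a b] W /=; have [[x ->] [y ->]] := (quotP a, quotP b).
rewrite (quot_mulE : forall x y, pq x * pq y = _) => Wab.
have := @mulg_continuous G (x, y) _ (quot_pi_continuous Wab).
move=> [[U V] /= [Ua Vb] UV].
exists (pq @` U, pq @` V); first by split; exact: quot_pi_nbhs.
move=> [_ _] /= [[u Uu <-] [v Vv <-]].
rewrite (quot_mulE : forall x y, pq x * pq y = _).
exact: (UV (u, v)).
Qed.

Lemma quot_inv_continuous : continuous (fun a : quot => a^-1).
Proof.
move=> a W /=; have [x ->] := quotP a.
rewrite (quot_invE : forall x, (pq x)^-1 = _) => Wa.
have := @invg_continuous G x _ (quot_pi_continuous Wa) => Wa'.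
apply: filterS (quot_pi_nbhs Wa') => _ [y /= Wy <-].
by rewrite (quot_invE : forall x, (pq x)^-1 = _).
Qed.

HB.instance Definition _ := isTopologicalGroup.Build quot
  quot_mul_continuous quot_inv_continuous.

End Quotient.

Section ProP.
Local Open Scope card_scope.
Variable p : nat.
Implicit Types G H P : topGroupType.

Definition profinite G :=
  [/\ compact [set: G], hausdorff_space G & totally_disconnected [set: G]].

Definition pro_p G := profinite G /\
  forall N : closedNormal G, open (N : set G) ->
    exists n, [set: quot N] #= `I_(p ^ n).

(* Finite groups are the finite discrete topological groups. *)
Definition finite_pgroup P :=
  (forall A : set P, open A) /\ exists n, [set: P] #= `I_(p ^ n).

Definition top_generates G (A : set G) := closed_gen A = [set: G].

Definition finitely_generated G :=
  exists2 A : set G, finite_set A & top_generates A.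

Definition top_iso G H (f : G -> H) :=
  [/\ {morph f : x y / x * y}, continuous f &
      exists h : H -> G, [/\ cancel f h, cancel h f & continuous h]].

Definition isomorphic G H := exists f : G -> H, top_iso f.

Definition GI_automorphism G (s : G -> G) :=
  top_iso s /\
  exists2 A : set G, top_generates A & forall x, A x -> s x = x^-1.

(* Counts of [Sur] do not depend on this choice: GI-automorphisms of a finitely
   generated pro-p group are conjugate. *)
Definition fixed_GI G : G -> G := 
  xget (idfun : G -> G) [set s : G -> G | GI_automorphism s].

Definition Sur G H (sG : G -> G) (sH : H -> H) : set (G -> H) :=
  [set f | [/\ continuous f, {morph f : x y / x * y}, range f = [set: H] &
               f \o sG = sH \o f]].

Definition has_pclass P c :=
  lower_pcentral P p c = [set 1] :> set P /\
  forall k, lower_pcentral P p k = [set 1] :> set P -> (c <= k)%N.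

Definition Q c G : topGroupType := quot (lower_pcentral G p c).

Definition free_pro_p g (F : topGroupType) (x : 'I_g -> F) :=
  pro_p F /\
  forall P, pro_p P -> forall y : 'I_g -> P,
    exists! f : F -> P,
      [/\ continuous f, {morph f : u v / u * v} & forall i, f (x i) = y i].

Definition locally_constant (T : topologicalType) (f : T -> 'F_p) :=
  forall a, open (f @^-1` [set a]).

Local Open Scope ring_scope.

(* [B] being a subspace of the space [Z] of functions [T -> 'F_p], the
   dimension of [Z / B] is [n]: some [n] elements of [Z] form a basis
   modulo [B]. *)
Definition quot_dim (T : Type) (Z B : set (T -> 'F_p)) (n : nat) :=
  exists2 b : 'I_n -> T -> 'F_p, (forall i, Z (b i)) &
    forall z, Z z -> exists! a : {ffun 'I_n -> 'F_p},
      B (fun t => z t - \sum_i a i * b i t).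

Definition cocycle1 G : set (G -> 'F_p) :=
  [set f | locally_constant f /\ forall x y, f (x * y)%g = f x + f y].

(* The action on 'F_p is trivial, so 1-coboundaries vanish. *)
Definition coboundary1 G : set (G -> 'F_p) := [set (fun=> 0)].

Definition cocycle2 G : set (G * G -> 'F_p) :=
  [set f | locally_constant f /\ forall x y z,
     f (y, z) - f ((x * y)%g, z) + f (x, (y * z)%g) - f (x, y) = 0].

Definition coboundary2 G : set (G * G -> 'F_p) :=
  [set f | exists2 h : G -> 'F_p, locally_constant h &
     f = fun xy => h xy.2 - h (xy.1 * xy.2)%g + h xy.1].

Definition d_eq G n := quot_dim (@cocycle1 G) (@coboundary1 G) n.
Definition r_eq G n := quot_dim (@cocycle2 G) (@coboundary2 G) n.

Definition schur_sigma G :=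
  [/\ pro_p G, finitely_generated G, finite_set [set: quot (derived G)],
      exists n, d_eq G n /\ r_eq G n & exists s : G -> G, GI_automorphism s].

Definition ancestor P :=
  finite_pgroup P /\ exists G c, schur_sigma G /\ isomorphic P (Q c G).

End ProP.

Lemma isomorphic_refl (G : topGroupType) : isomorphic G G.
Proof.
have idc : continuous (idfun : G -> G) by move=> x; exact: cvg_id.
by exists idfun; split => //; exists idfun.
Qed.

Lemma isomorphic_sym (G H : topGroupType) : isomorphic G H -> isomorphic H G.
Proof.
move=> [f [fM fc [h [fK hK hc]]]]; exists h; split => //; last by exists f.
by move=> x y; apply: (can_inj fK); rewrite fM !hK.
Qed.

Lemma isomorphic_trans (G H K : topGroupType) :
  isomorphic G H -> isomorphic H K -> isomorphic G K.
Proof.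
move=> [f [fM fc [f' [fK fK' fc']]]] [h [hM hc [h' [hK hK' hc']]]].
exists (h \o f); split.
- by move=> x y /=; rewrite fM hM.
- by move=> x; apply: continuous_comp; [exact: fc|exact: hc].
- exists (f' \o h'); split; [exact: can_comp|exact: can_comp|].
  by move=> x; apply: continuous_comp; [exact: hc'|exact: fc'].
Qed.

Section IsoClass.
Variable C : topGroupType -> Prop.

Record groups := Groups { group_of :> topGroupType; groupsP : C group_of }.

HB.instance Definition _ := gen_eqMixin groups.
HB.instance Definition _ := gen_choiceMixin groups.

Definition iso_rel : rel groups :=
  fun G H => `[< isomorphic G H >].

Lemma iso_rel_equiv : equiv_class_of iso_rel.
Proof.
split.
- by move=> G; apply/asboolP/isomorphic_refl.
- by move=> G H; apply: asbool_equiv_eq; split; exact: isomorphic_sym.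
- by move=> H G K /asboolP GH /asboolP HK; apply/asboolP/(isomorphic_trans GH).
Qed.

Canonical iso_equiv : equiv_rel groups := EquivRelPack iso_rel_equiv.

Definition isoclass : Type := {eq_quot iso_equiv}.

HB.instance Definition _ := Choice.on isoclass.
HB.instance Definition _ := Quotient.on isoclass.

Definition class_repr (a : isoclass) : topGroupType := repr a.

End IsoClass.

Definition trivial_group : Type := unit.

HB.instance Definition _ := Choice.on trivial_group.
HB.instance Definition _ := @isGroup.Build trivial_group tt (fun=> tt)
  (fun _ _ => tt) (fun _ _ _ => erefl) (fun x => let: tt := x in erefl)
  (fun x => let: tt := x in erefl) (fun=> erefl) (fun=> erefl).
HB.instance Definition _ := @isOpenTopological.Build trivial_group setT
  I (fun _ _ _ _ => I) (fun _ _ _ => I).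

Lemma trivial_continuous (T : topologicalType) (f : T -> trivial_group) :
  continuous f.
Proof.
apply/continuousP => A _; have [At|At] := pselect (A tt).
  have -> : f @^-1` A = setT by apply/seteqP; split=> x //= _; case: (f x).
  exact: openT.
have -> : f @^-1` A = set0 by apply/seteqP; split=> x //=; case: (f x).
exact: open0.
Qed.

HB.instance Definition _ := isTopologicalGroup.Build trivial_group
  (@trivial_continuous _ _) (@trivial_continuous _ _).

Lemma schur_sigma_trivial p : schur_sigma p (trivial_group : topGroupType).
Proof.
have all1 (A : set trivial_group) : A 1 -> A = setT.
  by move=> A1; apply/seteqP; split => // -[].
have fint : finite_set [set: trivial_group] by exact: finite_finset.
have finq (N : closedNormal (trivial_group : topGroupType)) :
    [set: quot N] = [set \pi_(quot N) (1 : trivial_group)].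
  by apply/seteqP; split => // a _; rewrite /= -[a]reprK; case: (repr a).
split.
- split; first split.
  + exact: finite_compact.
  + by move=> [] [].
  + move=> [] _; rewrite (all1 [set tt])//; apply: all1.
    exact: connected_component_refl.
- move=> N _; exists 0%N; rewrite expn0 finq.
  exact: card_set1.
- by exists setT => //; apply: all1; apply: sub_gen_smallest.
- rewrite finq; exact: finite_set1.
- exists 0%N; split; exists (fun i => fun=> 0%R) => [[]//|f [_ fM]].
    exists [ffun=> 0%R]; split; last by move=> a _; apply/ffunP => -[].
    apply/funext => t; rewrite big_ord0 subr0 /=.
    by have /eqP := fM t t; case: t; rewrite -subr_eq0 opprD addNKr oppr_eq0 => /eqP.
  exists [ffun=> 0%R]; split; last by move=> a _; apply/ffunP => -[].
  exists (fun=> f (1, 1)); first by move=> a; exact: I.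
  by apply/funext => -[[] []]; rewrite big_ord0 subr0 subrr add0r.
- exists idfun; split; last by exists setT; [apply: all1; exact: sub_gen_smallest|case].
  have idc : continuous (idfun : trivial_group -> trivial_group).
    exact: trivial_continuous.
  by split => //; exists idfun.
Qed.

Section ProductProbability.
Context d (T : measurableType d) (R : realType).

Definition tuple_cons n (xt : T * n.-tuple T) : n.+1.-tuple T :=
  [tuple of xt.1 :: xt.2].

Lemma measurable_tuple_cons n : measurable_fun [set: _] (@tuple_cons n).
Proof.
by apply: measurable_cons; [exact: measurable_fst|exact: measurable_snd].
Qed.

HB.instance Definition _ n :=
  isMeasurableFun.Build _ _ _ _ (@tuple_cons n) (@measurable_tuple_cons n).

Fixpoint tuple_prod (P : probability T R) n : probability (n.-tuple T) R :=
  if n is m.+1 then distribution (P \x tuple_prod P m)%E (@tuple_cons m)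
  else dirac [tuple].

End ProductProbability.

Section X.
Variables (p : nat) (F : topGroupType) (s : {multiplicative F -> F}).

Definition X_set : set F := [set r | Frattini F p r /\ s r = r^-1].

Lemma X_set1 : X_set 1.
Proof.
split; first by case: (cn_subgroup (lower_pcentral F p 1)).
by apply: (@mulIg _ (s 1)); rewrite -gmulfM !mulg1 invg1 mul1g.
Qed.

Definition X_space : Type := set_type X_set.
HB.instance Definition _ := Topological.on X_space.
HB.instance Definition _ :=
  isPointed.Build X_space (exist _ 1 (mem_set X_set1)).

Definition X := g_sigma_algebraType (@open X_space).
HB.instance Definition _ := Measurable.on X.

Definition Q_aut c (a : Q p c F) : Q p c F :=
  \pi_(quot (lower_pcentral F p c)) (s (repr a)).

Definition X_c c : set (Q p c F) :=
  [set a | Frattini (Q p c F) p a /\ @Q_aut c a = a^-1].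

Definition X_proj c (r : X) : Q p c F :=
  \pi_(quot (lower_pcentral F p c)) (\val r).

(* The pushforward of [mu] to each finite set [X_c c] is uniform; this determines
   [mu], because the fibres of the maps [X_proj c] generate the topology of X. *)
Definition uniform_on_levels (R : realType) (mu : probability X R) :=
  forall c a, @X_c c a ->
    mu (@X_proj c @^-1` [set a]) = ((#|` fset_set (@X_c c) |%:R : R)^-1)%R%:E.

End X.

Section BBH.
Variable p : nat.

Definition schur_class := isoclass (schur_sigma p).

HB.instance Definition _ := Choice.on schur_class.
HB.instance Definition _ := Quotient.on schur_class.
HB.instance Definition _ := isPointed.Build schur_class
  (\pi_schur_class (Groups (schur_sigma_trivial p))).

Definition Omega_gen : set (set schur_class) :=
  [set A | exists c (P : topGroupType), finite_pgroup p P /\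
     A = [set a | isomorphic (Q p c (class_repr a)) P]].

Definition schur_space := g_sigma_algebraType Omega_gen.
HB.instance Definition _ := Measurable.on schur_space.

Definition ancestor_class c :=
  isoclass (fun P => ancestor p P /\ has_pclass p P c).

Variable R : realType.
Local Open Scope ring_scope.

Definition mu_CL (g : nat) : R :=
  p%:R ^- (g ^ 2)%N * (\prod_(1 <= k < g.+1) (1 - p%:R ^- k) ^- 2) *
  limn (fun n => \prod_(1 <= i < n.+1) (1 - p%:R ^- i) : R).

Variables (F : nat -> topGroupType) (s : forall g, {multiplicative F g -> F g}).
Variable mu : forall g, probability (X p (s g)) R.

Definition presented g (r : g.-tuple (X p (s g))) : topGroupType :=
  quot (closed_normal_closure [set \val (tnth r i) | i in [set: 'I_g]]).

(* This set function is meant on Omega. The g-th term only sees the classes of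
   rank g in [A], through the condition [d_eq]. *)
Definition mu_BBH (A : set schur_space) : \bar R :=
  (\sum_(0 <= g <oo) (mu_CL g)%:E * tuple_prod (mu g) g
     [set r | exists2 a : schur_space, A a &
        d_eq p (class_repr a) g /\ isomorphic (presented r) (class_repr a)])%E.

Definition mu_BBH_level c (P : topGroupType) : \bar R :=
  mu_BBH [set a | isomorphic (Q p c (class_repr a)) P].

End BBH.

(* Main.v *)
(** Sending relators r to the group they present turns mu_BBH into the sum over g of
    mu_CL(g) times an image of the product measure on X^g. Up to a null set, r presents
    a Schur sigma-group: this happens exactly when the matrix of the exponents of the
    relators in (Z_p)^g has a nonzero determinant. The equivariant surjections from the
    presented group to H are those from F_g that kill all the relators. An equivariant
    surjection from F_g maps the relators to independent and uniform elements of
    Y = {h in Phi(H) : sigma(h) = h^-1}, so that it kills them with probability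
    |Y|^-g. As sigma-inverted elements are equidistributed over H/Phi(H), of rank d,
    there are |Y|^g prod_(i < d) (p^g - p^i) such surjections. Hence the integral is
    sum_g mu_CL(g) prod_(i < d) (p^g - p^i), which is 1 by Durfee's identity
    sum_k q^(k(k+d)) / ((q)_k (q)_(k+d)) = 1 / (q)_oo at q = 1/p. The integral also
    splits along the countably many classes of the groups Q_c(G), on which the number
    of surjections only depends. *)

(* The profinite statements are brought down to finite levels. A count of surjections onto a group
   of class [c] sees only [Q p c], so GI-automorphisms matter only up to conjugacy there, where the
   product of two of them has odd order. The equidistribution of inverted elements rests on twisted
   conjugations [x |-> a^-1 * x * sigma a]; reaching every fibre takes square roots, hence an odd
   [p]. Instead of determinants over Z_p, the proof uses determinants over Z/p^m for all m: shifting
   a matrix by scalars divisible by p shows that few of them are singular. A nonzero determinant at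
   a single level gives a finite abelianization by Cramer's rule, and also functions on F_g dual to
   the relators; as H^2(F_g) vanishes, these yield r = g. Finally, [mu_BBH] is given by a formula on
   all sets, without a measure structure; it is replaced by a genuine measure that agrees with it on
   Omega. *)
From HB Require Import structures.
Require Import Defs.
From mathcomp Require Import all_boot all_order all_algebra all_fingroup all_solvable.
From mathcomp Require Import mxalgebra mxrepresentation mxabelem finmap.
From mathcomp Require Import lra.
From mathcomp Require Import all_classical all_reals all_analysis measurable_realfun.

Set Implicit Arguments.
Unset Strict Implicit.
Unset Printing Implicit Defensive.

Import Order.TTheory GRing.Theory Num.Theory numFieldNormedType.Exports.

Local Open Scope classical_set_scope.

(** * Closed subgroups, quotients and homomorphisms *)

Section Subgroups.

Local Open Scope group_scope.

Section Morphisms.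
Variables (G H : groupType) (f : G -> H).
Hypothesis fM : {morph f : x y / x * y}.

Lemma morph_g1 : f 1 = 1.
Proof. by apply: (@mulIg _ (f 1)); rewrite -fM !mul1g. Qed.

Lemma morph_gV x : f x^-1 = (f x)^-1.
Proof. by apply: (@mulIg _ (f x)); rewrite -fM !mulVg morph_g1. Qed.

Lemma morph_gX n x : f (x ^+ n) = f x ^+ n.
Proof. by elim: n => [|n IH]; rewrite ?expg0 ?morph_g1 // !expgS fM IH. Qed.

Lemma morph_gJ x y : f (x ^ y) = f x ^ f y.
Proof. by rewrite /conjg !fM morph_gV. Qed.

Lemma morph_gR x y : f [~ x, y] = [~ f x, f y].
Proof. by rewrite !commgEl fM morph_gV morph_gJ. Qed.

End Morphisms.

Section ClosedSubgroups.
Variable G : topGroupType.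
Implicit Types (A B : set G) (N : closedNormal G).

Lemma closed_subgroup1 A : closed_subgroup A -> A 1.
Proof. by case. Qed.

Lemma closed_subgroupV A x : closed_subgroup A -> A x -> A x^-1.
Proof. by case=> _ A1 AF Ax; have := AF _ _ A1 Ax; rewrite mul1g. Qed.

Lemma closed_subgroupM A x y : closed_subgroup A -> A x -> A y -> A (x * y).
Proof.
by move=> Asub Ax /(closed_subgroupV Asub); case: Asub => _ _ AF AVy; rewrite -[y]invgK; exact: AF.
Qed.

Lemma closed_subgroupX A x n : closed_subgroup A -> A x -> A (x ^+ n).
Proof.
move=> Asub Ax; elim: n => [|n IH]; first exact: closed_subgroup1.
by rewrite expgS; exact: closed_subgroupM.
Qed.

Lemma closed_gen_min A B : closed_subgroup B -> A `<=` B -> closed_gen A `<=` B.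
Proof. by move=> Bsub AB x; apply; split. Qed.

Lemma sub_closed_gen A : A `<=` closed_gen A.
Proof. exact: sub_gen_smallest. Qed.

Lemma cn_1 N : cn_set N 1. Proof. exact: closed_subgroup1 (cn_subgroup N). Qed.
Lemma cn_V N x : cn_set N x -> cn_set N x^-1. Proof. exact: closed_subgroupV (cn_subgroup N). Qed.
Lemma cn_M N x y : cn_set N x -> cn_set N y -> cn_set N (x * y).
Proof. exact: closed_subgroupM (cn_subgroup N). Qed.
Lemma cn_X N x n : cn_set N x -> cn_set N (x ^+ n).
Proof. exact: closed_subgroupX (cn_subgroup N). Qed.
Lemma cn_closed N : closed (N : set G). Proof. by case: (cn_subgroup N). Qed.
Lemma cn_J N x y : cn_set N x -> cn_set N (x ^ y). Proof. exact: cn_normal. Qed.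

Lemma closed_normal_closure_min A N :
  A `<=` N -> closed_normal_closure A `<=` (N : set G).
Proof.
by move=> AN x; apply; split => //; split; [exact: cn_subgroup|exact: cn_normal].
Qed.

Lemma sub_closed_normal_closure A : A `<=` closed_normal_closure A.
Proof. exact: sub_gen_smallest. Qed.

(** In a finite set closed under products, the powers of [y] repeat, so [y^-1] is one of them. *)
Lemma closed_finite_set1_gen A : hausdorff_space G -> finite_set A ->
  A 1 -> (forall x y, A x -> A y -> A (x * y)) -> closed_subgroup A.
Proof.
move=> hG finA A1 AM; split => //.
  by apply: compact_closed => //; exact: finite_compact.
move=> x y Ax Ay; apply: (AM) => //.
have Ayn n : A (y ^+ n) by elim: n => [//|n IH]; rewrite expgS; exact: AM.
have [m [n [mn yE]]] : exists m n, (m < n)%N /\ y ^+ m = y ^+ n.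
  apply: contrapT => ninj.
  have inj : {in [set: nat] &, injective (fun n => y ^+ n)}.
    move=> m n _ _ ymn; apply: contrapT => /eqP; rewrite neq_ltn => /orP[mn|nm].
      by apply: ninj; exists m, n.
    by apply: ninj; exists n, m.
  apply: infinite_nat; have := sub_finite_set (fun z (h : [set y ^+ n | n in [set: nat]] z) =>
    let: ex_intro2 n _ e := h in eq_ind _ A (Ayn n) _ e) finA.
  by rewrite (eq_finite_set (inj_card_eq inj)).
suff -> : y^-1 = y ^+ (n - m).-1 by [].
have nm : (0 < n - m)%N by rewrite subn_gt0.
have e1 : y ^+ (n - m) = 1.
  by apply: (@mulIg _ (y ^+ m)); rewrite -expgnDr subnK ?mul1g// ltnW.
by apply: (@mulgI _ y); rewrite mulgV -expgS prednK.
Qed.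

End ClosedSubgroups.

Section ContinuousMorphisms.
Variables (G H : topGroupType) (f : G -> H).
Hypotheses (fc : continuous f) (fM : {morph f : x y / x * y}).

Lemma closed_subgroup_preimage (B : set H) :
  closed_subgroup B -> closed_subgroup (f @^-1` B).
Proof.
move=> [cB B1 BF]; split.
- by apply: closed_comp => // x _; exact: fc.
- by rewrite /= morph_g1.
- by move=> x y /= Bx By; rewrite fM morph_gV//; exact: BF.
Qed.

Lemma conj_invariant_preimage (B : set H) :
  conj_invariant B -> conj_invariant (f @^-1` B).
Proof. by move=> cB x y /= Bx; rewrite morph_gJ//; exact: cB. Qed.

Definition cn_preimage (N : closedNormal H) : closedNormal G :=
  ClosedNormal (closed_subgroup_preimage (cn_subgroup N))
    (conj_invariant_preimage (cn_normal (c := N))).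

Lemma lower_pcentral_morph p n x :
  cn_set (lower_pcentral G p n) x -> cn_set (lower_pcentral H p n) (f x).
Proof.
elim: n x => [//|n IH] x.
apply: (closed_gen_min (B := cn_preimage (lower_pcentral H p n.+1))).
  exact: cn_subgroup.
move=> _ [[a _ [b Pb <-]]|[b Pb <-]] /=; apply: sub_closed_gen.
  by left; exists (f a) => //; exists (f b); [exact: IH|rewrite morph_gR].
by right; exists (f b); [exact: IH|rewrite morph_gX].
Qed.

Lemma closed_subgroup_image (A : set G) : compact [set: G] -> hausdorff_space H ->
  closed_subgroup A -> closed_subgroup (f @` A).
Proof.
move=> cG hH [cA A1 AF]; split.
- apply: compact_closed => //; apply: continuous_compact.
    exact: continuous_subspaceT.
  exact: subclosed_compact cA cG _.
- by exists 1; rewrite ?morph_g1.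
- by move=> _ _ [x Ax <-] [y Ay <-]; exists (x * y^-1); [exact: AF|rewrite fM morph_gV].
Qed.

(** Compactness serves the inclusion from right to left: the image of P_(n+1)(G) must be closed in
    order to contain the closed subgroup generated by the lifted commutators and powers. *)
Lemma lower_pcentral_image p n : compact [set: G] -> hausdorff_space H ->
  range f = setT -> f @` (lower_pcentral G p n) = lower_pcentral H p n.
Proof.
move=> cG hH fT; apply/seteqP; split.
  by move=> _ [x Px <-]; exact: lower_pcentral_morph.
elim: n => [|n IH]; first by rewrite /= fT.
apply: closed_gen_min.
  by apply: closed_subgroup_image => //; exact: cn_subgroup.
have fS y : exists x, f x = y.
  by have : range f y by [rewrite fT]; move=> [x _ <-]; exists x.
move=> _ [[a _ [b Pb <-]]|[b Pb <-]]; have [y Py <-] := IH _ Pb.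
  have [x <-] := fS a; exists [~ x, y]; last by rewrite morph_gR.
  by apply: sub_closed_gen; left; exists x => //; exists y.
exists (y ^+ p); last by rewrite morph_gX.
by apply: sub_closed_gen; right; exists y.
Qed.

End ContinuousMorphisms.

Lemma closed_set1 (T : topologicalType) (x : T) : hausdorff_space T -> closed [set x].
Proof. by move=> hT; apply: compact_closed => //; exact: compact_set1. Qed.

Lemma closed_subgroup_set1 (G : topGroupType) : hausdorff_space G ->
  closed_subgroup [set (1 : G)].
Proof.
by move=> hG; split=> // [|x y -> ->]; [exact: closed_set1|rewrite /= mulgV].
Qed.

Lemma conj_invariant_set1 (G : topGroupType) : conj_invariant [set (1 : G)].
Proof. by move=> x y -> /=; rewrite conj1g. Qed.

Section LowerCentral.
Variables (G : topGroupType) (p : nat).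

Lemma lower_pcentralR n x y :
  cn_set (lower_pcentral G p n) y -> cn_set (lower_pcentral G p n.+1) [~ x, y].
Proof. by move=> Py; apply: sub_closed_gen; left; exists x => //; exists y. Qed.

Lemma lower_pcentralX n y :
  cn_set (lower_pcentral G p n) y -> cn_set (lower_pcentral G p n.+1) (y ^+ p).
Proof. by move=> Py; apply: sub_closed_gen; right; exists y. Qed.

Lemma lower_pcentralS n : lower_pcentral G p n.+1 `<=` lower_pcentral G p n.
Proof.
apply: closed_gen_min; first exact: cn_subgroup.
move=> _ [[a _ [b Pb <-]]|[b Pb <-]]; last exact: (cn_X (N := lower_pcentral G p n)).
rewrite commgEr; apply: (cn_M (N := lower_pcentral G p n)) => //.
exact/(cn_J (N := lower_pcentral G p n))/cn_V.
Qed.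

Lemma lower_pcentral_le m n : (m <= n)%N -> lower_pcentral G p n `<=` lower_pcentral G p m.
Proof.
elim: n => [|n IH]; first by rewrite leqn0 => /eqP ->.
rewrite leq_eqVlt ltnS => /orP[/eqP -> //|/IH]; apply: subset_trans.
exact: lower_pcentralS.
Qed.

End LowerCentral.

Lemma continuous_morph_eq (G H : topGroupType) (f h : G -> H) (A : set G) :
  hausdorff_space H -> continuous f -> continuous h ->
  {morph f : x y / x * y} -> {morph h : x y / x * y} ->
  top_generates A -> (forall x, A x -> f x = h x) -> f = h.
Proof.
move=> hH fc hc fM hM Agen fhA; apply/funext => x.
suff : closed_gen A `<=` [set x | f x = h x] by rewrite Agen; exact.
apply: closed_gen_min => //; split.
- have -> : [set x | f x = h x] = (fun x => f x * (h x)^-1) @^-1` [set 1].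
    apply/seteqP; split=> z /= => [->|]; first by rewrite mulgV.
    by move=> /(congr1 (fun t => t * h z)); rewrite mulgVK mul1g.
  apply: closed_comp; last exact: closed_set1.
  move=> z _; apply: (@continuous_comp _ _ _ (fun x : G => (f x, (h x)^-1))
    (fun xy : H * H => xy.1 * xy.2)); last exact: mulg_continuous.
  apply: cvg_pair => /=; first exact: fc.
  apply: (@continuous_comp _ _ _ h (fun x : H => x^-1)); first exact: hc.
  exact: invg_continuous.
- by rewrite /= !morph_g1.
- by move=> a b /= fa fb; rewrite fM hM (morph_gV fM) (morph_gV hM) fa fb.
Qed.

Section Projection.
Variables (G : topGroupType) (N : closedNormal G).

(** The unlocked form of the canonical projection: openness of a set of cosets then unfolds by
    conversion, as in [qpi_openP]. *)
Definition qpi (x : G) : quot N := quot_pi N x.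

Lemma qpiE : \pi_(quot N)%qT = qpi.
Proof. exact: quot_pi_unlock. Qed.

Lemma qpiM : {morph qpi : x y / x * y}.
Proof. by move=> x y; rewrite -qpiE; exact/esym/quot_mulE. Qed.

Lemma qpi_continuous : continuous qpi.
Proof. by rewrite -qpiE; exact: quot_pi_continuous. Qed.

Lemma qpi_eq x y : qpi x = qpi y <-> cn_set N (x^-1 * y).
Proof. by rewrite -qpiE; exact: quot_piE. Qed.

Lemma qpi_eq1 x : qpi x = 1 <-> cn_set N x.
Proof.
rewrite -(morph_g1 qpiM); split=> [/esym/qpi_eq|Nx]; rewrite ?invg1 ?mul1g//.
by apply/esym/qpi_eq; rewrite invg1 mul1g.
Qed.

Lemma qpi_surj (a : quot N) : exists x, a = qpi x.
Proof. by exists (generic_quotient.repr a); rewrite -qpiE reprK. Qed.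

Lemma qpi_range : range qpi = setT.
Proof. by apply/seteqP; split=> // a _; have [x ->] := qpi_surj a; exists x. Qed.

Definition qrepr (a : quot N) : G := generic_quotient.repr a.

Lemma qreprK a : qpi (qrepr a) = a.
Proof. by rewrite -qpiE reprK. Qed.

Lemma qpi_openP (U : set (quot N)) : open U <-> open (qpi @^-1` U).
Proof. by []. Qed.

Lemma closed_qpi (A : set (quot N)) : closed A <-> closed (qpi @^-1` A).
Proof.
by rewrite -!openC preimage_setC qpi_openP.
Qed.

Lemma qpi_factor_continuous (T : topologicalType) (f : quot N -> T) :
  continuous (f \o qpi) -> continuous f.
Proof.
move=> /continuousP fc; apply/continuousP => U oU; rewrite qpi_openP.
by rewrite -comp_preimage; exact: fc.
Qed.

Lemma qpi_lift (H : topGroupType) (f : G -> H) : continuous f ->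
  {morph f : x y / x * y} -> (forall x, cn_set N x -> f x = 1) ->
  exists2 h : quot N -> H, continuous h /\ {morph h : x y / x * y} &
    forall x, h (qpi x) = f x.
Proof.
move=> fc fM fN; exists (f \o qrepr).
  have fE x : f (qrepr (qpi x)) = f x.
    have /qpi_eq/fN : qpi (qrepr (qpi x)) = qpi x by rewrite qreprK.
    by rewrite fM morph_gV// => /(congr1 (fun t => f (qrepr (qpi x)) * t)); rewrite mulVKg mulg1.
  split; last first.
    move=> a b; have [[x ->] [y ->]] := (qpi_surj a, qpi_surj b).
    by rewrite -qpiM /= !fE fM.
  by apply: qpi_factor_continuous => x; rewrite (_ : _ \o _ = f)//; apply/funext => z /=.
move=> x /=; have /qpi_eq/fN : qpi (qrepr (qpi x)) = qpi x by rewrite qreprK.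
by rewrite fM morph_gV// => /(congr1 (fun t => f (qrepr (qpi x)) * t)); rewrite mulVKg mulg1.
Qed.

Lemma quot_eq_morph (H : Type) (f h : quot N -> H) :
  (forall x, f (qpi x) = h (qpi x)) -> f = h.
Proof. by move=> fh; apply/funext => a; have [x ->] := qpi_surj a. Qed.

End Projection.

End Subgroups.

(** * Open normal subgroups of compact groups *)

Section OpenNormalSubgroups.

(** * Compact totally disconnected spaces are zero-dimensional *)

Section ZeroDimensional.
Variable T : topologicalType.
Hypotheses (hT : hausdorff_space T) (cT : compact [set: T]).

(** The quasi-component of [x]. In a compact Hausdorff space it turns out to be connected, hence
    contained in the component. *)
Let quasi (x : T) : set T := [set y | forall C, clopen C -> C x -> C y].

Let quasi_closed x : closed (quasi x).
Proof.
have -> : quasi x = \bigcap_(C in [set C : set T | clopen C /\ C x]) C.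
  by apply/seteqP; split => y /= Qy C; [case=> ? ?|move=> ? ?]; exact: Qy.
by apply: closed_bigI => C [[]].
Qed.

Let quasi_sub_open x (O : set T) : open O -> quasi x `<=` O ->
  exists C, [/\ clopen C, C x & C `<=` O].
Proof.
move=> oO QO.
have : compact (~` O) by apply: (subclosed_compact _ cT) => //; exact: open_closedC.
(* [compact_cover] speaks of pointed spaces; [x] serves as the base point. *)
pose pT : ptopologicalType := HB.pack T (isPointed.Build T x).
rewrite -[compact]/(@compact pT) compact_cover.
move=> /(_ _ [set C | clopen C /\ C x] (fun C => ~` C))[].
- by move=> C [[_ cC] _]; exact: closed_openC.
- move=> y nOy; apply: contrapT => nC; apply/nOy/QO => C cC Cx; apply: contrapT => Cy.
  by apply: nC; exists C.
move=> D DC Dcov; exists (\bigcap_(C in [set` D]) C); split.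
- rewrite bigcap_fset big_seq; apply: (big_ind (@clopen T)) => [||C /DC/set_mem[]//].
    exact: clopenT.
  exact: clopenI.
- by move=> C /DC/set_mem[].
- move=> y Dy; apply: contrapT => /Dcov[C CD]; apply; exact: Dy.
Qed.

(** A separation of the quasi-component into closed sets [B] and [D] extends, by normality, to
    disjoint open sets. A clopen neighbourhood [K] of [x] inside their union is cut by them into two
    clopen sets, and the one containing [x] contains the whole quasi-component. *)
Let quasi_connected x : connected (quasi x).
Proof.
move=> B B0 [W oW BW] [C cC BC].
pose D := quasi x `&` ~` W.
have cB : closed B by rewrite BC; exact: closedI.
have cD : closed D by apply: closedI => //; exact: open_closedC.
have QBD y : quasi x y -> B y \/ D y.
  by move=> Qy; have [Oy|nOy] := pselect (W y); [left; rewrite BW|right].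
have BD y : B y -> ~ D y by rewrite BW => -[_ Oy] [].
have [|U BU UD] := @compact_normal T hT cT B cB (~` D).
  by move=> y By; apply: open_nbhs_nbhs; split; [exact: closed_openC|exact: BD].
pose V := ~` closure U.
have oV : open V by apply: closed_openC; exact: closed_closure.
have BU' : B `<=` U° by move=> y /BU.
have DV : D `<=` V by move=> y Dy Uy; exact: UD Uy Dy.
have [||K [[oK cK] Kx KUV]] := @quasi_sub_open x (U° `|` V).
- by apply: openU => //; exact: open_interior.
- by move=> y /QBD[/BU'|/DV]; [left|right].
have KUE : K `&` U° = K `&` closure U.
  apply/seteqP; split => y [Ky Uy]; split=> //.
    by apply: subset_closure; exact: interior_subset.
  by have [//|] := KUV _ Ky.
have KVE : K `&` V = K `&` ~` U°.
  apply/seteqP; split => y [Ky Uy]; split=> //.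
    by move=> /interior_subset/subset_closure.
  by have [//|] := KUV _ Ky.
have clU : clopen (K `&` U°).
  split; first by apply: openI => //; exact: open_interior.
  by rewrite KUE; apply: closedI => //; exact: closed_closure.
have clV : clopen (K `&` V).
  split; first exact: openI.
  by rewrite KVE; apply: closedI => //; apply: open_closedC; exact: open_interior.
have Qx : quasi x x by move=> ?.
have [Bx|Dx] := QBD x Qx; apply/seteqP; split => y.
- by rewrite BW => -[].
- move=> Qy; have [//|Dy] := QBD _ Qy.
  have [_ /interior_subset/subset_closure Uy] := Qy _ clU (conj Kx (BU' _ Bx)).
  by case: (DV _ Dy).
- by rewrite BW => -[].
- have [z Bz] := B0.
  have Qz : quasi x z by move: Bz; rewrite BW => -[].
  have [_ Vz] := Qz _ clV (conj Kx (DV _ Dx)).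
  by case: Vz; apply: subset_closure; apply: interior_subset; exact: BU'.
Qed.

Lemma totally_disconnected_zero_dimensional :
  totally_disconnected [set: T] -> zero_dimensional T.
Proof.
move=> tT x y xy; apply: contrapT => nC.
have Qy : quasi x y.
  by move=> C cC Cx; apply: contrapT => nCy; apply: nC; exists C.
have : connected_component setT x y.
  by exists (quasi x) => //; split => //; exact: quasi_connected.
by rewrite tT//= => yx; rewrite yx eqxx in xy.
Qed.

End ZeroDimensional.

Lemma zero_dimensional_hausdorff (T : topologicalType) :
  zero_dimensional T -> hausdorff_space T.
Proof.
move=> zT x y cxy; apply: contrapT => /eqP /zT [U [[oU cU] Ux Uy]].
have [|z [Uz]] := cxy U (~` U) (open_nbhs_nbhs (conj oU Ux)).
  by apply: open_nbhs_nbhs; split => //; exact: closed_openC.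
by [].
Qed.

Local Open Scope group_scope.

Section OpenSubgroups.
Variable G : topGroupType.

Lemma open_of_nbhs1 (A : set G) : (forall x y, A x -> A y -> A (x * y)) ->
  nbhs (1 : G) A -> open A.
Proof.
move=> AM A1; rewrite openE => x Ax; rewrite /interior.
have A1' : nbhs (x^-1 * x) A by rewrite mulVg.
have : nbhs x ((fun y => x^-1 * y) @^-1` A) := @mulg_left_continuous G x^-1 x A A1'.
by apply: filterS => y /= Ay; rewrite -[y](mulKVg x); exact: AM.
Qed.

Lemma open_subgroup_closed (A : set G) : open A -> A 1 ->
  (forall x y, A x -> A y -> A (x * y^-1)) -> closed_subgroup A.
Proof.
move=> oA A1 AF; split => //.
have AV x : A x -> A x^-1 by move=> /(AF _ _ A1); rewrite mul1g.
have -> : A = ~` (\bigcup_(x in ~` A) [set y | A (x^-1 * y)]).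
  apply/seteqP; split=> y /=.
    move=> Ay [x nAx /= Axy]; apply: nAx.
    by have := AF _ _ Ay Axy; rewrite invMg invgK mulKVg.
  by apply: contra_notP => nAy; exists y => //=; rewrite mulVg.
apply: open_closedC; apply: bigcup_open => x _.
by apply: open_comp => // y _; exact: mulg_left_continuous.
Qed.

Hypothesis cG : compact [set: G].

(** Take a clopen neighbourhood [D] of 1 inside [U]. The elements all of whose conjugates map [D]
    into itself by right translation form a conjugation-invariant set [W] inside [D], closed under
    products. The elements of [W] with inverse in [W] form the subgroup. *)
Lemma open_normal_basis (U : set G) :
  zero_dimensional G -> nbhs 1 U ->
  exists2 N : closedNormal G, open (N : set G) & N `<=` U.
Proof.
move=> zG U1; have hG := zero_dimensional_hausdorff zG.
have [D [D1 [oD cD]] DU] := zero_dimensional_cvg hG zG cG U1.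
pose W := [set x : G | forall gd : G * G, D gd.2 -> D (gd.2 * x ^ gd.1)].
(* A tube argument: for each [(g, d)], the element [d * x ^ g] stays in the open set [D] for [x]
   near 1, hence uniformly over the compact set of pairs. *)
have W1 : nbhs 1 W.
  have /compact_near_coveringP : compact ([set: G] `*` D).
    by apply: compact_setX => //; exact: subclosed_compact cD cG _.
  move=> /(_ _ (nbhs (1 : G)) (fun x gd => D (gd.2 * x ^ gd.1)) (nbhs_filter _)) cov.
  have {cov} : \forall x \near nbhs (1 : G), [set: G] `*` D `<=` (fun gd => D (gd.2 * x ^ gd.1)).
    apply: cov.
    move=> [g d] /= [_ Dd].
    have c : continuous (fun z : (G * G) * G => z.1.2 * (z.2 ^ z.1.1)).
      move=> z; rewrite /conjg.
      have cM (f h : (G * G) * G -> G) : {for z, continuous f} -> {for z, continuous h} ->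
          {for z, continuous (fun z => f z * h z)}.
        move=> cf ch; apply: (@continuous_comp _ _ _ (fun z => (f z, h z))
          (fun xy : G * G => xy.1 * xy.2)); last exact: mulg_continuous.
        by apply: cvg_pair.
      have c1 : {for z, continuous (fun z : (G * G) * G => z.1.1)}.
        by apply: (@continuous_comp _ _ _ fst fst); exact: cvg_fst.
      have c2 : {for z, continuous (fun z : (G * G) * G => z.1.2)}.
        by apply: (@continuous_comp _ _ _ fst snd); [exact: cvg_fst|exact: cvg_snd].
      have c3 : {for z, continuous (fun z : (G * G) * G => z.2)} by exact: cvg_snd.
      apply: (cM _ _ c2); apply: (cM _ _ _ (cM _ _ c3 _)) => //.
      by apply: (@continuous_comp _ _ _ (fun z => z.1.1) (fun x : G => x^-1)) => //; exact: invg_continuous.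
    have : nbhs ((g, d), 1) ((fun z : (G * G) * G => z.1.2 * (z.2 ^ z.1.1)) @^-1` D).
      apply: c => /=; rewrite conj1g mulg1.
      exact: open_nbhs_nbhs.
    by move=> [[U1' U2'] /= [U1n U2n] U12]; exists (U1', U2').
  by apply: filterS => x Vx gd Dgd; apply: Vx; split.
have WM x y : W x -> W y -> W (x * y).
  move=> Wx Wy gd Dgd; rewrite conjMg mulgA.
  by apply: (Wy (gd.1, gd.2 * x ^ gd.1)) => /=; exact: Wx.
have WJ x y : W x -> W (x ^ y).
  by move=> Wx [g d] /= Dd; rewrite -conjgM; exact: (Wx (y * g, d)).
pose A := [set x | W x /\ W x^-1].
have A1 : nbhs 1 A.
  have W1' : nbhs (1^-1 : G) W by rewrite invg1.
  by apply: filterI => //; exact: (@invg_continuous G 1 W W1').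
have AF x y : A x -> A y -> A (x * y^-1).
  by move=> [Wx Wx'] [Wy Wy']; split; [exact: WM|rewrite invMg invgK; exact: WM].
have oA : open A.
  apply: open_of_nbhs1 => // x y [Wx Wx'] [Wy Wy'].
  by split; [exact: WM|rewrite invMg; exact: WM].
have sA : closed_subgroup A.
  by apply: open_subgroup_closed => //; exact: nbhs_singleton.
have cA : conj_invariant A.
  by move=> x y [Wx Wx']; split; [exact: WJ|rewrite -conjVg; exact: WJ].
exists (ClosedNormal sA cA) => //= x [Wx _]; apply: DU.
by have := Wx (1, 1) D1; rewrite /= conjg1 mul1g.
Qed.

Lemma open_normal_finite (N : closedNormal G) : open (N : set G) ->
  finite_set [set: quot N].
Proof.
move=> oN.
have oc (x : G) : open [set y : G | qpi N y = qpi N x].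
  have -> : [set y | qpi N y = qpi N x] = (fun y => x^-1 * y) @^-1` N.
    by apply/seteqP; split=> y /= => [/esym/qpi_eq|/qpi_eq].
  by apply: open_comp => // y _; exact: mulg_left_continuous.
pose T : ptopologicalType := HB.pack (TopologicalGroup.sort G)
  (isPointed.Build (TopologicalGroup.sort G) 1).
have : @compact T [set: T] by exact: cG.
rewrite compact_cover.
case/(_ G setT (fun x => [set y : G | qpi N y = qpi N x])) => //.
  by move=> x _; exists x.
move=> D _ DT.
have -> : [set: quot N] = qpi N @` [set` D].
  apply/seteqP; split=> // a _; have [x ->] := qpi_surj a.
  by have [y Dy /= ->] := DT x I; exists y.
exact/finite_image/finite_fset.
Qed.

Lemma quot_open_discrete (N : closedNormal G) : open (N : set G) ->
  forall A : set (quot N), open A.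
Proof.
move=> oN A; apply/qpi_openP.
have -> : qpi N @^-1` A = \bigcup_(x in qpi N @^-1` A) (fun y => x^-1 * y) @^-1` N.
  apply/seteqP; split=> y /=.
    by move=> Ay; exists y => //=; rewrite mulVg; exact: cn_1.
  by move=> [x /= Ax /qpi_eq <-].
apply: bigcup_open => x _; apply: open_comp => // y _.
exact: mulg_left_continuous.
Qed.

End OpenSubgroups.

Lemma discrete_group_zero_dimensional (P : topGroupType) :
  (forall A : set P, open A) -> zero_dimensional P.
Proof.
move=> dP x y xy; exists [set x]; split => //; last by move/esym/eqP; rewrite (negbTE xy).
by split => //; rewrite -openC.
Qed.

End OpenNormalSubgroups.

(** * Finite groups as topological groups, pro-p groups *)

Section ProPGroups.

Local Open Scope group_scope.

Section Disc.
Variable gT : finGroupType.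

(* A discrete copy of [gT] whose carrier lives in the small universe required
   by [topGroupType]. *)
Definition disc : Type := {k : nat | (k < #|gT|)%N}.
HB.instance Definition _ := Choice.on disc.

Definition ofdisc (x : disc) : gT := enum_val (Ordinal (valP x)).
Definition todisc (x : gT) : disc :=
  exist _ (nat_of_ord (enum_rank x)) (ltn_ord (enum_rank x)).

Lemma todiscK : cancel todisc ofdisc.
Proof.
move=> x; rewrite /ofdisc (_ : Ordinal _ = enum_rank x) ?enum_rankK//.
exact: val_inj.
Qed.
Lemma ofdiscK : cancel ofdisc todisc.
Proof. by move=> x; apply: val_inj; rewrite /= /ofdisc enum_valK. Qed.

Definition disc_mul x y := todisc (ofdisc x * ofdisc y).
Definition disc_inv x := todisc (ofdisc x)^-1.
Definition disc_one := todisc 1.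

Fact disc_mulA : associative disc_mul.
Proof. by move=> x y z; rewrite /disc_mul !todiscK mulgA. Qed.
Fact disc_mul1 : left_id disc_one disc_mul.
Proof. by move=> x; rewrite /disc_mul todiscK mul1g ofdiscK. Qed.
Fact disc_1mul : right_id disc_one disc_mul.
Proof. by move=> x; rewrite /disc_mul todiscK mulg1 ofdiscK. Qed.
Fact disc_mulV : left_inverse disc_one disc_inv disc_mul.
Proof. by move=> x; rewrite /disc_mul todiscK mulVg. Qed.
Fact disc_Vmul : right_inverse disc_one disc_inv disc_mul.
Proof. by move=> x; rewrite /disc_mul todiscK mulgV. Qed.

HB.instance Definition _ := @isGroup.Build disc disc_one disc_inv disc_mul
  disc_mulA disc_mul1 disc_1mul disc_mulV disc_Vmul.
HB.instance Definition _ := @isOpenTopological.Build disc setT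
  I (fun _ _ _ _ => I) (fun _ _ _ => I).

Lemma disc_open (A : set disc) : open A. Proof. by []. Qed.

Lemma disc_nbhs (x : disc) (A : set disc) : A x -> nbhs x A.
Proof. by move=> Ax; apply: open_nbhs_nbhs; split. Qed.

Fact disc_mul_continuous : continuous (fun xy : disc * disc => xy.1 * xy.2).
Proof.
move=> [x y] A /nbhs_singleton Axy.
exists ([set x]%classic, [set y]%classic); first by split; exact: disc_nbhs.
by move=> [a b] [/= -> ->].
Qed.
Fact disc_inv_continuous : continuous (fun x : disc => x^-1).
Proof. by move=> x A /nbhs_singleton Ax; apply: disc_nbhs. Qed.

HB.instance Definition _ :=
  isTopologicalGroup.Build disc disc_mul_continuous disc_inv_continuous.

Lemma ofdiscM : {morph ofdisc : x y / x * y}.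
Proof. by move=> x y; rewrite -[LHS]/(ofdisc (disc_mul x y)) todiscK. Qed.

Lemma todiscM : {morph todisc : x y / x * y}.
Proof. by move=> x y; apply: (can_inj ofdiscK); rewrite ofdiscM !todiscK. Qed.

Lemma disc_finite : finite_set [set: disc].
Proof.
have -> : [set: disc] = todisc @` [set: gT].
  by apply/seteqP; split=> // x _; exists (ofdisc x); rewrite ?ofdiscK.
exact/finite_image/finite_finset.
Qed.

Lemma disc_continuous (T : topologicalType) (f : disc -> T) : continuous f.
Proof. by apply/continuousP => A _; exact: disc_open. Qed.

End Disc.

Lemma discrete_continuous (P : topGroupType) (T : topologicalType) (f : P -> T) :
  (forall A : set P, open A) -> continuous f.
Proof. by move=> dP; apply/continuousP => A _; exact: dP. Qed.

Section FinBridge.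
Variables (G : groupType) (finG : finite_set [set: G]).

(** The finiteness proof is kept in the definition of the type, so that canonical finite structures
    can be attached to it. *)
Definition fin_of : Type := let _ := finG in G.
HB.instance Definition _ := Group.on fin_of.

Let e : seq fin_of := enum_fset (fset_set [set: G]).
Let mem_e (x : fin_of) : x \in e.
Proof. by rewrite -[x \in e]/(x \in fset_set [set: G]) in_fset_set//; exact/mem_set. Qed.

Let e_pickleK : pcancel (fun x => index x e) (fun n => nth None (map Some e) n).
Proof.
by move=> x; rewrite (nth_map x) ?nth_index ?index_mem.
Qed.

HB.instance Definition _ := isCountable.Build fin_of e_pickleK.

Let e_axiom : Finite.axiom e.
Proof. by move=> x; rewrite count_uniq_mem ?fset_uniq// mem_e. Qed.

HB.instance Definition _ := fintype.isFinite.Build fin_of e_axiom.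

Lemma card_fin_of n : ([set: G] #= `I_n)%card <-> #|{: fin_of}| = n.
Proof.
have eE : size e = #|{: fin_of}|.
  rewrite cardT; apply/perm_size/uniq_perm; rewrite ?fset_uniq ?enum_uniq//.
  by move=> x; rewrite mem_enum mem_e.
rewrite -eE; have -> : ([set: G] #= `I_n)%card = (size e == n) :> bool.
  have -> : [set: G] = [set` fset_set [set: G]] by rewrite fset_setK.
  by apply/idP/eqP => /card_eq_fsetP.
by split=> /eqP.
Qed.

End FinBridge.

Section PGroups.
Variable p : nat.
Hypothesis p_prime : prime p.

(** By Cauchy's theorem every prime divisor of the order of the group is the order of an element,
    hence equal to [p] if all orders are powers of [p]. *)
Lemma pgroup_elementP (G : groupType) (finG : finite_set [set: G]) :
  (exists n, ([set: G] #= `I_(p ^ n))%card) <->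
  (forall x : G, exists n, x ^+ (p ^ n) = 1).
Proof.
split=> [[n /(card_fin_of finG) cG] x|xp].
  exists n; rewrite -cG -cardsT.
  exact: (@expg_cardG (fin_of finG) [set: fin_of finG]%G (x : fin_of finG)
    (finset.in_setT _)).
have /p_natP [n cn] : p.-nat #|{: fin_of finG}|.
  rewrite -cardsT; apply/pgroupP => q q_pr /(Cauchy q_pr)[x _ xq].
  have [n xn] := xp x; have : (q %| p ^ n)%N by rewrite -xq order_dvdn; apply/eqP.
  by rewrite Euclid_dvdX// => /andP[]; rewrite dvdn_prime2// => /eqP ->.
by exists n; apply/card_fin_of.
Qed.

(** A condition on elements replaces the one on cardinals: it is easier to check for quotients and
    extensions. *)
Lemma pro_pP (G : topGroupType) : pro_p p G <->
  [/\ compact [set: G], zero_dimensional G &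
      forall N : closedNormal G, open (N : set G) ->
        forall x, exists n, cn_set N (x ^+ (p ^ n))].
Proof.
split=> [[[cG hG tG] Gp]|[cG zG Gp]].
  split=> //; first exact: totally_disconnected_zero_dimensional.
  move=> N oN x.
  have [n xn] := (pgroup_elementP (open_normal_finite cG oN)).1 (Gp N oN) (qpi N x).
  by exists n; apply/qpi_eq1; rewrite (morph_gX (@qpiM _ N)).
split; first split => //.
- exact: zero_dimensional_hausdorff.
- exact: zero_dimension_totally_disconnected.
move=> N oN; apply/(pgroup_elementP (open_normal_finite cG oN)) => a.
have [x ->] := qpi_surj a; have [n xn] := Gp N oN x.
by exists n; rewrite -(morph_gX (@qpiM _ N)); apply/qpi_eq1.
Qed.

Lemma pro_p_compact G : pro_p p G -> compact [set: G].
Proof. by case=> -[]. Qed.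

Lemma pro_p_hausdorff G : pro_p p G -> hausdorff_space G.
Proof. by case=> -[]. Qed.

Lemma pro_p_quot_finite (G : topGroupType) (N : closedNormal G) :
  pro_p p G -> open (N : set G) -> finite_pgroup p (quot N).
Proof. by move=> [_ Gp] oN; split; [exact: quot_open_discrete|exact: Gp]. Qed.

Lemma finite_pgroup_finite P : finite_pgroup p P -> finite_set [set: P].
Proof. by case=> _ [n Pn]; apply/finite_setP; exists (p ^ n)%N. Qed.

Lemma finite_pgroup_element P : finite_pgroup p P ->
  forall x : P, exists n, x ^+ (p ^ n) = 1.
Proof.
move=> Pp; apply/(pgroup_elementP (finite_pgroup_finite Pp)).
by case: Pp.
Qed.

Lemma discrete_pro_p (P : topGroupType) : (forall A : set P, open A) ->
  finite_set [set: P] -> (forall x : P, exists n, x ^+ (p ^ n) = 1) -> pro_p p P.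
Proof.
move=> dP finP Pp; apply/pro_pP; split.
- exact: finite_compact.
- exact: discrete_group_zero_dimensional.
- by move=> N _ x; have [n xn] := Pp x; exists n; rewrite xn; exact: cn_1.
Qed.

Lemma finite_pgroup_pro_p P : finite_pgroup p P -> pro_p p P.
Proof.
move=> Pp; apply: discrete_pro_p; first by case: Pp.
- exact: finite_pgroup_finite.
- exact: finite_pgroup_element.
Qed.

Lemma disc_element (gT : finGroupType) : p.-nat #|gT| ->
  forall x : disc gT, exists n, x ^+ (p ^ n) = 1.
Proof.
move=> /p_natP [n cn] x; exists n.
apply: (can_inj (@ofdiscK gT)); rewrite (morph_gX (@ofdiscM gT)) -cn.
by rewrite (morph_g1 (@ofdiscM gT)) -cardsT (@expg_cardG gT [set: gT]%G) ?inE.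
Qed.

Lemma disc_pro_p (gT : finGroupType) : p.-nat #|gT| -> pro_p p (disc gT).
Proof.
by move=> pT; apply: discrete_pro_p; [|exact: disc_finite|exact: disc_element].
Qed.

Lemma disc_finite_pgroup (gT : finGroupType) : p.-nat #|gT| ->
  finite_pgroup p (disc gT).
Proof.
move=> pT; split; first by [].
apply/(pgroup_elementP (@disc_finite gT)) => x; exact: disc_element.
Qed.

Lemma open_normal_sep (G : topGroupType) (A : set G) x : pro_p p G -> closed A ->
  ~ A x -> exists2 U : closedNormal G, open (U : set G) &
    forall u, cn_set U u -> ~ A (x * u).
Proof.
move=> /pro_pP[cG zG _] cA nAx.
have : nbhs (1 : G) ((fun u => x * u) @^-1` ~` A).
  apply: (@mulg_left_continuous G x 1 (~` A)); apply: open_nbhs_nbhs; split.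
    exact: closed_openC.
  by rewrite mulg1.
by move=> /(open_normal_basis cG zG)[U oU UA]; exists U.
Qed.

Lemma open_normal_zero_dimensional (G : topGroupType) :
  (forall x : G, x <> 1 -> exists2 U : closedNormal G, open (U : set G) & ~ cn_set U x) ->
  zero_dimensional G.
Proof.
move=> sepG x y /eqP xy; have [|U oU nU] := sepG (x^-1 * y).
  by move=> e; apply: xy; apply: (@mulgI _ x^-1); rewrite mulVg.
exists ((fun y => x^-1 * y) @^-1` U); split=> //=; last by rewrite mulVg; exact: cn_1.
split.
  by apply: open_comp => // z _; exact: mulg_left_continuous.
by apply: closed_comp => [z _|]; [exact: mulg_left_continuous|exact: cn_closed].
Qed.

Lemma quot_pro_p (G : topGroupType) (N : closedNormal G) :
  pro_p p G -> pro_p p (quot N).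
Proof.
move=> Gp; have /pro_pP[cG zG Gx] := Gp; apply/pro_pP; split.
- rewrite -(qpi_range N); apply: continuous_compact => //.
  exact/continuous_subspaceT/qpi_continuous.
- apply: open_normal_zero_dimensional => a; have [x ->] := qpi_surj a => x1.
  (* Separating [x^-1] from [N] puts [x^-1 * u] outside [N] for all [u] in [U], so that the class of
     [x] is not in the image of [U]. *)
  have nNx : ~ cn_set N x^-1 by move=> /cn_V; rewrite invgK => /qpi_eq1.
  have [U oU UN] := open_normal_sep Gp (@cn_closed _ N) nNx.
  pose V := qpi N @` U.
  have oV : open V by rewrite /V -qpiE; exact: quot_pi_open.
  have V1 : V 1 by exists 1; [exact: cn_1|rewrite (morph_g1 (@qpiM _ N))].
  have VF c d : V c -> V d -> V (c * d^-1).
    move=> [u Uu <-] [v Uv <-]; exists (u * v^-1); first by apply: cn_M => //; exact: cn_V.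
    by rewrite qpiM (morph_gV (@qpiM _ N)).
  have VJ : conj_invariant V.
    move=> _ b [u Uu <-]; have [y ->] := qpi_surj b.
    by exists (u ^ y); [exact: cn_J|rewrite (morph_gJ (@qpiM _ N))].
  exists (ClosedNormal (open_subgroup_closed oV V1 VF) VJ) => //= -[u Uu ux].
  apply: (UN u Uu); apply/qpi_eq1; rewrite qpiM ux (morph_gV (@qpiM _ N)).
  by rewrite mulVg.
- move=> M oM a; have [x ->] := qpi_surj a.
  have [n xn] := Gx (cn_preimage (@qpi_continuous _ N) (@qpiM _ N) M) oM x.
  by exists n; rewrite -(morph_gX (@qpiM _ N)).
Qed.

(** This comes out of the uniqueness in the universal property. If the closed subgroup were proper,
    its image in some finite quotient would lie in a maximal subgroup, normal because the quotient
    is a p-group. The preimage [N] contains the basis, so the projection to [F / N] and the trivial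
    map agree on the basis, although they differ. *)
Lemma free_pro_p_generates g (F : topGroupType) (x : 'I_g -> F) :
  free_pro_p p x -> top_generates (range x).
Proof.
move=> [Fp Fu]; apply/seteqP; split => // y _.
set C := closed_gen _; have Csub : closed_subgroup C := closed_gen_subgroup _.
apply: contrapT => nCy.
have [U oU UC] := open_normal_sep Fp (let: And3 c _ _ := Csub in c) nCy.
have [cF _ _] := (pro_pP F).1 Fp.
have finQ := open_normal_finite cF oU.
pose Q := fin_of finQ.
pose pi : F -> Q := qpi U.
have piM : {morph pi : x y / x * y} := @qpiM _ U.
have pQ : p.-group [set: Q]%SET.
  have [_ /(_ _ oU)[n /(card_fin_of finQ) cQ]] := Fp.
  by rewrite /pgroup cardsT cQ pnatX pnat_id// orbT.
pose K := [set a : Q | `[< exists2 c, C c & pi c = a >]]%SET.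
have gK : group_set K.
  apply/group_setP; split.
    rewrite inE; apply/asboolP; exists 1; first exact: closed_subgroup1.
    exact: morph_g1 piM.
  move=> a b; rewrite !inE => -[c Cc <-] [d Cd <-].
  by exists (c * d); [exact: (closed_subgroupM Csub Cc Cd)|rewrite piM].
have piy : pi y \notin Group gK.
  apply/negP; rewrite !inE => -[c Cc /qpi_eq cy].
  by apply: (UC (c^-1 * y)^-1); [exact: cn_V|rewrite invMg invgK mulKVg].
have [KT|[M maxM KM]] := maximal_exists (finset.subsetT (Group gK)).
  by move: piy; rewrite KT finset.in_setT.
have nM : normal M [set: Q]%SET by exact: (p_maximal_normal pQ maxM).
pose A : set F := fun z => pi z \in M.
have oA : open A.
  have /continuousP cq := @qpi_continuous _ U.
  exact: (cq (fun a : quot U => (a : Q) \in M) (quot_open_discrete oU _)).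
have A1 : A 1 by rewrite /A (morph_g1 piM) group1.
have AF u v : A u -> A v -> A (u * v^-1).
  by rewrite /A => Au Av; rewrite piM (morph_gV piM) groupM ?groupV.
have AJ : conj_invariant A.
  move=> u v Au; rewrite /A (morph_gJ piM) memJ_norm//.
  by apply: (fintype.subsetP (normal_norm nM)); rewrite finset.in_setT.
pose N := ClosedNormal (open_subgroup_closed oA A1 AF) AJ.
have Np : pro_p p (quot N) by exact: quot_pro_p.
have [f [_ funiq]] := Fu _ Np (fun=> 1).
have fN : f = qpi N.
  apply: funiq; split; [exact: qpi_continuous|exact: qpiM|move=> i].
  apply/qpi_eq1; apply: (fintype.subsetP KM); rewrite !inE.
  by exists (x i) => //; apply: sub_closed_gen; exists i.
have f1 : f = fun=> 1.
  apply: funiq; split=> // [z|u v]; last by rewrite mulg1.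
  exact: cvg_cst.
have := maxgroupp maxM; rewrite fintype.properE => /andP[_ /negP]; apply; apply/fintype.subsetP => a _.
have [z ->] := qpi_surj (a : quot U).
by apply/(qpi_eq1 N z); rewrite -fN f1.
Qed.


End PGroups.

End ProPGroups.

(** * Quotients by the lower p-central series *)

Section LowerSeries.

Local Open Scope group_scope.

Section CentralExtension.
Variables (G : topGroupType) (N : closedNormal G) (p : nat).
Hypotheses (p_gt0 : (0 < p)%N) (Nc : forall x y : G, cn_set N x -> x * y = y * x).
Hypothesis Np : forall x : G, cn_set N x -> x ^+ p = 1.

(** To adjoin one element [a], take the products [a ^+ k * c] with [k < p]. Here [p] is any positive
    exponent of [N]; [finite_abelianization] uses a power of the prime. *)
Lemma finite_central_closure (B : set G) : finite_set B -> B `<=` N ->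
  exists C : set G, [/\ finite_set C, C `<=` N, B `<=` C, C 1 &
    forall x y, C x -> C y -> C (x * y)].
Proof.
move=> /finite_seqP[b ->]; elim: b => [|a b IH] abN.
  exists [set 1]%classic; split=> //; first by move=> _ ->; exact: cn_1.
  by move=> x y -> ->; rewrite /= mulg1.
have [|C [fC CN bC C1 CM]] := IH.
  by move=> x xb; apply: abN; rewrite /= inE; apply/orP; right.
have Na : cn_set N a by apply: abN; rewrite /= inE eqxx.
have aX k : a ^+ k = a ^+ (k %% p).
  by rewrite {1}(divn_eq k p) expgnDr mulnC expgnA Np// expg1n mul1g.
exists [set a ^+ k * c | k in `I_p & c in C]%classic; split.
- exact: finite_image2.
- by move=> _ [k _ [c Cc <-]]; apply: cn_M; [exact: cn_X|exact: CN].
- move=> x; rewrite /= inE => /orP[/eqP ->|/bC Cx].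
    exists (1 %% p); first by rewrite /= ltn_mod.
    by exists 1 => //; rewrite -aX mulg1.
  by exists 0; rewrite //= ?p_gt0//; exists x => //; rewrite mul1g.
- by exists 0; rewrite //= ?p_gt0//; exists 1 => //; rewrite mulg1.
- move=> _ _ [k _ [c Cc <-]] [l _ [d Cd <-]].
  exists ((k + l) %% p)%N; first by rewrite /= ltn_mod.
  exists (c * d); first exact: CM.
  by rewrite -aX expgnDr -!mulgA; congr (_ * _); rewrite !mulgA; congr (_ * _); apply/esym/Nc/CN.
Qed.

(** A section [t] of the projection is multiplicative up to finitely many central defects. With a
    finite [C] closed under products that contains these and the defects of the generators, the
    finite set of all [c * t a] is closed under products and contains [S], so it is the whole
    group. *)
Lemma finite_central_extension (S : set G) : hausdorff_space G ->
  finite_set S -> top_generates S -> finite_set [set: quot N] ->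
  finite_set [set: G].
Proof.
move=> hG fS Sgen fQ.
pose t := @qrepr G N.
have tN x : cn_set N (x * (t (qpi N x))^-1).
  apply/qpi_eq1; rewrite qpiM (morph_gV (@qpiM _ N)) qreprK mulgV//.
pose B := ([set t a * t b * (t (a * b))^-1 | a in [set: quot N] & b in [set: quot N]]
  `|` [set s * (t (qpi N s))^-1 | s in S] `|` [set (t 1)^-1])%classic.
have fB : finite_set B.
  rewrite !finite_setU; split; first split.
  - exact: finite_image2.
  - exact: finite_image.
  - exact: finite_set1.
have BN : B `<=` N.
  move=> _ [[[a _ [b _ <-]]|[s _ <-]]| ->]; [|exact: tN|].
    suff -> : a * b = qpi N (t a * t b) by exact: tN.
    by rewrite qpiM !qreprK.
  by apply: cn_V; apply/qpi_eq1; rewrite qreprK.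
have [C [fC CN BC C1 CM]] := finite_central_closure fB BN.
pose Y := [set c * t a | c in C & a in [set: quot N]]%classic.
have fY : finite_set Y by exact: finite_image2.
have Y1 : Y 1.
  by exists (t 1)^-1; [apply: BC; right|exists 1 => //; rewrite mulVg].
have YM x y : Y x -> Y y -> Y (x * y).
  move=> [c Cc [a _ <-]] [d Cd [b _ <-]].
  exists (c * d * (t a * t b * (t (a * b))^-1)).
    by apply: (CM); [exact: CM|apply: BC; left; left; exists a => //; exists b].
  exists (a * b) => //; rewrite -!mulgA; congr (_ * _).
  by rewrite mulVg mulg1 !mulgA (Nc _ (CN _ Cd)).
apply: sub_finite_set (fY) => x _.
suff : closed_gen S `<=` Y by rewrite Sgen; exact.
apply: closed_gen_min; first exact: closed_finite_set1_gen.
move=> s Ss; exists (s * (t (qpi N s))^-1); first by apply: BC; left; right; exists s.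
by exists (qpi N s) => //; rewrite mulgVK.
Qed.

End CentralExtension.

Lemma finite_hausdorff_open (G : topologicalType) : hausdorff_space G ->
  finite_set [set: G] -> forall A : set G, open A.
Proof.
move=> hG fG A; rewrite -closedC; apply: compact_closed => //.
by apply: finite_compact; exact: sub_finite_set fG.
Qed.

Lemma top_generates_image (G H : topGroupType) (f : G -> H) (A : set G) :
  continuous f -> {morph f : x y / x * y} -> range f = setT ->
  top_generates A -> top_generates (f @` A).
Proof.
move=> fc fM fT Agen; apply/seteqP; split=> // y _.
have [x _ <-] : range f y by rewrite fT.
suff : closed_gen A `<=` f @^-1` (closed_gen (f @` A)) by rewrite Agen; exact.
apply: closed_gen_min.
  by apply: closed_subgroup_preimage => //; exact: closed_gen_subgroup.
by move=> a Aa; apply: sub_closed_gen; exists a.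
Qed.

Section LowerQuotient.
Variable p : nat.
Hypothesis p_prime : prime p.
Variable G : topGroupType.
Hypothesis Gp : pro_p p G.

Lemma quot_hausdorff (N : closedNormal G) : hausdorff_space (quot N).
Proof. exact: pro_p_hausdorff (quot_pro_p p_prime N Gp). Qed.

Lemma Q_lower c n : lower_pcentral (Q p c G) p n =
  qpi (lower_pcentral G p c) @` (lower_pcentral G p n) :> set (Q p c G).
Proof.
apply/esym/lower_pcentral_image; [exact: qpi_continuous|exact: qpiM| | |exact: qpi_range].
- exact: pro_p_compact Gp.
- exact: quot_hausdorff.
Qed.

Lemma Q_lower1 c : lower_pcentral (Q p c G) p c = [set 1]%classic :> set (Q p c G).
Proof.
rewrite Q_lower; apply/seteqP; split=> [_ [x Px <-]|_ ->] /=; first exact/qpi_eq1.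
by exists 1; [exact: (cn_1 (lower_pcentral G p c))|exact: morph_g1 (@qpiM _ _)].
Qed.

Hypothesis Gfg : finitely_generated G.

(** For the induction, the image of P_c(G) in [Q p c.+1 G] is central of exponent [p], and the
    quotient by it is an image of [Q p c G]. *)
Lemma Q_finite c : finite_set [set: Q p c G].
Proof.
have [A fA Agen] := Gfg.
elim: c => [|c IH].
  have -> : [set: Q p 0 G] = [set 1]%classic.
    apply/seteqP; split=> // a _; have [x ->] := qpi_surj a.
    exact/qpi_eq1.
  exact: finite_set1.
pose H := Q p c.+1 G; pose N := lower_pcentral H p c.
have P1 (x : H) : cn_set (lower_pcentral H p c.+1) x -> x = 1.
  by move=> Px; have : [set 1]%classic x by rewrite -(Q_lower1 c.+1).
apply: (@finite_central_extension H N p (prime_gt0 p_prime) _ _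
  (qpi (lower_pcentral G p c.+1) @` A)).
- move=> x y Nx; apply/commgP/eqP; apply: (P1).
  by rewrite -invgR; apply: cn_V; exact: lower_pcentralR.
- by move=> x Nx; apply: (P1); exact: lower_pcentralX.
- exact: quot_hausdorff.
- exact: finite_image.
- by apply: top_generates_image => //; [exact: qpi_continuous|exact: qpiM|exact: qpi_range].
pose f (x : G) := qpi N (qpi (lower_pcentral G p c.+1) x).
have fM : {morph f : x y / x * y} by move=> x y; rewrite /f !qpiM.
have fc : continuous f.
  by move=> x; apply: continuous_comp; exact: qpi_continuous.
have [|h _ hE] := @qpi_lift G (lower_pcentral G p c) _ f fc fM.
  move=> x Px; apply/qpi_eq1.
  by apply: lower_pcentral_morph => //; [exact: qpi_continuous|exact: qpiM].
have -> : [set: quot N] = h @` [set: Q p c G].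
  apply/seteqP; split => // b _; have [a ->] := qpi_surj b.
  have [x ->] := qpi_surj a; exists (qpi (lower_pcentral G p c) x) => //.
exact: finite_image.
Qed.

Lemma lower_pcentral_open c : open (lower_pcentral G p c : set G).
Proof.
have := finite_hausdorff_open (@quot_hausdorff _) (Q_finite c) [set 1]%classic.
move=> /qpi_openP; congr open; apply/seteqP; split=> x /=; first by move/qpi_eq1.
by move=> Px; exact/qpi_eq1.
Qed.

Lemma Q_finite_pgroup c : finite_pgroup p (Q p c G).
Proof. by apply: pro_p_quot_finite => //; exact: lower_pcentral_open. Qed.

End LowerQuotient.

Section Counting.
Variable R : realType.

Lemma counting_image_inj (T U : choiceType) (f : T -> U) (A : set T) :
  {in A &, injective f} -> counting (f @` A) = counting A :> \bar R.
Proof.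
move=> f_inj; rewrite /counting.
have -> : finite_set (f @` A) = finite_set A.
  by apply: eq_finite_set; exact: inj_card_eq.
case: ifPn => // /asboolP fA; rewrite fset_set_image// card_in_imfset//.
by move=> x y /=; rewrite !in_fset_set//; exact: f_inj.
Qed.

End Counting.

Section SurTransfer.
Variables (G Q H : topGroupType) (q : G -> Q) (sG : G -> G) (sQ : Q -> Q) (sH : H -> H).
Hypotheses (qc : continuous q) (qM : {morph q : x y / x * y}) (qT : range q = setT).
Hypothesis qquot : forall f : Q -> H, continuous (f \o q) -> continuous f.
Hypothesis qs : q \o sG = sQ \o q.

Lemma Sur_precomp :
  (fun f : Q -> H => f \o q) @` Sur sQ sH =
  [set f | Sur sG sH f /\ forall x, q x = 1 -> f x = 1].
Proof.
have qS y : exists x, q x = y by have [x _ <-] : range q y by [rewrite qT]; exists x.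
apply/seteqP; split.
  move=> _ [f [fc fM fT fs] <-]; split; last first.
    by move=> x /= ->; rewrite morph_g1.
  split.
  - by move=> x; apply: continuous_comp; [exact: qc|exact: fc].
  - by move=> x y /=; rewrite qM fM.
  - apply/seteqP; split=> // z _; have [y _ <-] : range f z by rewrite fT.
    by have [x <-] := qS y; exists x.
  - by rewrite -[LHS]/(f \o (q \o sG)) qs -[LHS]/((f \o sQ) \o q) fs.
move=> f [[fc fM fT fs] f1].
have fE x y : q x = q y -> f x = f y.
  move=> qxy; apply: (@divg1_eq _ (f x) (f y)); rewrite -(morph_gV fM) -fM; apply: f1.
  by rewrite qM morph_gV// qxy mulgV.
pose r (y : Q) := projT1 (cid (qS y)).
have rK y : q (r y) = y by rewrite /r; case: cid.
have frq : (f \o r) \o q = f by apply/funext => x /=; apply: fE; rewrite rK.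
exists (f \o r) => //; split.
- by apply: qquot; rewrite frq.
- by move=> x y /=; rewrite -fM; apply: fE; rewrite qM !rK.
- apply/seteqP; split=> // z _; have [x _ <-] : range f z by rewrite fT.
  by exists (q x) => //=; apply: fE; rewrite rK.
- apply/funext => y /=; have := congr1 (fun h => h (r y)) fs => /= <-.
  apply: fE; rewrite rK; have := congr1 (fun h => h (r y)) qs => /= ->.
  by rewrite rK.
Qed.

Lemma counting_Sur_precomp (R : realType) :
  counting [set f | Sur sG sH f /\ forall x, q x = 1 -> f x = 1] =
  counting (Sur sQ sH) :> \bar R.
Proof.
rewrite -Sur_precomp counting_image_inj// => f h _ _ fh; apply/funext => y.
have [x _ <-] : range q y by rewrite qT.
exact: (congr1 (fun f => f x) fh).
Qed.

End SurTransfer.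

End LowerSeries.

(** * GI-automorphisms *)

Section GITheory.

Local Open Scope group_scope.

Section Commutators.
Variable G : groupType.
Implicit Types a b k z : G.

Lemma commMg_conj a k b : [~ a * k, b] = [~ a, b] ^ k * [~ k, b].
Proof.
by rewrite /commg /conjg !invMg -!mulgA mulKVg mulKVg.
Qed.

Lemma commgM_central a b z : (forall x, commute x z) -> [~ a, b * z] = [~ a, b].
Proof.
move=> cz; have zJ x : x ^ z = x by rewrite /conjg (cz x) mulKg.
have Jz x : z^-1 ^ x = z^-1.
  by rewrite /conjg (commute_sym (commuteV (cz x))) mulKg.
rewrite commgEr invMg conjMg Jz -mulgA (mulgA (b^-1 ^ a)) -commgEr.
exact: zJ.
Qed.

End Commutators.

Section TrivialOnFrattini.
Variables (G : topGroupType) (p : nat).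

Lemma quot_central n x y : cn_set (lower_pcentral G p n) y ->
  commute (qpi (lower_pcentral G p n.+1) x) (qpi (lower_pcentral G p n.+1) y).
Proof.
move=> Py; apply/commgP/eqP; rewrite -(morph_gR (@qpiM _ _)).
by apply/qpi_eq1; exact: lower_pcentralR.
Qed.

(** For [y] in P_n, the map [a |-> [~ a, y]] is a homomorphism modulo P_(n+2), since its values lie
    in P_(n+1) and are thus central. As P_(n+1) has exponent [p] modulo P_(n+2), it kills
    commutators and [p]-th powers. *)
Lemma lower_pcentral_commg1 n x y : cn_set (lower_pcentral G p 1) x ->
  cn_set (lower_pcentral G p n) y -> cn_set (lower_pcentral G p n.+2) [~ x, y].
Proof.
move=> Px Py; pose q := qpi (lower_pcentral G p n.+2).
have qM : {morph q : x y / x * y} := @qpiM _ _.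
have qR a : cn_set (lower_pcentral G p n.+1) [~ a, y] by exact: lower_pcentralR.
have qRc a b : commute (q b) [~ q a, q y].
  by rewrite -(morph_gR qM); exact: quot_central.
have RM a b : [~ q (a * b), q y] = [~ q a, q y] * [~ q b, q y].
  rewrite qM commgEl conjMg invMg -mulgA (mulgA (q a)^-1) -commgEl mulgA.
  by rewrite -(commuteV (commute_sym (qRc a b))) -mulgA -commgEl.
have R1 : [~ q 1, q y] = 1 by rewrite (morph_g1 qM) comm1g.
have RV a : [~ q a^-1, q y] = [~ q a, q y]^-1.
  by apply: (@mulIg _ [~ q a, q y]); rewrite -RM !mulVg R1.
have RX a n' : [~ q (a ^+ n'), q y] = [~ q a, q y] ^+ n'.
  by elim: n' => [|m IH]; rewrite ?expg0// !expgS RM IH.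
pose S := [set a | [~ q a, q y] = 1]%classic.
suff : lower_pcentral G p 1 `<=` S.
  by move=> /(_ _ Px) Sx; apply/qpi_eq1; rewrite -/q (morph_gR qM).
apply: closed_gen_min.
  split; [|exact: R1|by move=> a b; rewrite /S /= => Ra Rb; rewrite RM RV Ra Rb invg1 mulg1].
  have -> : S = (fun a : G => [~ a, y]) @^-1` (lower_pcentral G p n.+2).
    apply/seteqP; split=> a Sa; first by apply/qpi_eq1; rewrite -/q (morph_gR qM).
    exact: etrans (esym (morph_gR qM _ _)) ((qpi_eq1 _ _).2 Sa).
  apply: closed_comp; last exact: cn_closed.
  move=> a _; rewrite /commg.
  have -> : (fun a : G => a^-1 * a ^ y) = (fun z : G * G => z.1 * z.2) \o
      (fun a => (a^-1, a ^ y)) by [].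
  apply: continuous_comp; last exact: mulg_continuous.
  by apply: cvg_pair; [exact: invg_continuous|exact: conjg_continuous].
move=> _ [[c _ [d _ <-]]|[d _ <-]]; rewrite /S /=.
  rewrite (commgEl c d) RM RV /conjg 2!RM RV.
  rewrite -(morph_gR qM c y) -(morph_gR qM d y).
  have cc : commute (q [~ c, y]) (q [~ d, y]) := quot_central _ (qR d).
  exact/eqP/commgP.
rewrite RX -(morph_gR qM) -(morph_gX qM); apply/qpi_eq1.
exact: lower_pcentralX.
Qed.

Variable u : G -> G.
Hypotheses (uc : continuous u) (uM : {morph u : x y / x * y}).
Hypothesis u1 : forall x, cn_set (lower_pcentral G p 1) (x^-1 * u x).

(** P_(n+1) is generated by commutators [[~ a, b]] and powers [b ^+ p] with [b] in P_n. Modulo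
    P_(n+2) these do not change when [a] is multiplied by an element of P_1, by
    [lower_pcentral_commg1], and [b] by an element of P_(n+1). *)
Lemma trivial_on_Frattini n y : cn_set (lower_pcentral G p n) y ->
  cn_set (lower_pcentral G p n.+1) (y^-1 * u y).
Proof.
elim: n y => [|n IH] y; first by move=> _; exact: u1.
pose q := qpi (lower_pcentral G p n.+2).
have qM : {morph q : x y / x * y} := @qpiM _ _.
have qc : continuous q := @qpi_continuous _ _.
pose S := [set y | q y = q (u y)]%classic.
suff : lower_pcentral G p n.+1 `<=` S by move=> /[apply] /qpi_eq.
apply: closed_gen_min.
  split.
  - have -> : S = (fun x => x^-1 * u x) @^-1` (lower_pcentral G p n.+2).
      by apply/seteqP; split=> a Sa; exact/qpi_eq.
    apply: closed_comp; last exact: cn_closed.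
    move=> a _.
    have -> : (fun a : G => a^-1 * u a) = (fun z : G * G => z.1 * z.2) \o
        (fun a => (a^-1, u a)) by [].
    apply: continuous_comp; last exact: mulg_continuous.
    by apply: cvg_pair; [exact: invg_continuous|exact: uc].
  - by rewrite /S /= (morph_g1 uM).
  - by move=> a b; rewrite /S /= uM (morph_gV uM) !qM !(morph_gV qM) => -> ->.
have uE x : u x = x * (x^-1 * u x) by rewrite mulKVg.
move=> _ [[a _ [b Pb <-]]|[b Pb <-]]; rewrite /S /=.
  rewrite (morph_gR uM) (uE a) (uE b).
  set k := _^-1 * _; set z := _^-1 * _.
  have Pk : cn_set (lower_pcentral G p 1) k by exact: u1.
  have Pz : cn_set (lower_pcentral G p n.+1) z by exact: IH.
  have zc x : commute (q x) (q z) by exact: quot_central.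
  clearbody k z; rewrite !(morph_gR qM) !qM.
  have zc' c : commute c (q z) by have [d ->] := qpi_surj c.
  rewrite commgM_central// commMg_conj -(morph_gR qM k b).
  have -> : q [~ k, b] = 1 by apply/qpi_eq1; exact: lower_pcentral_commg1.
  rewrite mulg1 -(morph_gR qM); apply/esym/conjg_fixP/commgP.
  by apply: commute_sym; apply: quot_central; exact: lower_pcentralR.
rewrite (morph_gX uM) (uE b); set z := _^-1 * _.
have Pz : cn_set (lower_pcentral G p n.+1) z by exact: IH.
rewrite !(morph_gX qM) qM expgMn; last exact: quot_central.
have -> : q z ^+ p = 1; last by rewrite mulg1.
by rewrite -(morph_gX qM); apply/qpi_eq1; exact: lower_pcentralX.
Qed.

Lemma iter_morph k : {morph iter k u : x y / x * y}.
Proof. by elim: k => [//|k IH] x y /=; rewrite IH uM. Qed.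

Lemma iter_continuous k : continuous (iter k u).
Proof.
elim: k => [|k IH] x; first exact: cvg_id.
by apply: (@continuous_comp _ _ _ (iter k u) u); [exact: IH|exact: uc].
Qed.

End TrivialOnFrattini.

(** Let [v] be the [p ^ i]-fold iterate of [u] and [v x = x * z]. Then [v] fixes [z] modulo P_(i+2),
    so the [j]-fold iterate of [v] sends [x] to [x * z ^+ j]; for [j = p] the last factor is in
    P_(i+2). *)
Lemma iter_trivial_on_Frattini (G : topGroupType) p (u : G -> G) :
  continuous u -> {morph u : x y / x * y} ->
  (forall x, cn_set (lower_pcentral G p 1) (x^-1 * u x)) ->
  forall i x, cn_set (lower_pcentral G p i.+1) (x^-1 * iter (p ^ i) u x).
Proof.
move=> uc uM u1; elim=> [|i IH] x; first exact: u1.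
pose v := iter (p ^ i) u; pose P := lower_pcentral G p i.+2.
have vM : {morph v : x y / x * y} by exact: iter_morph.
have vc : continuous v by exact: iter_continuous.
have v1 y : cn_set (lower_pcentral G p 1) (y^-1 * v y).
  exact: (lower_pcentral_le (ltn0Sn i)).
have vz : cn_set (lower_pcentral G p i.+1) (x^-1 * v x) by exact: IH.
set z := _^-1 * _ in vz.
have vj j : qpi P (iter j v x) = qpi P (x * z ^+ j).
  elim: j => [|j IHj] /=; first by rewrite mulg1.
  have qv a b : qpi P a = qpi P b -> qpi P (v a) = qpi P (v b).
    move=> /qpi_eq /(lower_pcentral_morph vc vM); rewrite vM (morph_gV vM).
    by move=> /qpi_eq.
  have vE : v x = x * z by rewrite mulKVg.
  rewrite (qv _ _ IHj) vM (morph_gX vM) vE expgS !qpiM -!mulgA.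
  do 2![congr (_ * _)]; rewrite !(morph_gX (@qpiM _ P)).
  suff -> : qpi P (v z) = qpi P z by [].
  by apply/esym/qpi_eq; exact: trivial_on_Frattini.
apply/qpi_eq; rewrite -/P expnS mulnC -[LHS]mulg1.
have -> m : iter (p ^ i * m) u x = iter m v x.
  by elim: m => [|m IHm]; rewrite ?muln0// mulnS iterD IHm.
rewrite vj qpiM; congr (_ * _); apply/esym/qpi_eq1.
exact: lower_pcentralX.
Qed.

Section Involutions.
Variables (T : Type) (s t : T -> T).
Hypotheses (sK : involutive s) (tK : involutive t).

(* Two involutions whose product [u] has odd order [2k+1] are conjugate, by
   [u^(k+1)]. *)
Lemma involution_conj k : (forall x, iter k.*2.+1 (s \o t) x = x) ->
  forall x, iter k.+1 (s \o t) (t x) = s (iter k.+1 (s \o t) x).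
Proof.
move=> uk x; set u := s \o t.
(* [s] conjugates [u] into its inverse. *)
have us j y : iter j u (s (iter j u y)) = s y.
  elim: j y => [//|j IH] y; rewrite iterS -[in X in s X]/u iterSr.
  have -> : iter j u (u y) = u (iter j u y) by rewrite -iterSr -iterS.
  have -> : iter j u (s (u (iter j u y))) = iter j u (t (iter j u y)) by rewrite /u /= sK.
  rewrite -iterS iterSr.
  have -> : u (t (iter j u y)) = s (iter j u y) by rewrite /u /= tK.
  exact: IH.
rewrite iterSr {2}/u /= tK.
have {1}-> : x = iter k u (iter k.+1 u x) by rewrite -iterD addnS addnn uk.
exact: us.
Qed.

End Involutions.

Section GIAutomorphisms.
Variable p : nat.
Hypotheses (p_prime : prime p) (p_odd : odd p).

Section One.
Variables (G : topGroupType) (s : G -> G).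
Hypotheses (Gp : pro_p p G) (sGI : GI_automorphism s).

Lemma GI_morph : {morph s : x y / x * y}. Proof. by case: sGI => -[]. Qed.
Lemma GI_continuous : continuous s. Proof. by case: sGI => -[]. Qed.

Lemma GI_involutive : involutive s.
Proof.
have [_ [A Agen As]] := sGI; have sM := GI_morph; have sc := GI_continuous.
suff : s \o s = idfun by move=> ss x; exact: (congr1 (fun f => f x) ss).
apply: (continuous_morph_eq (pro_p_hausdorff Gp) _ _ _ _ Agen) => //.
- by move=> x; apply: continuous_comp; exact: sc.
- by move=> x; exact: cvg_id.
- by move=> x y /=; rewrite !sM.
- by move=> x Ax /=; rewrite (As _ Ax) (morph_gV sM) (As _ Ax) invgK.
Qed.

Lemma quot_Frattini_abelian (x y : quot (lower_pcentral G p 1)) : commute x y.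
Proof.
have [[a ->] [b ->]] := (qpi_surj x, qpi_surj y).
exact: (@quot_central G p 0).
Qed.

Lemma GI_inverts_Frattini x : cn_set (lower_pcentral G p 1) (x * s x).
Proof.
have [_ [A Agen As]] := sGI; have sM := GI_morph; have sc := GI_continuous.
pose q := qpi (lower_pcentral G p 1).
have qM : {morph q : x y / x * y} := @qpiM _ _.
suff : q \o s = (fun x => (q x)^-1).
  move=> /(congr1 (fun f => f x)) qs; apply/qpi_eq1.
  by rewrite -/q qM (qs : q (s x) = _) mulgV.
apply: (continuous_morph_eq (@quot_hausdorff _ p_prime _ Gp _) _ _ _ _ Agen).
- by move=> z; apply: continuous_comp; [exact: sc|exact: qpi_continuous].
- by move=> z; apply: (@continuous_comp _ _ _ q (fun x => x^-1));
    [exact: qpi_continuous|exact: invg_continuous].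
- by move=> u v /=; rewrite sM qM.
- by move=> u v; rewrite qM -invMg quot_Frattini_abelian.
- by move=> a Aa /=; rewrite As// (morph_gV qM).
Qed.

End One.

(* Both automorphisms invert the Frattini quotient, so [s \o t] is trivial on it and
   has order a power of [p], which is odd. *)
Lemma GI_conj (Q : topGroupType) c (s t : Q -> Q) : pro_p p Q ->
  lower_pcentral Q p c = [set 1]%classic :> set Q ->
  GI_automorphism s -> GI_automorphism t ->
  exists2 h : Q -> Q, top_iso h & h \o t = s \o h.
Proof.
move=> Qp Qc sGI tGI; pose u := s \o t.
have [sM tM] := (GI_morph sGI, GI_morph tGI).
have [sc tc] := (GI_continuous sGI, GI_continuous tGI).
have [sK tK] := (GI_involutive Qp sGI, GI_involutive Qp tGI).
have uM : {morph u : x y / x * y} by move=> x y; rewrite /u /= tM sM.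
have uc : continuous u by move=> x; apply: continuous_comp; [exact: tc|exact: sc].
have u1 x : cn_set (lower_pcentral Q p 1) (x^-1 * u x).
  have -> : x^-1 * u x = (t x * x)^-1 * (t x * s (t x)).
    by rewrite invMg -mulgA mulKg.
  apply: (cn_M (N := lower_pcentral Q p 1)); last exact: GI_inverts_Frattini.
  by apply: (cn_V (N := lower_pcentral Q p 1)); have := GI_inverts_Frattini Qp tGI (t x); rewrite tK.
have uord x : iter (p ^ c) u x = x.
  have := iter_trivial_on_Frattini uc uM u1 (i := c) x.
  move=> /lower_pcentralS; rewrite Qc => /(congr1 (fun y => x * y)).
  by rewrite mulKVg mulg1.
have pcE : (p ^ c)%N = (p ^ c)./2.*2.+1.
  by rewrite -[LHS]odd_double_half oddX p_odd orbT.
set k := (p ^ c)./2 in pcE; rewrite pcE in uord.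
have hcomm := involution_conj sK tK uord.
pose h := iter k.+1 u; pose h' := iter k u.
have hh' x : h (h' x) = x by rewrite /h /h' -iterD addSn addnn uord.
have h'h x : h' (h x) = x by rewrite /h /h' -iterD addnS addnn uord.
exists h; last by apply/funext => x; exact: hcomm.
split; [exact: iter_morph|exact: iter_continuous|].
by exists h'; split => //; exact: iter_continuous.
Qed.

End GIAutomorphisms.

End GITheory.

(** * Equivariant surjections and the quotients of given class *)

Section SurTransferLevels.

Local Open Scope group_scope.

Lemma fixed_GI_P (G : topGroupType) :
  (exists s : G -> G, GI_automorphism s) -> GI_automorphism (@fixed_GI G).
Proof. by move=> [s sGI]; rewrite /fixed_GI; case: xgetP => [t _ //|/(_ s)]. Qed.

Lemma isomorphic_quotient_map (G Q P : topGroupType) (q : G -> Q) (f : Q -> P)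
    (T : topologicalType) (h : P -> T) : top_iso f ->
  (forall k : Q -> T, continuous (k \o q) -> continuous k) ->
  continuous (h \o (f \o q)) -> continuous h.
Proof.
move=> [fM fc [f' [fK f'K f'c]]] qq hc.
have hfc : continuous (h \o f) by exact: (qq).
rewrite (_ : h = (h \o f) \o f'); last by apply/funext => x /=; rewrite f'K.
by move=> x; apply: continuous_comp; [exact: f'c|exact: hfc].
Qed.

Section Levels.
Variable p : nat.
Hypotheses (p_prime : prime p) (p_odd : odd p).

Lemma GI_quotient (G P : topGroupType) (q : G -> P) (s : G -> G) :
  pro_p p G -> GI_automorphism s -> continuous q -> {morph q : x y / x * y} ->
  range q = setT -> (forall f : P -> P, continuous (f \o q) -> continuous f) ->
  (forall x, q x = 1 -> q (s x) = 1) ->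
  exists2 t : P -> P, GI_automorphism t & t \o q = q \o s.
Proof.
move=> Gp sGI qc qM qT qquot qs.
have [[sM sc] sK] := (GI_morph sGI, GI_continuous sGI, GI_involutive Gp sGI).
have qS y : exists x, q x = y by have [x _ <-] : range q y by [rewrite qT]; exists x.
pose r (y : P) := projT1 (cid (qS y)).
have rK y : q (r y) = y by rewrite /r; case: cid.
pose t := q \o s \o r.
have tE x : t (q x) = q (s x).
  apply: divg1_eq; rewrite /t /= -(morph_gV qM) -qM -(morph_gV sM) -sM; apply: qs.
  by rewrite qM (morph_gV qM) rK mulgV.
have tq : t \o q = q \o s by apply/funext => x; exact: tE.
have tM : {morph t : x y / x * y}.
  by move=> x y; rewrite -(rK x) -(rK y) -qM !tE sM qM.
have tc : continuous t.
  by apply: (qquot); rewrite tq => x; apply: continuous_comp; [exact: sc|exact: qc].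
have tK : involutive t by move=> x; rewrite -(rK x) !tE sK.
exists t => //; split; first by split=> //; exists t.
have [_ [A Agen As]] := sGI; exists (q @` A); first exact: top_generates_image.
by move=> _ [x Ax <-]; rewrite tE As// (morph_gV qM).
Qed.

(** As P_c(H) is trivial, every homomorphism from [G] to [H] factors through [Q p c G], hence
    through [P]. The automorphism that [s] induces on [P] may differ from [t], but is conjugate to
    it by [GI_conj]. *)
Lemma counting_Sur_level (R : realType) (G P H : topGroupType) c
    (s : G -> G) (t : P -> P) (sH : H -> H) :
  pro_p p G -> pro_p p P -> isomorphic (Q p c G) P ->
  GI_automorphism s -> GI_automorphism t ->
  lower_pcentral H p c = [set 1]%classic :> set H ->
  counting (Sur s sH) = counting (Sur t sH) :> \bar R.
Proof.
move=> Gp Pp [f fiso] sGI tGI Hc; have [fM fc [f' [fK f'K f'c]]] := fiso.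
pose q := f \o qpi (lower_pcentral G p c).
have qM : {morph q : x y / x * y} by move=> x y; rewrite /q /= qpiM fM.
have qc : continuous q by move=> x; apply: continuous_comp; [exact: qpi_continuous|exact: fc].
have qT : range q = setT.
  apply/seteqP; split=> // y _; have [x fx] := qpi_surj (f' y).
  by exists x => //; rewrite /q /= -fx f'K.
have q1 x : q x = 1 <-> cn_set (lower_pcentral G p c) x.
  rewrite -qpi_eq1; split=> [qx|]; last by rewrite /q /= => ->; exact: morph_g1.
  by apply: (can_inj fK); rewrite (morph_g1 fM).
have qquot (T : topologicalType) (h : P -> T) : continuous (h \o q) -> continuous h.
  by apply: isomorphic_quotient_map fiso _ => k; exact: qpi_factor_continuous.
have Pc : lower_pcentral P p c = [set 1]%classic :> set P.
  rewrite -(lower_pcentral_image qc qM p c (pro_p_compact Gp) (pro_p_hausdorff Pp) qT).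
  apply/seteqP; split=> [_ [x Px <-]|_ ->]; first exact/q1.
  by exists 1; [exact: (cn_1 (lower_pcentral G p c))|exact: morph_g1].
have [|t' t'GI t'q] := GI_quotient Gp sGI qc qM qT (@qquot _).
  by move=> x /q1 Px; apply/q1/(lower_pcentral_morph (GI_continuous sGI) (GI_morph sGI)).
have -> : counting (Sur s sH) = counting (Sur t' sH) :> \bar R.
  rewrite -(counting_Sur_precomp sH qc qM qT (@qquot _) (esym t'q)); congr counting.
  apply/seteqP; split=> [k Sk|k []//]; split=> // x /q1 Px.
  have [kc kM _ _] := Sk; have := lower_pcentral_morph kc kM Px.
  by rewrite Hc.
have [h [hM hc [h' [hK h'K h'c]]] hcomm] := GI_conj p_prime p_odd Pp Pc t'GI tGI.
have hT : range h = setT by apply/seteqP; split=> // y _; exists (h' y).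
have hquot (k : P -> H) : continuous (k \o h) -> continuous k.
  move=> khc; rewrite (_ : k = (k \o h) \o h'); last by apply/funext => x /=; rewrite h'K.
  by move=> x; apply: continuous_comp; [exact: h'c|exact: khc].
rewrite -(counting_Sur_precomp sH hc hM hT hquot hcomm); congr counting.
apply/seteqP; split=> [k [//]|k Sk]; split=> // x hx.
have -> : x = 1 by apply: (can_inj hK); rewrite hx (morph_g1 hM).
by case: Sk => _ kM _ _; exact: morph_g1.
Qed.

(** A surjection carries P_k(P) onto P_k(H), so [P] cannot have smaller class than [H]. *)
Lemma Sur_pclass (P H : topGroupType) c (t : P -> P) (sH : H -> H) :
  pro_p p P -> hausdorff_space H -> has_pclass p H c -> Sur t sH !=set0 ->
  lower_pcentral P p c = [set 1]%classic :> set P -> has_pclass p P c.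
Proof.
move=> Pp hH [_ Hc] [f [fc fM fT _]] Pc; split=> // k Pk; apply: Hc.
rewrite -(lower_pcentral_image fc fM p k (pro_p_compact Pp) hH fT) Pk.
by rewrite image_set1 (morph_g1 fM).
Qed.

Definition X_level (G : topGroupType) (s : G -> G) n : set G :=
  [set x | cn_set (lower_pcentral G p n) x /\ s x = x^-1].

(* The fibres are permuted by the twisted conjugations [x |-> a^-1 * x * sA a]. *)
Lemma X_level_fiber (A B : topGroupType) (sA : A -> A) (sB : B -> B) (f : A -> B)
    n (b : B) :
  compact [set: A] -> hausdorff_space B ->
  {morph sA : x y / x * y} -> continuous sA -> involutive sA ->
  {morph sB : x y / x * y} ->
  (exists m, b ^+ (p ^ m) = 1) ->
  continuous f -> {morph f : x y / x * y} -> range f = setT ->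
  f \o sA = sB \o f -> X_level sB n b ->
  exists2 h : A -> A, injective h &
    X_level sA n `&` f @^-1` [set b] = h @` (X_level sA n `&` f @^-1` [set 1]).
Proof.
move=> cA hB sM sc sK sBM [m bm] fc fM fT fs [Pb sb].
(* [b] has odd order, hence a square root [b ^+ (p ^ m)./2.+1]. The inverse [y] of this root
   satisfies [y^-1 * sB y = b], so twisted conjugation by a lift [a] of [y] in P_n carries the fibre
   over 1 to the fibre over [b]. *)
have bE : b = b ^+ (p ^ m)./2.+1 * b ^+ (p ^ m)./2.+1.
  have pE : (p ^ m)%N = (p ^ m)./2.*2.+1.
    by rewrite -[LHS]odd_double_half oddX p_odd orbT.
  rewrite -expgnDr addSn addnS addnn -{1}[b]mulg1 -bm -expgS.
  by rewrite {1}pE.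
pose y := b ^- (p ^ m)./2.+1.
have Py : cn_set (lower_pcentral B p n) y by apply: cn_V; apply: cn_X.
have sy : y^-1 * sB y = b.
  by rewrite /y (morph_gV sBM) (morph_gX sBM) sb expVgn !invgK -bE.
have [a Pa fa] : (f @` lower_pcentral A p n) y.
  by rewrite (lower_pcentral_image fc fM p n cA hB fT).
have fsE x : f (sA x) = sB (f x) by exact: (congr1 (fun k => k x) fs).
have sBV x : sB x^-1 = (sB x)^-1 by exact: morph_gV.
have sAV x : sA x^-1 = (sA x)^-1 by exact: morph_gV.
have fV x : f x^-1 = (f x)^-1 by exact: morph_gV.
have Psa : cn_set (lower_pcentral A p n) (sA a) by exact: lower_pcentral_morph.
exists (fun x => a^-1 * x * sA a).
  by move=> x z /(mulIg) /mulgI.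
apply/seteqP; split=> [x [[Px sx] /= fx]|_ [x [[Px sx] /= fx] <-]]; last first.
  split; first split.
  - by apply: cn_M => //; apply: cn_M => //; exact: cn_V.
  - by rewrite !sM sAV sx sK !invMg invgK mulgA.
  - by rewrite /= !fM fV fx mulg1 fsE fa.
exists (a * x * (sA a)^-1); last by rewrite -!mulgA mulKg mulVg mulg1.
split; first split.
- by apply: cn_M; [exact: cn_M|exact: cn_V].
- by rewrite !sM sAV sx sK !invMg invgK mulgA.
- by rewrite /= !fM fV fx fsE fa -sy mulKVg mulgV.
Qed.

(** Burnside's basis theorem: P_1(H) lies in ['Phi], whose elements are non-generators. *)
Lemma Frattini_generates (H : topGroupType) (C : set H) : finite_pgroup p H ->
  closed_subgroup C ->
  (forall h, exists2 c, C c & cn_set (lower_pcentral H p 1) (c^-1 * h)) ->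
  C = setT.
Proof.
move=> Hp Csub CP; have finH := finite_pgroup_finite Hp.
have [dH [n /(card_fin_of finH) cH]] := Hp.
pose K : finGroupType := fin_of finH.
have pK : p.-group [set: K]%SET by rewrite /pgroup cardsT cH pnatX pnat_id// orbT.
pose S := [set x : K | `[< C x >]]%SET.
have gS : group_set S.
  apply/group_setP; split; first by rewrite inE; exact/asboolP/(closed_subgroup1 Csub).
  by move=> x y; rewrite !inE => Cx Cy; exact: (closed_subgroupM Csub).
have PPhi : lower_pcentral H p 1 `<=` [set x : H | (x : K) \in 'Phi([set: K]%SET)]%classic.
  apply: closed_gen_min.
    split=> [||x y /= Px Py]; last exact: (@groupM K _ _ _ Px (groupVr Py)).
      by rewrite -openC; exact: dH.
    exact: (@group1 K).
  move=> _ [[x _ [y _ <-]]|[x _ <-]] /=; rewrite (Phi_joing pK).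
    apply: (fintype.subsetP (joing_subl _ _)).
    by apply: mem_commg; rewrite finset.in_setT.
  apply: (fintype.subsetP (joing_subr _ _)).
  have xp : p.-elt (x : K) by apply: (mem_p_elt pK); rewrite finset.in_setT.
  by have := Mho_p_elt 1 (finset.in_setT (x : K)) xp; rewrite expn1.
have : Group gS :=: [set: K]%SET.
  rewrite -[LHS]genGid; apply: (@Phi_nongen K [set: K]%G); apply/eqP; rewrite finset.eqEsubset finset.subsetT /=.
  apply/fintype.subsetP => h _; have [c Cc Ph] := CP h.
  rewrite -[h](mulKVg (c : K)); apply: groupM.
    by apply: (fintype.subsetP (joing_subr _ _)); rewrite inE; exact/asboolP.
  by apply: (fintype.subsetP (joing_subl _ _)); exact: PPhi.
move=> KS; apply/seteqP; split=> // h _.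
have : (h : K) \in Group gS by rewrite KS finset.in_setT.
by rewrite inE => /asboolP.
Qed.

End Levels.

End SurTransferLevels.

(** * Generating tuples and Durfee's identity *)

Section CountGenerators.
Local Open Scope ring_scope.

Lemma row_free_col_mx (F : fieldType) d g (v : 'rV[F]_g) (A : 'M[F]_(d, g)) :
  row_free (col_mx v A) = row_free A && ~~ (v <= A)%MS.
Proof.
apply/idP/andP => [vA|[rA nvA]].
  split.
    apply: inj_row_free => u uA.
    have : row_mx 0 u *m col_mx v A = 0 by rewrite mul_row_col mul0mx add0r.
    by move/eqP; rewrite mulmx_free_eq0// row_mx_eq0 => /andP[_ /eqP].
  apply/negP => /submxP[u uA].
  have : row_mx 1%:M (- u) *m col_mx v A = 0.
    by rewrite mul_row_col mul1mx mulNmx -uA subrr.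
  by move/eqP; rewrite mulmx_free_eq0// row_mx_eq0 oner_eq0.
apply: inj_row_free => w; rewrite -[w]hsubmxK mul_row_col.
set a := lsubmx w; set u := rsubmx w; rewrite [a]mx11_scalar mul_scalar_mx => e.
have a0 : a 0 0 = 0.
  apply/eqP; apply: contraNT nvA => a0; apply/submxP; exists (- ((a 0 0)^-1 *: u)).
  rewrite mulNmx -scalemxAl -[u *m A](addKr (a 0 0 *: v)) e addr0 scalerN opprK.
  by rewrite scalerA mulVf// scale1r.
rewrite a0 raddf0; move: e; rewrite a0 scale0r add0r => /eqP.
by rewrite mulmx_free_eq0// => /eqP ->; rewrite row_mx0.
Qed.

(** A new row must avoid the span of [d] independent ones, which has [#|F| ^ d] elements. *)
Lemma card_row_free (F : finFieldType) d g :
  #|[set A : 'M[F]_(d, g) | row_free A]%SET| = (\prod_(i < d) (#|F| ^ g - #|F| ^ i))%N.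
Proof.
elim: d => [|d IHd].
  rewrite big_ord0; apply/eqP/cards1P; exists 0; apply/setP => A.
  by rewrite !inE [A]flatmx0 eqxx -row_leq_rank leq0n.
rewrite big_ord_recr /= -IHd -[LHS]sum1_card.
rewrite (partition_big (@dsubmx F 1 d g) (fun A => A \in [set A | row_free A]%SET)) /=; last first.
  by move=> A; rewrite !inE -[A in row_free A]vsubmxK row_free_col_mx => /andP[] //.
rewrite -sum_nat_const; apply: eq_bigr => A; rewrite inE => rA.
rewrite (reindex (fun v : 'rV_g => col_mx v A)) /=; last first.
  exists usubmx => [v _|B]; first by rewrite col_mxKu.
  by case/andP=> _ /eqP <-; rewrite vsubmxK.
have -> : (#|F| ^ g - #|F| ^ d = #|~: rowg A|)%N.
  by rewrite cardsCs finset.setCK card_mx mul1n card_rowg (eqnP rA).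
rewrite -sum1_card; apply: eq_bigl => v.
by rewrite !inE col_mxKd eqxx andbT row_free_col_mx rA.
Qed.

End CountGenerators.

Section AbelemGenerators.
Local Open Scope group_scope.
Variables (p : nat) (V : finGroupType).
Hypotheses (p_prime : prime p) (abelV : p.-abelem [set: V]%SET).

Definition generating_tuples g : {set {ffun 'I_g -> V}} :=
  [set y : {ffun 'I_g -> V} | <<[set y i | i in 'I_g]>> == [set: V]]%SET.

(** Coordinates turn [y] into a matrix with columns [y i]. The tuple generates exactly when the
    columns span, that is when the [d] rows are independent. *)
Lemma card_generating_tuples g :
  #|generating_tuples g| = (\prod_(i < logn p #|V|) (p ^ g - p ^ i))%N.
Proof.
(* The coordinates [abelem_rV] ask for a nontrivial group. *)
have [V1|ntV] := eqVneq [set: V]%SET 1%g.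
  have -> : generating_tuples g = [set: {ffun 'I_g -> V}]%SET.
    apply/setP => y; rewrite !inE V1 finset.eqEsubset sub1G andbT -V1.
    exact: finset.subsetT.
  have cV : #|V| = 1%N by rewrite -cardsT V1 cards1.
  by rewrite cardsT card_ffun cV exp1n logn1 big_ord0.
pose r := abelem_rV abelV ntV; pose d := ('dim [set: V]%SET).
have cV : #|V| = (p ^ d)%N.
  by rewrite -cardsT -(card_abelem_rV abelV ntV) card_mx mul1n card_Fp.
rewrite cV pfactorK//.
have <- : #|[set A : 'M['F_p]_(d, g) | row_free A]%SET| =
    (\prod_(i < d) (p ^ g - p ^ i))%N.
  by rewrite card_row_free card_Fp.
pose M (y : {ffun 'I_g -> V}) : 'M['F_p]_(d, g) := (\matrix_i r (y i))^T%R.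
have rinj : injective r.
  by move=> a b; apply: abelem_rV_inj; rewrite finset.in_setT.
have Mbij : bijective M.
  exists (fun A => [ffun i => rVabelem abelV ntV (row i A^T)]).
    move=> y; apply/ffunP => i; rewrite ffunE trmxK rowK /r abelem_rV_K ?finset.in_setT//.
  move=> A; rewrite /M; apply: trmx_inj; rewrite trmxK; apply/row_matrixP => i.
  by rewrite rowK ffunE /r rVabelemK.
rewrite -(card_imset _ (bij_inj Mbij)); apply: eq_card => A; rewrite !inE.
apply/imsetP/idP => [[y]|].
  rewrite inE => /eqP gy ->; rewrite -[row_free _]/(_ == _) mxrank_tr.
  set N := (\matrix_i r (y i))%R.
  have : (1%:M%R <= N)%MS.
    apply/row_subP => j; rewrite -mem_rowg.
    pose S := abelem_rV abelV ntV @*^-1 (rowg N).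
    have : [set: V]%SET \subset S.
      rewrite -gy gen_subG; apply/fintype.subsetP => _ /imsetP[i _ ->].
      apply/morphpreP; split; first exact: finset.in_setT.
      have : r (y i) \in rowg N by rewrite inE -(rowK (fun i => r (y i)) i) row_sub.
      by [].
    move=> /fintype.subsetP /(_ (rVabelem abelV ntV (row j 1%:M%R))).
    rewrite finset.in_setT => /(_ isT) /morphpreP[_]; rewrite inE.
    by rewrite [X in (X <= _)%MS](rVabelemK abelV ntV) inE.
  by move=> /mxrankS; rewrite mxrank1 eqn_leq rank_leq_col.
move=> rA; have [y' _ My'] := Mbij; exists (y' A); rewrite ?My'//.
rewrite inE finset.eqEsubset finset.subsetT /=; apply/fintype.subsetP => v _.
set y := y' A; have yA : A^T%R = (\matrix_i r (y i))%R by rewrite -[A]My' trmxK.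
have /submxP[u uE] : (r v <= (\matrix_i r (y i))%R)%MS.
  rewrite -yA; apply: submx_full; rewrite /row_full mxrank_tr; exact: rA.
have -> : v = rVabelem abelV ntV (r v) by rewrite abelem_rV_K ?finset.in_setT.
rewrite uE mulmx_sum_row.
have -> : rVabelem abelV ntV (\sum_i u ord0 i *: row i (\matrix_i r (y i)))%R =
    \prod_i (y i ^+ (u ord0 i)).
  rewrite (big_morph _ (@rVabelemD _ _ _ abelV ntV) (rVabelem0 abelV ntV)).
  by apply: eq_bigr => i _; rewrite rVabelemZ rowK abelem_rV_K ?finset.in_setT.
apply: group_prod => i _; apply/groupX/mem_gen/imsetP; exists i => //.
Qed.

End AbelemGenerators.

(** * Durfee's identity, as a limit of finite identities *)

Section DurfeeIdentity.
Local Open Scope ring_scope.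
Variables (R : realType) (q : R).
Hypotheses (q0 : 0 < q) (q3 : 3 * q <= 1).

Definition euler_prod n : R := \prod_(1 <= k < n.+1) (1 - q ^+ k).
Local Notation e := euler_prod.

(** Gaussian binomial coefficients, through the q-Pascal rule. *)
Fixpoint gauss n k : R :=
  match n, k with
  | _, 0%N => 1
  | 0%N, _.+1 => 0
  | n'.+1, k'.+1 => gauss n' k' + q ^+ k'.+1 * gauss n' k'.+1
  end.

Lemma euler_prod0 : e 0 = 1. Proof. by rewrite /e big_nil. Qed.

Lemma euler_prodS n : e n.+1 = e n * (1 - q ^+ n.+1).
Proof. by rewrite /e big_nat_recr. Qed.

Lemma expr_q_le1 k : q ^+ k <= 1.
Proof.
apply: exprn_ile1; first exact: ltW.
by apply: le_trans q3; rewrite ler_peMl ?(ltW q0)// ler1n.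
Qed.

(** The extra [q ^+ n / 2] carries the induction: as [e n <= 1], the next step loses at most
    [q ^+ n.+1], and [3 * q <= 1] pays for it. The bound 1/2 keeps the limit away from 0. *)
Lemma euler_prod_ge n : 1 / 2 + q ^+ n / 2 <= e n.
Proof.
elim: n => [|n IH]; first by rewrite euler_prod0 expr0; lra.
have qn : 0 < q ^+ n by exact: exprn_gt0.
have e1 : e n <= 1.
  by rewrite /e big_seq prodr_ile1// => i _; rewrite subr_ge0 expr_q_le1 gerBl exprn_ge0// ltW.
rewrite euler_prodS exprS.
have qq : 0 < q * q ^+ n by exact: mulr_gt0.
have : 3 * q * q ^+ n <= q ^+ n by rewrite ger_pMl.
nra.
Qed.

Lemma euler_prod_gt0 n : 0 < e n.
Proof.
apply: lt_le_trans (euler_prod_ge n); have : 0 < q ^+ n by exact: exprn_gt0.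
lra.
Qed.

Lemma euler_prod_noninc : nonincreasing_seq e.
Proof.
apply/nonincreasing_seqP => n; rewrite euler_prodS ler_piMr//.
  exact/ltW/euler_prod_gt0.
by rewrite gerBl exprn_ge0// ltW.
Qed.

Lemma gauss0 n : gauss n 0 = 1. Proof. by case: n. Qed.

Lemma gauss_gt n k : (n < k)%N -> gauss n k = 0.
Proof.
elim: n k => [|n IH] [|k]//=; rewrite ltnS => nk.
by rewrite !IH ?mulr0 ?addr0// ltnW.
Qed.

Lemma gaussE n k : (k <= n)%N -> gauss n k = e n / (e k * e (n - k)).
Proof.
elim: n k => [|n IH] [|k] //= nk.
- by rewrite subn0 euler_prod0 mulr1 divff ?oner_eq0.
- by rewrite subn0 euler_prod0 mul1r divff// gt_eqF// euler_prod_gt0.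
move: nk; rewrite ltnS leq_eqVlt => /orP[/eqP ->|kn].
  rewrite (@gauss_gt n n.+1)// mulr0 addr0 IH// !subnn euler_prod0 !mulr1 !divff//;
  by rewrite gt_eqF// euler_prod_gt0.
rewrite IH ?(ltnW kn)// IH// subSS.
have -> : (n - k = (n - k.+1).+1)%N by rewrite subnSK.
rewrite !euler_prodS.
have -> : q ^+ n.+1 = q ^+ k.+1 * q ^+ (n - k.+1).+1.
  by rewrite -exprD addnS subnKC.
have nz m : 1 - q ^+ m.+1 != 0.
  have := euler_prod_gt0 m.+1; rewrite euler_prodS pmulr_rgt0 ?euler_prod_gt0//.
  by move=> /lt0r_neq0.
have hX := mulVf (nz k); have hY := mulVf (nz (n - k.+1)%N).
rewrite !invfM; move: hX hY.
set u := (1 - q ^+ k.+1)^-1; set w := (1 - q ^+ (n - k.+1).+1)^-1.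
set X := q ^+ k.+1; set Y := q ^+ (n - k.+1).+1; set E := e n.
set b := (e k)^-1; set c := (e (n - k.+1))^-1 => hX hY.
(* The q-Pascal rule comes down to [(1 - X) + X * (1 - Y) = 1 - X * Y]. The factors [u * (1 - X)]
   and [w * (1 - Y)], equal to 1, bring both terms to a common denominator. *)
transitivity (E * (b * (c * w)) * (u * (1 - X)) + X * (E * (b * u * c)) * (w * (1 - Y))).
  by rewrite hX hY !mulr1.
lra.
Qed.

(** A q-Vandermonde identity whose limit in [n] is Durfee's. By the q-Pascal rule the sum for [n.+1]
    and [d] splits in two, and the pieces recombine termwise into the sum for [n] and [d.+1]; hence
    the induction with [d] general. *)
Lemma durfee_finite n d :
  \sum_(k < n.+1) gauss n k * q ^+ (k * (k + d)) / e (k + d) = (e (n + d))^-1.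
Proof.
elim: n d => [|n IH] d.
  by rewrite big_ord_recl big_ord0 /= mul0n expr0 !mul1r addr0.
rewrite big_ord_recl /= ?gauss0 mul0n expr0 !mul1r add0n.
under eq_bigr do rewrite /bump leq0n add1n add0n mulrDl mulrDl.
rewrite big_split /= addrCA [X in _ + X]addrC.
have -> : \sum_(i < n.+1) q ^+ i.+1 * gauss n i.+1 * q ^+ (i.+1 * (i.+1 + d)) / e (i.+1 + d)
    + (e d)^-1 = \sum_(k < n.+1) q ^+ k * gauss n k * q ^+ (k * (k + d)) / e (k + d).
  rewrite big_ord_recr /= gauss_gt// mulr0 !mul0r addr0.
  rewrite [RHS]big_ord_recl /= gauss0 expr0 ?mul0n ?expr0 !mul1r add0n addrC.
  by congr (_ + _); apply: eq_bigr.
rewrite -big_split /= addSnnS -IH; apply: eq_bigr => k _.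
rewrite addSn addnS euler_prodS.
have -> : (k.+1 * (k + d).+1 = k * (k + d) + k + (k + d).+1)%N.
  by rewrite mulSn mulnS addnC [X in (X + _)%N]addnC.
have -> : (k * (k + d).+1 = k * (k + d) + k)%N by rewrite mulnS addnC.
rewrite !exprD.
have nz m : 1 - q ^+ m.+1 != 0.
  have := euler_prod_gt0 m.+1; rewrite euler_prodS pmulr_rgt0 ?euler_prod_gt0//.
  by move=> /lt0r_neq0.
have hz := mulVf (nz (k + d)%N); move: hz.
rewrite !invfM; set u := (1 - q ^+ (k + d).+1)^-1; set z := q ^+ (k + d).+1.
set D := (e (k + d))^-1; set Q := q ^+ (k * (k + d)) => hz.
transitivity (gauss n k * (Q * q ^+ k * z) * (D * u) +
    q ^+ k * gauss n k * Q * D * (u * (1 - z))).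
  by rewrite hz mulr1.
lra.
Qed.

End DurfeeIdentity.

Section DurfeeSeries.
Local Open Scope ring_scope.
Variables (R : realType) (q : R).
Hypotheses (q0 : 0 < q) (q3 : 3 * q <= 1).
Local Notation e := (euler_prod q).

Definition euler_limit : R := limn e.

Lemma cvg_euler_prod : e @ \oo --> euler_limit.
Proof.
apply: (nonincreasing_is_cvgn (euler_prod_noninc q0 q3)).
by exists 0 => _ [n _ <-]; exact/ltW/euler_prod_gt0.
Qed.

Lemma euler_limit_gt0 : 0 < euler_limit.
Proof.
apply: (@lt_le_trans _ _ (1 / 2)); first by rewrite divr_gt0.
apply: limr_ge; first exact: (cvgP _ cvg_euler_prod).
near=> n; apply: le_trans (euler_prod_ge q0 q3 n).
by rewrite lerDl divr_ge0// exprn_ge0// ltW.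
Unshelve. all: by end_near. Qed.

Definition durfee_term d k : R := q ^+ (k * (k + d)) / (e k * e (k + d)).

Lemma durfee_term_ge0 d k : 0 <= durfee_term d k.
Proof.
rewrite divr_ge0//; first by rewrite exprn_ge0// ltW.
by rewrite mulr_ge0//; exact/ltW/euler_prod_gt0.
Qed.

Lemma durfee_finiteE n d :
  \sum_(k < n.+1) durfee_term d k * (e n / e (n - k)) = (e (n + d))^-1.
Proof.
rewrite -durfee_finite//; apply: eq_bigr => -[k /= kn] _.
rewrite gaussE// /durfee_term !invfM; lra.
Qed.

(** Both bounds come from [durfee_finiteE]. Since [e n / e (n - k) <= 1], the partial sums are at
    least [(e (n + d))^-1]. With the number of terms fixed, the weights [e m / e (m - k)] tend to 1
    as [m] grows, while the truncated sums stay below [(e (m + d))^-1], hence below the inverse of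
    the limit. *)
Lemma cvg_durfee d :
  (fun n => \sum_(k < n) durfee_term d k) @ \oo --> euler_limit^-1.
Proof.
rewrite -(cvg_shiftS _ _); apply: (@squeeze_cvgr _ _ _ _
  (fun n => (e (n + d))^-1) (fun=> euler_limit^-1)).
- near=> n; apply/andP; split.
    rewrite -durfee_finiteE; apply: ler_sum => -[k /= kn] _.
    rewrite ler_piMr ?durfee_term_ge0// ler_pdivrMr ?euler_prod_gt0// mul1r.
    exact: (euler_prod_noninc q0 q3 (leq_subr k n)).
  have cvn : (fun m : nat => \sum_(k < n.+1) durfee_term d k * (e m / e (m - k)))
      @ \oo --> \sum_(k < n.+1) durfee_term d k * (euler_limit / euler_limit).
    apply: cvg_big => [|k _]; first exact: add_continuous.
    apply: cvgM; first exact: cvg_cst.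
    apply: cvgM; first exact: cvg_euler_prod.
    apply: cvgV; first by rewrite gt_eqF// euler_limit_gt0.
    rewrite -(cvg_shiftn k); under eq_fun do rewrite addnK.
    exact: cvg_euler_prod.
  rewrite /=; have -> : \sum_(k < n.+1) durfee_term d k =
      \sum_(k < n.+1) durfee_term d k * (euler_limit / euler_limit).
    by apply: eq_bigr => k _; rewrite divff ?mulr1// gt_eqF// euler_limit_gt0.
  rewrite -(cvg_lim _ cvn)//; apply: limr_le; first exact: (cvgP _ cvn).
  near=> m; apply: (@le_trans _ _ (e (m + d))^-1); last first.
    rewrite lef_pV2 ?posrE ?euler_prod_gt0 ?euler_limit_gt0//.
    apply: limr_le; first exact: (cvgP _ cvg_euler_prod).
    near=> l; apply: (euler_prod_noninc q0 q3).
    by near: l; exact: nbhs_infty_ge.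
  have nm : (n <= m)%N by near: m; exact: nbhs_infty_ge.
  rewrite -durfee_finiteE -[(m.+1)](subnKC (nm : n.+1 <= m.+1)%N) big_split_ord /=.
  rewrite lerDl sumr_ge0// => k _; rewrite mulr_ge0 ?durfee_term_ge0//.
  by rewrite divr_ge0//; exact/ltW/euler_prod_gt0.
- apply: cvgV; first by rewrite gt_eqF// euler_limit_gt0.
  by rewrite (cvg_shiftn d); exact: cvg_euler_prod.
- exact: cvg_cst.
Unshelve. all: by end_near. Qed.

End DurfeeSeries.

(** * Free pro-p groups *)

Section FreeGroups.

Local Open Scope group_scope.

Lemma card_fset_set_finType (T : finType) (A : set T) :
  #|` fset_set A| = #|[set a | `[< A a >]]%SET|.
Proof.
have finA : finite_set A by exact: finite_finset.
rewrite cardE; apply/perm_size/uniq_perm; rewrite ?fset_uniq ?enum_uniq// => a.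
by rewrite mem_enum inE in_fset_set// in_setE; apply/idP/asboolP.
Qed.

Lemma card_family_const (T : finType) g (A : 'I_g -> {set T}) n :
  (forall i, #|A i| = n) -> #|[set y : {ffun 'I_g -> T} | [forall i, y i \in A i]]%SET| = (n ^ g)%N.
Proof.
move=> An; transitivity #|finfun.family (fun i => mem (A i))|.
  by apply: eq_card => y; rewrite inE; apply/forallP/familyP.
rewrite card_family -[in RHS](card_ord g) cardT.
by rewrite /image_mem; elim: (enum 'I_g) => [//|i e IH] /=; rewrite An IH expnS.
Qed.

Definition gen_rank p (H : topGroupType) : nat :=
  logn p #|` fset_set [set: quot (lower_pcentral H p 1)]|.

Section FreeProP.
Variables (p : nat).
Hypotheses (p_prime : prime p) (p_odd : odd p).
Variables (g : nat) (F : topGroupType) (x : 'I_g -> F).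
Hypothesis F_free : free_pro_p p x.

Lemma free_pro_p_p : pro_p p F. Proof. by case: F_free. Qed.

Lemma free_gen : top_generates (range x). Proof. exact: free_pro_p_generates F_free. Qed.

Lemma free_fg : finitely_generated F.
Proof. exists (range x); [exact/finite_image/finite_finset|exact: free_gen]. Qed.

Lemma free_hom_eq (P : topGroupType) (f h : F -> P) : hausdorff_space P ->
  continuous f -> continuous h -> {morph f : u v / u * v} -> {morph h : u v / u * v} ->
  (forall i, f (x i) = h (x i)) -> f = h.
Proof.
move=> hP fc hc fM hM fh.
by apply: (continuous_morph_eq hP fc hc fM hM free_gen) => _ [i _ <-].
Qed.

Lemma free_lift (P : topGroupType) (y : 'I_g -> P) : pro_p p P ->
  exists f : F -> P, [/\ continuous f, {morph f : u v / u * v} & forall i, f (x i) = y i].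
Proof. by move=> Pp; case: F_free => _ /(_ P Pp y)[f []]; exists f. Qed.

Variable s : F -> F.
Hypotheses (sM : {morph s : u v / u * v}) (sc : continuous s).
Hypothesis sx : forall i, s (x i) = (x i)^-1.

Lemma free_involutive : involutive s.
Proof.
suff : s \o s = idfun by move=> ss u; exact: (congr1 (fun f => f u) ss).
apply: free_hom_eq.
- exact: pro_p_hausdorff free_pro_p_p.
- by move=> u; apply: continuous_comp; exact: sc.
- by move=> u; exact: cvg_id.
- by move=> u v /=; rewrite !sM.
- by [].
- by move=> i /=; rewrite sx (morph_gV sM) sx invgK.
Qed.

Lemma free_GI : GI_automorphism s.
Proof.
split; first by split => //; exists s; split => //; exact: free_involutive.
by exists (range x); [exact: free_gen|move=> _ [i _ <-]].
Qed.

Section Target.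
Variables (H : topGroupType) (sH : H -> H) (c : nat).
Hypotheses (Hp : finite_pgroup p H) (sH_GI : GI_automorphism sH).

Let Hpro : pro_p p H := finite_pgroup_pro_p p_prime Hp.
Let finH : finite_set [set: H] := finite_pgroup_finite Hp.
Let V := quot (lower_pcentral H p 1).
Let pi : H -> V := qpi (lower_pcentral H p 1).
Let piM : {morph pi : u v / u * v} := @qpiM _ _.
Let finV : finite_set [set: V].
Proof.
have -> : [set: V] = pi @` [set: H] by rewrite -(qpi_range (lower_pcentral H p 1)).
exact: finite_image.
Qed.
Let K : finGroupType := fin_of finH.
Let W : finGroupType := fin_of finV.
Let pKW : K -> W := pi.

Let W_abelem : p.-abelem [set: W]%SET.
Proof.
rewrite abelemE//; apply/andP; split.
  apply/centsP => a _ b _; exact: (@quot_Frattini_abelian p H).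
apply/exponentP => a _; have [h ->] := qpi_surj (a : V).
have : qpi (lower_pcentral H p 1) (h ^+ p) = 1.
  by apply/qpi_eq1; exact: (@lower_pcentralX H p 0).
by rewrite -(morph_gX piM).
Qed.

(** By [Frattini_generates], the closed subgroup [range f] is all of [H] as soon as it maps onto [H]
    modulo P_1(H). *)
Lemma free_range_generates (f : F -> H) :
  continuous f -> {morph f : u v / u * v} ->
  range f = [set: H] <->
  <<[set pKW (f (x i)) | i in 'I_g]%SET>> = [set: W]%SET.
Proof.
move=> fc fM; set Y := [set _ | i in _]%SET.
have fcl : closed_subgroup (range f).
  apply: closed_subgroup_image => //; first exact: pro_p_compact free_pro_p_p.
    exact: pro_p_hausdorff Hpro.
have qf u : pKW (f u) \in <<Y>>.
  suff : closed_gen (range x) `<=` [set u | pKW (f u) \in <<Y>>]%classic.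
    by rewrite free_gen; exact.
  apply: closed_gen_min; last first.
    by move=> _ [i _ <-] /=; apply/mem_gen/imsetP; exists i.
  split=> [||a b /= Pa Pb].
  - apply: (@closed_comp _ _ f [set h | pKW h \in <<Y>>]%classic); first by move=> ? _; exact: fc.
    by rewrite -openC; case: Hp.
  - rewrite /= (morph_g1 fM); have -> : pKW 1 = 1 by exact: (morph_g1 piM).
    exact: group1.
  - rewrite fM (morph_gV fM).
    have -> : pKW (f a * (f b)^-1) = pKW (f a) * (pKW (f b))^-1.
      by rewrite -[LHS]/(pi _) piM (morph_gV piM).
    exact: (groupM Pa (groupVr Pb)).
split=> [fT|YT].
  apply/setP => a; rewrite finset.in_setT.
  have [h ah] := qpi_surj (a : V); have [u _ fu] : range f h by rewrite fT.
  by rewrite ah -fu; exact: qf.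
apply: Frattini_generates Hp fcl _ => // h.
pose Z := [set a : W | `[< exists2 u, pKW (f u) = a & True >]]%SET.
have gZ : group_set Z.
  apply/group_setP; split.
    rewrite inE; apply/asboolP; exists 1 => //.
    by rewrite (morph_g1 fM); exact: (morph_g1 piM).
  move=> a b; rewrite !inE => -[u <- _] [v <- _].
  by exists (u * v) => //; rewrite fM; exact: piM.
have : pKW h \in Group gZ.
  have : pKW h \in <<Y>> by rewrite YT finset.in_setT.
  apply: fintype.subsetP; rewrite gen_subG; apply/fintype.subsetP => _ /imsetP[i _ ->].
  by rewrite inE; apply/asboolP; exists (x i).
rewrite inE => /asboolP[u uh _]; exists (f u); first by exists u.
by apply/qpi_eq.
Qed.

Lemma free_equivariant (f : F -> H) : continuous f -> {morph f : u v / u * v} ->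
  f \o s = sH \o f <-> forall i, sH (f (x i)) = (f (x i))^-1.
Proof.
move=> fc fM; split=> [fs i|fs].
  by have := congr1 (fun k => k (x i)) fs; rewrite /= sx (morph_gV fM) => ->.
apply: free_hom_eq.
- exact: pro_p_hausdorff Hpro.
- by move=> u; apply: continuous_comp; [exact: sc|exact: fc].
- by move=> u; apply: continuous_comp; [exact: fc|exact: (GI_continuous sH_GI)].
- by move=> u v /=; rewrite sM fM.
- by move=> u v /=; rewrite fM (GI_morph sH_GI).
- by move=> i /=; rewrite sx (morph_gV fM) fs.
Qed.

Let inverted : {set K} := [set h : K | (sH h : K) == h^-1]%SET.
Let fiber (v : W) : {set K} := [set h in inverted | pKW h == v]%SET.

(** The automorphism induced on [V] is inversion, so every [v] is an inverted element and
    [X_level_fiber] for [n = 0] compares its fibre with the one over 1, which is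
    [X_level p sH 1]. *)
Lemma card_inverted_fiber (v : W) : #|fiber v| = #|` fset_set (X_level p sH 1)|.
Proof.
have piT : range pi = setT by exact: qpi_range.
have pic : continuous pi by exact: qpi_continuous.
have piq (f : V -> V) : continuous (f \o pi) -> continuous f by exact: qpi_factor_continuous.
have [|t tGI tpi] := GI_quotient Hpro sH_GI pic piM piT piq.
  move=> h /qpi_eq1 Ph; apply/qpi_eq1.
  exact: (lower_pcentral_morph (GI_continuous sH_GI) (GI_morph sH_GI)).
have piX (h : H) : pi (sH h) = (pi h)^-1.
  have : pi (h * sH h) = 1 by apply/qpi_eq1; exact: GI_inverts_Frattini Hpro sH_GI h.
  by rewrite piM => /mulg1_eq ->.
have [k k_inj kE] : exists2 h : H -> H, injective h &
    X_level p sH 0 `&` pi @^-1` [set (v : V)]%classic =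
    h @` (X_level p sH 0 `&` pi @^-1` [set 1]%classic).
  have [h0 vh] := qpi_surj (v : V).
  apply: (X_level_fiber p_odd (sB := t)) => //.
  - exact: pro_p_compact Hpro.
  - exact: (@quot_hausdorff p p_prime H Hpro).
  - exact: (GI_morph sH_GI).
  - exact: (GI_continuous sH_GI).
  - exact: (GI_involutive Hpro sH_GI).
  - exact: (GI_morph tGI).
  - have [n hn] := finite_pgroup_element p_prime Hp h0.
    by exists n; rewrite vh -(morph_gX piM) hn (morph_g1 piM).
  - split=> //; rewrite vh.
    by have := congr1 (fun f => f h0) tpi; rewrite /= -[qpi _ _]/(pi h0) => ->.
have -> : X_level p sH 1 = X_level p sH 0 `&` pi @^-1` [set 1]%classic.
  apply/seteqP; split=> [h [Ph sh]|h [[_ sh] /qpi_eq1 Ph]]; split=> //.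
  exact/qpi_eq1.
have fin0 : finite_set (X_level p sH 0 `&` pi @^-1` [set 1]%classic).
  exact: sub_finite_set finH.
have cardk (A : set H) : finite_set A -> #|` fset_set A| = #|` fset_set (k @` A)|.
  by move=> fA; rewrite fset_set_image// card_imfset.
rewrite cardk// -kE.
rewrite -[RHS]/(#|` fset_set ((X_level p sH 0 `&` pi @^-1` [set (v : V)]%classic) : set K)|).
rewrite card_fset_set_finType; apply: eq_card => h; rewrite !inE.
apply/andP/idP => [[/eqP sh /eqP ph]|]; first by apply/asboolP; split.
by move/asboolP => [[_ sh] ph]; split; apply/eqP.
Qed.

(** The images of the basis under the equivariant surjections, by [free_equivariant] and
    [free_range_generates]. *)
Let good : {set {ffun 'I_g -> K}} :=
  [set y : {ffun 'I_g -> K} | [forall i, y i \in inverted] &&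
           ([ffun i => pKW (y i)] \in generating_tuples W g)]%SET.

Let goodE (y : {ffun 'I_g -> K}) : (y \in good) =
  [forall i, y i \in inverted] && ([ffun i => pKW (y i)] \in generating_tuples W g).
Proof. by rewrite inE. Qed.

Lemma card_good : #|good| =
  (#|` fset_set (X_level p sH 1)| ^ g * \prod_(i < logn p #|W|) (p ^ g - p ^ i))%N.
Proof.
rewrite -(card_generating_tuples p_prime W_abelem) mulnC -sum_nat_const.
rewrite -[LHS]sum1_card (partition_big (fun y : {ffun 'I_g -> K} => [ffun i => pKW (y i)])
  (fun v => v \in generating_tuples W g)) /=; last by move=> y; rewrite goodE => /andP[].
apply: eq_bigr => v vgen.
rewrite -(card_family_const (A := fun i => fiber (v i))); last first.
  by move=> i; exact: card_inverted_fiber.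
rewrite -sum1_card; apply: eq_bigl => y; rewrite goodE [RHS]inE.
apply/andP/forallP => [[/andP[/forallP yi _] /eqP yv] i|yf].
  by rewrite inE yi -yv ffunE eqxx.
have yv : [ffun i => pKW (y i)] = v.
  by apply/ffunP => i; rewrite ffunE; have := yf i; rewrite inE => /andP[_ /eqP].
rewrite yv vgen andbT; split=> //.
by apply/forallP => i; have := yf i; rewrite inE => /andP[].
Qed.

Lemma counting_Sur_free (R : realType) : counting (Sur s sH) =
  (#|` fset_set (X_level p sH 1)| ^ g *
   \prod_(i < gen_rank p H) (p ^ g - p ^ i))%N%:R%:E :> \bar R.
Proof.
have cW : #|W| = #|` fset_set [set: V]|.
  rewrite -[RHS]/(#|` fset_set [set: W]|) card_fset_set_finType -cardsT.
  by apply: eq_card => a; rewrite !inE; apply/esym/asboolP.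
rewrite /gen_rank -cW.
pose ev (f : F -> H) : {ffun 'I_g -> K} := [ffun i => f (x i)].
have ev_inj : {in Sur s sH &, injective ev}.
  move=> f h /set_mem [fc fM _ _] /set_mem [hc hM _ _] /ffunP fh.
  apply: free_hom_eq => // [|i]; first exact: pro_p_hausdorff Hpro.
  by have := fh i; rewrite !ffunE.
rewrite -(counting_image_inj _ ev_inj).
have -> : ev @` Sur s sH = [set y | y \in good]%classic.
  apply/seteqP; split=> [_ [f [fc fM fT fs] <-]|y /=].
    suff : ev f \in good by [].
    rewrite goodE; apply/andP; split.
      apply/forallP => i; rewrite inE ffunE; apply/eqP.
      by move/(free_equivariant fc fM): fs; apply.
    rewrite inE; apply/eqP; rewrite -(free_range_generates fc fM).1//.
    by congr <<_>>; apply: eq_imset => i; rewrite !ffunE.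
  rewrite goodE => /andP[/forallP yi ygen].
  have [f [fc fM fx]] := free_lift (y : 'I_g -> H) Hpro.
  exists f; last by apply/ffunP => i; rewrite ffunE fx.
  split=> //.
    apply/(free_range_generates fc fM); move: ygen; rewrite inE => /eqP <-.
    congr <<_>>; apply: eq_imset => i; rewrite ffunE fx//.
  apply/(free_equivariant fc fM) => i; rewrite fx.
  by have := yi i; rewrite inE => /eqP.
rewrite /counting asboolT; last exact: finite_finset.
congr (_%:R%:E); rewrite -card_good card_fset_set_finType.
by apply: eq_card => y; rewrite inE; apply/asboolP/idP.
Qed.

End Target.
End FreeProP.

End FreeGroups.

(** * The law of the images of random relators *)

Section LawOfRelators.

Local Open Scope group_scope.

Section FinitelyManyValues.
Local Open Scope ring_scope.
Local Open Scope ereal_scope.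
Context d (T : measurableType d) (R : realType) (m : {measure set T -> \bar R}).

Lemma measure_fibers (U : choiceType) (f : T -> U) (A : set U) : finite_set A ->
  (forall u, measurable (f @^-1` [set u]%classic)) ->
  m (f @^-1` A) = \sum_(u \in A) m (f @^-1` [set u]%classic).
Proof.
move=> fA mf; rewrite -measure_fin_bigcup//.
- by congr (m _); apply/seteqP; split=> [t At|t [u Au /= ->]//]; exists (f t).
- by move=> u v _ _ [t [/= <- <-]].
Qed.

End FinitelyManyValues.

Section TupleBox.
Context d (T : measurableType d) (R : realType) (P : probability T R).

Definition tuple_box n (B : 'I_n -> set T) : set (n.-tuple T) :=
  [set r | forall i, B i (tnth r i)].

Lemma measurable_tuple_box n (B : 'I_n -> set T) :
  (forall i, measurable (B i)) -> measurable (tuple_box B).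
Proof.
move=> mB; have -> : tuple_box B = \bigcap_(i in [set: 'I_n]) ((fun r => tnth r i) @^-1` B i).
  by apply/seteqP; split=> [r Br i _|r Br i]; [exact: (Br i)|exact: (Br i I)].
apply: fin_bigcap_measurable => [|i _]; first exact: finite_finset.
by rewrite -[X in measurable X]setTI; apply: measurable_tnth.
Qed.

Lemma tuple_prod_box n (B : 'I_n -> set T) : (forall i, measurable (B i)) ->
  tuple_prod P n (tuple_box B) = (\prod_(i < n) P (B i))%E.
Proof.
elim: n B => [|n IH] B mB.
  rewrite big_ord0 /= diracE mem_set//; by move=> [].
rewrite big_ord_recl /= /pushforward.
have -> : (@tuple_cons _ T n) @^-1` tuple_box B =
    B ord0 `*` tuple_box (fun i => B (lift ord0 i)).
  apply/seteqP; split=> [[a r] /= Br|[a r] /= [Ba Br] i].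
    split; first exact: (Br ord0).
    by move=> i; have := Br (lift ord0 i); rewrite tnthS.
  by case: (unliftP ord0 i) => [j|] ->; rewrite ?tnthS.
rewrite product_measure1E//; last exact: measurable_tuple_box.
by congr (_ * _)%E; exact: (IH (fun i : 'I_n => B (lift ord0 i)) (fun i => mB _)).
Qed.

End TupleBox.

Section LawOnX.
Variables (p : nat).
Hypotheses (p_prime : prime p) (p_odd : odd p).
Variables (g : nat) (F : topGroupType) (x : 'I_g -> F).
Hypothesis F_free : free_pro_p p x.
Variable s : {multiplicative F -> F}.
Hypotheses (sc : continuous s) (sx : forall i, s (x i) = (x i)^-1).
Variables (R : realType) (mu : probability (X p s) R).
Hypothesis mu_unif : uniform_on_levels mu.

Lemma X_measurable_preimage (A : set F) : open A ->
  measurable [set r : X p s | A (\val r)].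
Proof.
move=> oA; apply: sub_sigma_algebra.
by exists A.
Qed.

Let sM : {morph s : u v / u * v} := @gmulfM _ _ s.
Let Fp : pro_p p F := free_pro_p_p F_free.
Let Ffg := free_fg p_prime F_free.

Lemma X_proj_measurable c (A : set (Q p c F)) :
  measurable (@X_proj p F s c @^-1` A).
Proof.
have -> : @X_proj p F s c @^-1` A = [set r : X p s | (qpi (lower_pcentral F p c) @^-1` A) (\val r)].
  by apply/seteqP; split=> r; rewrite /X_proj /= qpiE.
apply: X_measurable_preimage; apply/qpi_openP.
by apply: quot_open_discrete; exact: lower_pcentral_open.
Qed.

Lemma Q_autE c (u : F) : @Q_aut p F s c (qpi (lower_pcentral F p c) u) =
  qpi (lower_pcentral F p c) (s u).
Proof.
rewrite /Q_aut qpiE -[generic_quotient.repr _]/(qrepr _).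
have /qpi_eq Pu : qpi (lower_pcentral F p c) (qrepr (qpi (lower_pcentral F p c) u)) =
  qpi (lower_pcentral F p c) u by rewrite qreprK.
apply/qpi_eq; rewrite -(morph_gV sM) -sM.
exact: lower_pcentral_morph.
Qed.

Lemma X_cE c : @X_c p F s c = X_level p (@Q_aut p F s c) 1.
Proof. by []. Qed.

Variables (H : topGroupType) (sH : H -> H) (c : nat).
Hypotheses (Hp : finite_pgroup p H) (Hc : lower_pcentral H p c = [set 1]%classic :> set H).
Hypothesis sHM : {morph sH : u v / u * v}.
Variable f : F -> H.
Hypotheses (fc : continuous f) (fM : {morph f : u v / u * v}).
Hypotheses (fT : range f = setT) (fs : f \o s = sH \o f).

(** [f] factors through [Q p c F], where the law of a relator is uniform on [X_c]. By
    [X_level_fiber] the fibres over the elements of [X_level p sH 1] have equally many points, so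
    these values share the total mass 1 equally. *)
Lemma X_law h : X_level p sH 1 h ->
  mu [set r | f (\val r) = h] = ((#|` fset_set (X_level p sH 1)|%:R : R)^-1)%:E.
Proof.
move=> Xh; set P := lower_pcentral F p c.
have [k [kc kM] kE] : exists2 k : quot P -> H, continuous k /\ {morph k : u v / u * v} &
    forall u, k (qpi P u) = f u.
  apply: qpi_lift => // u Pu; have := lower_pcentral_morph fc fM Pu.
  by rewrite Hc.
have kT : range k = setT.
  by apply/seteqP; split=> // z _; have [u _ <-] : range f z by [rewrite fT]; exists (qpi P u).
have finQ : finite_set [set: Q p c F] by exact: Q_finite.
have Hpro := finite_pgroup_pro_p p_prime Hp.
have aM : {morph @Q_aut p F s c : u v / u * v}.
  move=> a b; have [[u ->] [v ->]] := (qpi_surj a, qpi_surj b).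
  by rewrite -qpiM !Q_autE sM qpiM.
have aK : involutive (@Q_aut p F s c).
  move=> a; have [u ->] := qpi_surj a.
  by rewrite !Q_autE (free_involutive p_prime F_free sM sc sx).
have ac : continuous (@Q_aut p F s c).
  apply: qpi_factor_continuous.
  have -> : @Q_aut p F s c \o qpi P = qpi P \o s by apply/funext => u /=; exact: Q_autE.
  by move=> u; apply: continuous_comp; [exact: sc|exact: qpi_continuous].
have ka : k \o @Q_aut p F s c = sH \o k.
  apply: quot_eq_morph => u /=; rewrite Q_autE !kE.
  exact: (congr1 (fun t => t u) fs).
have XcP (r : X p s) : @X_c p F s c (X_proj c r).
  rewrite X_cE /X_proj qpiE; have [Pr sr] := set_valP r; split.
    by apply: lower_pcentral_morph Pr; [exact: qpi_continuous|exact: qpiM].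
  by rewrite Q_autE sr (morph_gV (@qpiM _ P)).
have lawE h' : mu [set r | f (\val r) = h'] =
    (\sum_(a \in @X_c p F s c `&` k @^-1` [set h']%classic)
       ((#|` fset_set (@X_c p F s c) |%:R : R)^-1)%:E)%E.
  have -> : [set r | f (\val r) = h'] =
      @X_proj p F s c @^-1` (@X_c p F s c `&` k @^-1` [set h']%classic).
    apply/seteqP; split=> r /=; first by move=> fr; split=> //=; rewrite /X_proj qpiE kE.
    by move=> [_]; rewrite /X_proj qpiE kE.
  rewrite measure_fibers; last 2 first.
  - exact: sub_finite_set finQ.
  - by move=> a; exact: X_proj_measurable.
  apply: eq_fsbigr => a /set_mem[Xa _]; exact: mu_unif.
have lawh h' : X_level p sH 1 h' -> mu [set r | f (\val r) = h'] = mu [set r | f (\val r) = 1].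
  move=> Xh'; have [|||t t_inj tE] := X_level_fiber p_odd _ _ aM ac aK sHM _ kc kM kT ka Xh'.
  - exact: finite_compact.
  - exact: pro_p_hausdorff Hpro.
  - exact: finite_pgroup_element.
  rewrite !lawE X_cE tE fsbig_image//; first exact: in2W.
have finX : finite_set (X_level p sH 1) by exact: sub_finite_set (finite_pgroup_finite Hp).
have : mu [set: X p s] = (\sum_(h' \in X_level p sH 1) mu [set r | f (\val r) = h'])%E.
  have -> : [set: X p s] = (fun r : X p s => f (\val r)) @^-1` X_level p sH 1.
    apply/seteqP; split=> // r _ /=; have [Pr sr] := set_valP r; split.
      exact: lower_pcentral_morph.
    have := congr1 (fun t => t (\val r)) fs; rewrite /= => <-.
    by rewrite -(morph_gV fM) -sr.
  rewrite measure_fibers// => h'.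
  apply: (X_measurable_preimage (A := f @^-1` [set h']%classic)).
  by have /continuousP := fc; apply; case: Hp.
rewrite probability_setT.
rewrite (eq_fsbigr (fun=> mu [set r | f (\val r) = 1])); last first.
  by move=> h' /set_mem; exact: lawh.
rewrite (lawh _ Xh); set m := mu _.
have -> : m = (fine m)%:E.
  rewrite fineK// fin_num_measure//.
  apply: (X_measurable_preimage (A := f @^-1` [set 1]%classic)).
  by have /continuousP := fc; apply; case: Hp.
rewrite fsbig_finite//= sumEFin big_const_seq count_predT iter_addr_0 => -[].
set N := #|` _ |; move: (fine m) => r e.
have N0 : (N%:R != 0 :> R)%R.
  by apply/eqP => N0; move: e; rewrite -mulr_natr N0 mulr0 => /eqP; rewrite oner_eq0.
by congr (_%:E)%E; apply: (mulIf N0); rewrite mulVf// mulr_natr -e.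
Qed.

Lemma tuple_X_law n (h : 'I_n -> H) : (forall i, X_level p sH 1 (h i)) ->
  tuple_prod mu n (tuple_box (fun i => [set r : X p s | f (\val r) = h i])) =
  ((#|` fset_set (X_level p sH 1)|%:R ^- n : R))%R%:E.
Proof.
move=> Xh; rewrite tuple_prod_box; last first.
  move=> i; apply: (X_measurable_preimage (A := f @^-1` [set h i]%classic)).
  by have /continuousP := fc; apply; case: Hp.
under eq_bigr do rewrite X_law//.
by rewrite prodEFin prodr_const card_ord exprVn.
Qed.

End LawOnX.

End LawOfRelators.

(** * Cohomology in degree two of free pro-p groups *)

Section H2Free.

Local Open Scope group_scope.

Section LocallyConstant.
Variable p : nat.
Local Notation D := (disc 'F_p).

(** In this form a homomorphism to 'F_p is a continuous morphism to a pro-p group, within reach of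
    the universal property of the free group. *)
Lemma locally_constantP (T : topologicalType) (f : T -> 'F_p) :
  locally_constant f <-> continuous (fun t => todisc (f t) : D).
Proof.
split=> [lf|/continuousP cf a].
  apply/continuousP => A _.
  have -> : (fun t => todisc (f t) : D) @^-1` A =
      \bigcup_(a in [set a | A (todisc a)]) (f @^-1` [set a]%classic).
    by apply/seteqP; split=> [t At|t [a /= Aa ->]//]; exists (f t).
  by apply: bigcup_open => a _; exact: lf.
have := cf [set (todisc a : D)]%classic (@disc_open _ _); congr open.
by apply/seteqP; split=> t /=; [exact: (can_inj (@todiscK _))|move=> ->].
Qed.

Lemma locally_constant_op2 (T : topologicalType) (f h : T -> 'F_p) (op : 'F_p -> 'F_p -> 'F_p) :
  locally_constant f -> locally_constant h -> locally_constant (fun t => op (f t) (h t)).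
Proof.
move=> lf lh a.
have -> : (fun t => op (f t) (h t)) @^-1` [set a]%classic =
    \bigcup_(bc in [set bc | op bc.1 bc.2 = a])
      (f @^-1` [set bc.1]%classic `&` h @^-1` [set bc.2]%classic).
  apply/seteqP; split=> [t /= ta|t [[b c] /= <- [-> ->]]//].
  by exists (f t, h t).
by apply: bigcup_open => bc _; apply: openI; [exact: lf|exact: lh].
Qed.

Lemma locally_constant_cst (T : topologicalType) (a : 'F_p) :
  locally_constant (fun _ : T => a).
Proof. by apply/locally_constantP => t; exact: cvg_cst. Qed.

Lemma locally_constant_comp (T U : topologicalType) (f : T -> U) (h : U -> 'F_p) :
  continuous f -> locally_constant h -> locally_constant (h \o f).
Proof.
move=> fc /locally_constantP hc; apply/locally_constantP => t.
by apply: (@continuous_comp _ _ _ f (fun u => todisc (h u) : D)); [exact: fc|exact: hc].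
Qed.

Lemma locally_constant_sum (T : topologicalType) (I : Type) (r : seq I)
    (f : I -> T -> 'F_p) : (forall i, locally_constant (f i)) ->
  locally_constant (fun t => \sum_(i <- r) f i t)%R.
Proof.
move=> lf; elim: r => [|i r IH].
  by under eq_fun do rewrite big_nil; exact: locally_constant_cst.
by under eq_fun do rewrite big_cons; exact: locally_constant_op2.
Qed.

Hypothesis p_prime : prime p.

Lemma disc_Fp_pro_p : pro_p p D.
Proof. by apply: (disc_pro_p p_prime); rewrite card_Fp// pnat_id. Qed.

Lemma locally_constant_morph_Frattini (G : topGroupType) (f : G -> 'F_p) :
  locally_constant f -> (forall u v, f (u * v)%g = f u + f v)%R ->
  forall u, cn_set (lower_pcentral G p 1) u -> (f u = 0)%R.
Proof.
move=> /locally_constantP fc fM u Pu.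
have dM : {morph (fun t => todisc (f t) : D) : u v / u * v}.
  by move=> a b; rewrite fM -todiscM.
have := lower_pcentral_morph fc dM Pu.
suff -> : lower_pcentral D p 1 = [set 1]%classic :> set D.
  by move=> /(can_inj (@todiscK _)).
apply/seteqP; split=> [|_ ->]; last exact: (cn_1 (lower_pcentral D p 1)).
apply: closed_gen_min.
  by apply: closed_subgroup_set1; exact: pro_p_hausdorff disc_Fp_pro_p.
move=> _ [[a _ [b _ <-]]|[b _ <-]] /=.
  apply/eqP/commgP; apply: (can_inj (@ofdiscK _)); rewrite !ofdiscM.
  exact: addrC.
apply: (can_inj (@ofdiscK _)); rewrite (morph_gX (@ofdiscM _)).
rewrite (morph_g1 (@ofdiscM _)) FinRing.zmodXgE -mulr_natr.
by rewrite pchar_Fp_0// mulr0.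
Qed.

End LocallyConstant.

Section Extension.
Variables (p : nat) (G : topGroupType) (z : G * G -> 'F_p).
Hypothesis zc : cocycle2 z.
Local Notation D := (disc 'F_p).
Local Open Scope ring_scope.

Let zl : locally_constant z. Proof. by case: zc. Qed.
Let zE u v w : z (v, w) - z ((u * v)%g, w) + z (u, (v * w)%g) - z (u, v) = 0.
Proof. by case: zc. Qed.

Let z1l v : z (1%g, v) = z (1%g, 1%g).
Proof.
by apply/eqP; rewrite -subr_eq0 -(zE 1%g 1%g v) !mul1g subrr add0r.
Qed.

Let z1r u : z (u, 1%g) = z (1%g, 1%g).
Proof.
apply/eqP; rewrite eq_sym -subr_eq0 -(zE u 1%g 1%g) !mulg1.
by rewrite subrK.
Qed.

(* The central extension of [G] by the cyclic group of order [p] with factor set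
   [z]. *)
Definition ext : Type := let _ := zc in (D * G)%type.
HB.instance Definition _ := Topological.copy ext (D * G)%type.

Definition ext_mul (a b : ext) : ext :=
  (todisc (ofdisc a.1 + ofdisc b.1 + z (a.2, b.2)), (a.2 * b.2)%g).
(** The cocycle is not assumed to be normalized, whence the correction by its value at [(1, 1)]. *)
Definition ext_one : ext := (todisc (- z (1%g, 1%g)), 1%g).
Definition ext_inv (a : ext) : ext :=
  (todisc (- ofdisc a.1 - z (1%g, 1%g) - z ((a.2)^-1%g, a.2)), (a.2)^-1%g).

Fact ext_mulA : associative ext_mul.
Proof.
move=> [a u] [b v] [c w]; congr (_, _) => /=; last by rewrite mulgA.
rewrite !todiscK; congr todisc.
have /eqP := zE u v w; rewrite subr_eq0 => /eqP <-.
rewrite -!addrA; do 2!congr (_ + _).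
rewrite !addrA addrAC [_ + ofdisc c]addrC -!addrA; congr (_ + _).
by rewrite (addrC _ (z ((u * v)%g, w))) addKr addrC.
Qed.

Fact ext_mul1 : left_id ext_one ext_mul.
Proof.
move=> [a u]; congr (_, _) => /=; last by rewrite mul1g.
by rewrite todiscK (z1l u) addrAC addNr add0r ofdiscK.
Qed.

Fact ext_1mul : right_id ext_one ext_mul.
Proof.
move=> [a u]; congr (_, _) => /=; last by rewrite mulg1.
by rewrite todiscK (z1r u) subrK ofdiscK.
Qed.

Fact ext_mulV : left_inverse ext_one ext_inv ext_mul.
Proof.
move=> [a u]; congr (_, _) => /=; last by rewrite mulVg.
rewrite todiscK; congr todisc.
by rewrite addrAC subrK addrAC addNr add0r.
Qed.

Fact ext_Vmul : right_inverse ext_one ext_inv ext_mul.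
Proof.
move=> [a u]; congr (_, _) => /=; last by rewrite mulgV.
rewrite todiscK; congr todisc.
have -> : z (u^-1%g, u) = z (u, u^-1%g).
  have := zE u u^-1%g u; rewrite mulgV mulVg z1l z1r subrK => /eqP.
  by rewrite subr_eq0 => /eqP.
by rewrite !addrA subrr add0r subrK.
Qed.

HB.instance Definition _ := @isGroup.Build ext ext_one ext_inv ext_mul
  ext_mulA ext_mul1 ext_1mul ext_mulV ext_Vmul.

Let z_continuous : continuous (fun uv : G * G => todisc (z uv) : D).
Proof. exact/locally_constantP. Qed.

Let disc_cont2 (T : topologicalType) (f h : T -> D) (op : 'F_p -> 'F_p -> 'F_p) :
  continuous f -> continuous h ->
  continuous (fun t => todisc (op (ofdisc (f t)) (ofdisc (h t))) : D).
Proof.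
move=> fc hc; apply/locally_constantP.
apply: locally_constant_op2; apply/locally_constantP.
  by have -> : (fun t => todisc (ofdisc (f t)) : D) = f by apply/funext => t; rewrite ofdiscK.
by have -> : (fun t => todisc (ofdisc (h t)) : D) = h by apply/funext => t; rewrite ofdiscK.
Qed.

Let ext_pair_continuous (T : topologicalType) (f : T -> D) (h : T -> G) :
  continuous f -> continuous h -> continuous (fun t => (f t, h t) : ext).
Proof.
move=> fc hc t W [[U V] /= [Uf Vh] UV].
have : nbhs t (f @^-1` U `&` h @^-1` V)%classic.
  by apply: filterI; [exact: fc|exact: hc].
suff : (f @^-1` U `&` h @^-1` V `<=` (fun t => (f t, h t) : ext) @^-1` W)%classic.
  by move=> /filterS; apply.
by move=> y [Uy Vy]; exact: (UV (f y, h y)).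
Qed.

Let ext_fst_continuous : continuous (fun a : ext => a.1 : D).
Proof. by move=> a; exact: cvg_fst. Qed.

Let ext_snd_continuous : continuous (fun a : ext => a.2 : G).
Proof. by move=> a; exact: cvg_snd. Qed.

Let comp_cont (T U V : topologicalType) (f : T -> U) (h : U -> V) :
  continuous f -> continuous h -> continuous (h \o f).
Proof. by move=> fc hc t; apply: continuous_comp; [exact: fc|exact: hc]. Qed.

Fact ext_mul_continuous : continuous (fun ab : ext * ext => (ab.1 * ab.2)%g).
Proof.
have c1 : continuous (fun ab : ext * ext => ab.1) by move=> ?; exact: cvg_fst.
have c2 : continuous (fun ab : ext * ext => ab.2) by move=> ?; exact: cvg_snd.
have c11 := comp_cont c1 ext_fst_continuous; have c12 := comp_cont c1 ext_snd_continuous.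
have c21 := comp_cont c2 ext_fst_continuous; have c22 := comp_cont c2 ext_snd_continuous.
have cp : continuous (fun ab : ext * ext => (ab.1.2, ab.2.2)).
  by move=> t; apply: cvg_pair; [exact: c12|exact: c22].
have cm : continuous (fun ab : ext * ext => (ab.1.2 * ab.2.2)%g).
  exact: (comp_cont cp (@mulg_continuous G)).
have cz := comp_cont cp z_continuous.
apply: (ext_pair_continuous _ cm).
have := disc_cont2 (op := fun c d => c + d)
  (disc_cont2 (op := fun c d => c + d) c11 c21) cz.
rewrite (_ : (fun t => _) = (fun t : ext * ext => (t.1 * t.2)%g.1 : D))//.
by apply/funext => t /=; rewrite !todiscK.
Qed.

Fact ext_inv_continuous : continuous (fun a : ext => a^-1%g).
Proof.
have ci := comp_cont ext_snd_continuous (@invg_continuous G).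
apply: (ext_pair_continuous _ ci).
have cp : continuous (fun a : ext => ((a.2)^-1%g, a.2)).
  by move=> t; apply: cvg_pair; [exact: ci|exact: ext_snd_continuous].
have cz := comp_cont cp z_continuous.
have := disc_cont2 (op := fun c d => - c - z (1%g, 1%g) - d) ext_fst_continuous cz.
rewrite (_ : (fun t => _) = (fun t : ext => (t^-1)%g.1 : D))//.
by apply/funext => t /=; rewrite !todiscK.
Qed.

HB.instance Definition _ :=
  isTopologicalGroup.Build ext ext_mul_continuous ext_inv_continuous.

Definition ext_proj (a : ext) : G := a.2.

Lemma ext_projM : {morph ext_proj : a b / (a * b)%g}. Proof. by []. Qed.

Lemma ext_proj_continuous : continuous ext_proj. Proof. exact: ext_snd_continuous. Qed.

Lemma ext_fstM (a b : ext) : ofdisc (a * b)%g.1 = ofdisc a.1 + ofdisc b.1 + z (a.2, b.2).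
Proof. by rewrite -[RHS]todiscK. Qed.

Lemma ext_kernel_central (k a : ext) : k.2 = 1%g -> (k * a = a * k)%g.
Proof.
move=> k1; apply: injective_projections => /=.
  apply: (can_inj (@ofdiscK _)); rewrite !ext_fstM k1 (z1l a.2) (z1r a.2).
  by congr (_ + _); exact: addrC.
by rewrite k1 mul1g mulg1.
Qed.

Hypothesis p_prime : prime p.

Lemma ext_kernel_exponent (k : ext) : k.2 = 1%g -> (k ^+ p = 1)%g.
Proof.
move=> k1; pose w := z (1%g, 1%g).
have kX n : (k ^+ n)%g.2 = 1%g.
  by rewrite -[_.2]/(ext_proj _) (morph_gX ext_projM) /ext_proj k1 expg1n.
(* On the kernel, the first component becomes additive once shifted by [w]. *)
have kn n : ofdisc (k ^+ n)%g.1 = (ofdisc k.1 + w) *+ n - w.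
  elim: n => [|n IH]; first by rewrite mulr0n sub0r; exact: (todiscK (- w)).
  rewrite expgSr ext_fstM IH kX k1 mulrSr -/w.
  by rewrite -!addrA; congr (_ + _); rewrite subrr addr0 addrC addrK.
apply: injective_projections; last by rewrite kX.
apply: (can_inj (@ofdiscK _)); rewrite kn -mulr_natr pchar_Fp_0// mulr0 sub0r.
exact/esym/(todiscK (- w)).
Qed.

Hypothesis Gp : pro_p p G.

(** Some [p ^ n]-th power of [e] falls into the image of [M] in [G], so [e ^+ (p ^ n)] is an element
    of [M] times one of the kernel. The kernel is central of exponent [p], and one more [p]-th power
    lands in [M]. *)
Lemma ext_pro_p : pro_p p ext.
Proof.
have /(pro_pP p_prime)[cG zG Gx] := Gp; apply/(pro_pP p_prime); split.
- have -> : [set: ext] = ([set: D] `*` [set: G])%classic by apply/seteqP; split.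
  apply: compact_setX => //; apply: finite_compact; exact: disc_finite.
- move=> [a u] [b v] /eqP abuv; have [ab|/eqP ab] := pselect (a = b).
    have /eqP uv : u <> v by move=> uv; apply: abuv; rewrite ab uv.
    have [U [[oU cU] Uu Uv]] := zG _ _ uv.
    exists (ext_proj @^-1` U); split => //; split.
      by have /continuousP := ext_proj_continuous; exact.
    by apply: closed_comp => // t _; exact: ext_proj_continuous.
  exists ((fun e : ext => e.1 : D) @^-1` [set a]%classic); split => //; last first.
    by move=> /= ba; rewrite ba eqxx in ab.
  have /continuousP fo := ext_fst_continuous; split; first exact: fo.
  by rewrite -openC preimage_setC; exact: fo.
- move=> M oM e.
  pose A := (ext_proj @` M)%classic.
  have oA : open A.
    rewrite openE => _ [[a u] Mau <-]; rewrite /interior.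
    have : nbhs ((a, u) : D * G) (M : set (D * G)).
      exact: (open_nbhs_nbhs (conj (oM : open (M : set (D * G))) Mau)).
    move=> [[U V] /= [Ua Vu] UV]; apply: filterS Vu => v Vv.
    by exists (a, v) => //; apply: (UV (a, v)); split => //=; exact: nbhs_singleton.
  have A1 : A 1%g by exists 1%g => //; exact: cn_1.
  have AF u v : A u -> A v -> A (u * v^-1)%g.
    move=> [a Ma <-] [b Mb <-]; exists (a * b^-1)%g; last by rewrite ext_projM (morph_gV ext_projM).
    by apply: cn_M => //; exact: cn_V.
  have AJ : conj_invariant A.
    move=> _ v [a Ma <-]; exists (a ^ ((todisc (0%R : 'F_p), v) : ext))%g; first exact: cn_J.
    by rewrite (morph_gJ ext_projM).
  have [n [m Mm me]] := Gx (ClosedNormal (open_subgroup_closed oA A1 AF) AJ) oA (ext_proj e).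
  exists n.+1; pose k := (m^-1 * e ^+ (p ^ n))%g.
  have k1 : k.2 = 1%g.
    rewrite -[k.2]/(ext_proj k) /k ext_projM (morph_gV ext_projM) me.
    by rewrite (morph_gX ext_projM) mulVg.
  rewrite expnSr expgnA -[(e ^+ (p ^ n))%g](mulKVg m) -/k.
  rewrite expgMn; last by apply/commute_sym; exact: ext_kernel_central.
  by rewrite (ext_kernel_exponent k1) mulg1; exact: cn_X.
Qed.

End Extension.

(* By freeness, the extension with factor set [z] splits. *)
Lemma free_cocycle2 (p g : nat) (F : topGroupType) (x : 'I_g -> F) (z : F * F -> 'F_p) :
  prime p -> free_pro_p p x -> cocycle2 z -> coboundary2 z.
Proof.
move=> p_prime F_free zc; have Fp := free_pro_p_p F_free.
have [f [fc fM fx]] := free_lift F_free (fun i => (todisc (0%R : 'F_p), x i) : ext zc)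
  (ext_pro_p zc p_prime Fp).
have fE : @ext_proj _ _ _ zc \o f = idfun.
  apply: (free_hom_eq p_prime F_free (pro_p_hausdorff Fp)).
  - by move=> u; apply: continuous_comp; [exact: fc|exact: ext_proj_continuous].
  - by move=> u; exact: cvg_id.
  - by move=> u v /=; rewrite fM.
  - by [].
  - by move=> i /=; rewrite fx.
have f2 u : (f u).2 = u by exact: (congr1 (fun h => h u) fE).
(* If [b u] is the first component of the splitting, multiplicativity reads
   [b (u * v) = b u + b v + z (u, v)]: hence the sign. *)
exists (fun u => - ofdisc (f u).1)%R.
  apply/locally_constantP.
  have : continuous (fun u => (f u).1 : disc 'F_p).
    by move=> u; apply: (@continuous_comp _ _ _ f (fun a : ext zc => a.1 : disc 'F_p));
      [exact: fc|exact: cvg_fst].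
  move=> f1c; apply/locally_constantP.
  apply: (@locally_constant_op2 p F _ (fun=> 0)%R (fun a _ => - a)%R) => //.
    apply/locally_constantP.
    by have -> : (fun u => todisc (ofdisc (f u).1) : disc 'F_p) = (fun u => (f u).1)
      by apply/funext => u; rewrite ofdiscK.
  exact: locally_constant_cst.
apply/funext => -[u v] /=; rewrite fM ext_fstM !f2 opprK.
have E (a b c : 'F_p) : (c = - b + (a + b + c) - a)%R.
  by rewrite [(a + b)%R]addrC -!addrA addKr addrC subrK.
exact: E.
Qed.

End H2Free.

(** * Ranks of presented groups *)

Section Presentations.

Local Open Scope group_scope.

Lemma qrepr_invariant (G : topGroupType) (N : closedNormal G) (T : Type) (h : G -> T) :
  (forall u n, cn_set N n -> h (u * n) = h u) -> forall u, h (qrepr (qpi N u)) = h u.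
Proof.
move=> hN u; have /esym/qpi_eq Nu : qpi N (qrepr (qpi N u)) = qpi N u by rewrite qreprK.
by rewrite -(mulKVg u (qrepr _)) hN.
Qed.

Lemma locally_constant_quot (p : nat) (G : topGroupType) (N : closedNormal G)
    (f : quot N -> 'F_p) : locally_constant (f \o qpi N) -> locally_constant f.
Proof. by move=> lf a; apply/qpi_openP; rewrite -comp_preimage; exact: lf. Qed.

Lemma locally_constant_closed (p : nat) (T : topologicalType) (f : T -> 'F_p) a :
  locally_constant f -> closed (f @^-1` [set a]%classic).
Proof.
move=> lf; rewrite -openC.
have -> : ~` (f @^-1` [set a]%classic) = \bigcup_(b in [set b | b <> a]) f @^-1` [set b]%classic.
  by apply/seteqP; split=> [t fa|t [b /= ba ->]//]; exists (f t).
by apply: bigcup_open => b _; exact: lf.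
Qed.

Lemma qpi2_continuous (G : topGroupType) (N : closedNormal G) :
  continuous (fun uv : G * G => (qpi N uv.1, qpi N uv.2)).
Proof.
move=> [u v] W [[U V] /= [Uu Vv] UV].
exists (qpi N @^-1` U, qpi N @^-1` V) => [|[u' v'] /= [Uu' Vv']].
  by split; exact: qpi_continuous.
exact: (UV (qpi N u', qpi N v')).
Qed.

Lemma locally_constant_quot2 (p : nat) (G : topGroupType) (N : closedNormal G)
    (f : quot N * quot N -> 'F_p) :
  locally_constant (fun uv => f (qpi N uv.1, qpi N uv.2)) -> locally_constant f.
Proof.
move=> lf a; rewrite openE => -[c d] /= fcd; rewrite /interior.
have [[u cu] [v dv]] := (qpi_surj c, qpi_surj d); subst c d.
have : nbhs (u, v) ((fun uv => f (qpi N uv.1, qpi N uv.2)) @^-1` [set a]%classic).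
  by apply: open_nbhs_nbhs; split=> //; exact: lf.
move=> [[U V] /= [Uu Vv] UV].
exists (qpi N @` U, qpi N @` V).
  by rewrite -qpiE; split; exact: quot_pi_nbhs.
by move=> [_ _] /= [[u' Uu' <-] [v' Vv' <-]]; exact: (UV (u', v')).
Qed.

Section Del.
Variables (p : nat) (G : topGroupType).
Local Open Scope ring_scope.

Definition del (h : G -> 'F_p) (uv : G * G) : 'F_p := h uv.2 - h (uv.1 * uv.2)%g + h uv.1.

Lemma del_lin (I : finType) (h : G -> 'F_p) (a : I -> 'F_p) (k : I -> G -> 'F_p) uv :
  del (fun u => h u - \sum_i a i * k i u) uv = del h uv - \sum_i a i * del (k i) uv.
Proof.
rewrite /del; under [in RHS]eq_bigr do rewrite mulrDr mulrBr.
rewrite big_split sumrB /= [in RHS]opprD [RHS]addrACA; congr (_ + _).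
by rewrite !opprD !opprK addrACA.
Qed.

Lemma del_cocycle2 (h : G -> 'F_p) : locally_constant h -> cocycle2 (del h).
Proof.
move=> lh; split.
  have l1 : locally_constant (fun uv : G * G => h uv.1).
    by apply: (@locally_constant_comp _ _ _ fst) => // t; exact: cvg_fst.
  have l2 : locally_constant (fun uv : G * G => h uv.2).
    by apply: (@locally_constant_comp _ _ _ snd) => // t; exact: cvg_snd.
  have l3 : locally_constant (fun uv : G * G => h (uv.1 * uv.2)%g).
    by apply: (@locally_constant_comp _ _ _ (fun uv : G * G => (uv.1 * uv.2)%g)) => //; exact: mulg_continuous.
  have l4 := @locally_constant_op2 p _ _ _ (fun a b => a - b) l2 l3.
  exact: (@locally_constant_op2 p _ _ _ (fun a b => a + b) l4 l1).
move=> u v w; rewrite /del /= mulgA.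
set a := h w; set b := h (v * w)%g; set c := h v; set d := h (u * v * w)%g.
set e := h (u * v)%g; set f := h u.
rewrite [LHS]addrAC -[X in X + _]addrA -opprD addrAC.
apply/eqP; rewrite subr_eq0; apply/eqP.
by rewrite addrACA [X in X + _]addrA subrK -[RHS]addrA; congr (_ + _); rewrite addrA [e + _]addrC subrK.
Qed.

End Del.

Section Presented.
Variables (p : nat).
Hypothesis p_prime : prime p.
Variables (g : nat) (F : topGroupType) (x : 'I_g -> F).
Hypothesis F_free : free_pro_p p x.
Variable rho : 'I_g -> F.
Hypothesis rhoP : forall i, cn_set (lower_pcentral F p 1) (rho i).
Local Notation N := (closed_normal_closure (range rho)).
Local Open Scope ring_scope.

Lemma relators_Frattini u : cn_set N u -> cn_set (lower_pcentral F p 1) u.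
Proof. by apply: closed_normal_closure_min => _ [i _ <-]; exact: rhoP. Qed.

Lemma cocycle1_eq (f h : F -> 'F_p) : cocycle1 f -> cocycle1 h ->
  (forall i, f (x i) = h (x i)) -> f = h.
Proof.
move=> [/locally_constantP fc fM] [/locally_constantP hc hM] fh.
have : (fun u => todisc (f u) : disc 'F_p) = (fun u => todisc (h u)).
  apply: (free_hom_eq p_prime F_free (pro_p_hausdorff (disc_Fp_pro_p p_prime)) fc hc).
  - by move=> u v; rewrite fM -todiscM.
  - by move=> u v; rewrite hM -todiscM.
  - by move=> i; rewrite fh.
by move=> E; apply/funext => u; have /(congr1 (fun k => ofdisc (k u))) := E; rewrite !todiscK.
Qed.

Lemma dual_basis : exists2 xi : 'I_g -> F -> 'F_p, (forall i, cocycle1 (xi i)) &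
  forall i j, xi i (x j) = (i == j)%:R.
Proof.
have H i := free_lift F_free (fun j => todisc ((i == j)%:R : 'F_p)) (disc_Fp_pro_p p_prime).
exists (fun i u => ofdisc (projT1 (cid (H i)) u)) => [i|i j]; case: cid => f [fc fM fx] /=.
  split=> [|u v]; last by rewrite fM ofdiscM.
  apply/locally_constantP.
  by have -> : (fun t => todisc (ofdisc (f t))) = f by apply/funext => t; rewrite ofdiscK.
by rewrite fx todiscK.
Qed.

(** The relators lie in the Frattini subgroup, so every homomorphism from the free group to 'F_p
    descends to the quotient. *)
Lemma presented_d_eq : d_eq p (quot N : topGroupType) g.
Proof.
have [xi xiZ xix] := dual_basis.
have xiN i u n : cn_set N n -> xi i (u * n)%g = xi i u.
  move=> Nn; have [li ->] := xiZ i.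
  by rewrite (locally_constant_morph_Frattini p_prime li (proj2 (xiZ i)) (relators_Frattini Nn)) addr0.
have bE i u : xi i (qrepr (qpi N u)) = xi i u by apply: qrepr_invariant => ? ?; exact: xiN.
exists (fun i => xi i \o @qrepr F N) => [i|z [lz zM]].
  split=> [|a b].
    apply: locally_constant_quot; have -> : (xi i \o @qrepr F N) \o qpi N = xi i.
      by apply/funext => u; exact: bE.
    by have [] := xiZ i.
  have [[u ->] [v ->]] := (qpi_surj a, qpi_surj b).
  by rewrite -qpiM /= !bE; have [_ ->] := xiZ i.
have sumE (a : {ffun 'I_g -> 'F_p}) j : \sum_i a i * xi i (x j) = a j.
  rewrite (bigD1 j)//= xix eqxx mulr1 big1 ?addr0// => i ij.
  by rewrite xix (negbTE ij) mulr0.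
exists [ffun i => z (qpi N (x i))]; split=> [|a /(congr1 (fun k => k (qpi N (x _)))) aE].
  apply/quot_eq_morph => u /=; apply/eqP; rewrite subr_eq0; apply/eqP.
  under eq_bigr do rewrite bE.
  pose S u := \sum_i [ffun i => z (qpi N (x i))] i * xi i u.
  suff /(congr1 (fun k => k u)) : z \o qpi N = S by [].
  apply: cocycle1_eq.
  - split=> [|v w]; last by rewrite /= qpiM zM.
    by apply: locally_constant_comp lz; exact: qpi_continuous.
  - split=> [|v w].
      apply: locally_constant_sum => i.
      apply: (@locally_constant_op2 p F _ (fun=> 0) (fun b _ => _ * b)).
        by have [] := xiZ i.
      exact: locally_constant_cst.
    by rewrite /S -big_split; apply: eq_bigr => i _; have [_ ->] := xiZ i; rewrite mulrDr.
  - by move=> j; rewrite /S sumE ffunE.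
apply/ffunP => j; rewrite ffunE.
have /eqP := aE j; rewrite /= subr_eq0 => /eqP ->.
by rewrite -[RHS]sumE; apply: eq_bigr => i _; rewrite bE.
Qed.

(* The restrictions of the [k i] to [N] form a basis of the [F]-invariant
   homomorphisms from [N] to 'F_p, dual to the relators; as H^2 of [F] vanishes,
   the classes of the [del (k i)] form a basis of H^2 of the quotient. *)
Variable k : 'I_g -> F -> 'F_p.
Hypothesis kl : forall i, locally_constant (k i).
Hypothesis kr : forall i u n, cn_set N n -> k i (u * n)%g = k i u + k i n.
Hypothesis kL : forall i u n, cn_set N n -> k i (n * u)%g = k i n + k i u.
Hypothesis k_rho : forall i j, k i (rho j) = (i == j)%:R.

Lemma presented_r_eq : r_eq p (quot N : topGroupType) g.
Proof.
have kJ i n v : cn_set N n -> k i (n ^ v)%g = k i n.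
  move=> Nn; apply: (@addrI _ (k i v)); rewrite -(kr i v (cn_J v Nn)) -conjgC.
  by rewrite (kL i v Nn) addrC.
have k1 i : k i 1%g = 0.
  by apply: (@addrI _ (k i 1%g)); rewrite -(kr i 1%g (cn_1 _)) mulg1 addr0.
have dkN i u v n m : cn_set N n -> cn_set N m ->
    del (k i) ((u * n)%g, (v * m)%g) = del (k i) (u, v).
  move=> Nn Nm; rewrite /del /=.
  have -> : (u * n * (v * m) = u * v * (n ^ v * m))%g by rewrite /conjg !mulgA mulgK.
  have Nnv := cn_J v Nn.
  rewrite (kr _ _ Nm) (kr _ _ (cn_M Nnv Nm)) (kr _ _ Nm) (kr _ _ Nn) kJ//.
  rewrite [k i n + k i m]addrC opprD [X in X + _]addrACA [in k i m + _]opprD.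
  by rewrite [k i m + _]addrA subrr sub0r [k i u + _]addrC addrA subrK.
have E3 (s t w : 'F_p) : w = s + t - (t - w + s).
  by rewrite opprD opprB [w - t - s]addrC addrACA subrr add0r addrC subrK.
pose b i (ab : quot N * quot N) := del (k i) (qrepr ab.1, qrepr ab.2).
have bE i u v : b i (qpi N u, qpi N v) = del (k i) (u, v).
  have qN w : exists2 n, cn_set N n & qrepr (qpi N w) = (w * n)%g.
    exists (w^-1 * qrepr (qpi N w))%g; last by rewrite mulKVg.
    by apply/qpi_eq; rewrite qreprK.
  by have [[n Nn nE] [m Nm mE]] := (qN u, qN v); rewrite /b /= nE mE dkN.
have bZ i : cocycle2 (b i).
  have [dl dZ] := del_cocycle2 (kl i); split.
    apply: locally_constant_quot2; rewrite (_ : (fun _ => _) = del (k i))//.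
    by apply/funext => -[u v]; exact: bE.
  move=> a c d; have [[u ->] [[v ->] [w ->]]] := (qpi_surj a, (qpi_surj c, qpi_surj d)).
  by rewrite -!qpiM !bE dZ.
have bsum (a : 'I_g -> 'F_p) u v : \sum_i a i * b i (qpi N u, qpi N v) =
    \sum_i a i * del (k i) (u, v) by apply: eq_bigr => i _; rewrite bE.
exists b => // z [zl zE].
(* Inflated to the free group, [z] is the coboundary of some [h]. Up to the constant [h 1], this [h]
   is additive along [N] on both sides, so on [N] it is determined by its values at the relators. *)
have [h hl hE] : coboundary2 (fun uv => z (qpi N uv.1, qpi N uv.2)).
  apply: (free_cocycle2 p_prime F_free); split=> [|u v w]; last by rewrite /= !qpiM.
  by apply: locally_constant_comp zl; exact: qpi2_continuous.
have hE' u v : z (qpi N u, qpi N v) = del h (u, v).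
  by have := congr1 (fun k => k (u, v)) hE.
have z1r a : z (a, 1%g) = z (1%g, 1%g).
  by apply/eqP; rewrite eq_sym -subr_eq0 -(zE a 1%g 1%g) !mulg1 subrK.
have z1l a : z (1%g, a) = z (1%g, 1%g).
  by apply/eqP; rewrite -subr_eq0 -(zE 1%g 1%g a) !mul1g subrr add0r.
have z11 : z (1%g, 1%g) = h 1%g.
  by rewrite -(morph_g1 (@qpiM _ N)) hE' /del /= mulg1 subrr add0r.
have hr u n : cn_set N n -> h (u * n)%g = h u + h n - h 1%g.
  move=> /qpi_eq1 Nn; have := hE' u n; rewrite Nn z1r z11 /del /= => ->.
  exact: E3.
have hL u n : cn_set N n -> h (n * u)%g = h n + h u - h 1%g.
  move=> /qpi_eq1 Nn; have := hE' n u; rewrite Nn z1l z11 /del /= => ->.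
  exact: E3.
pose a := [ffun j => h (rho j) - h 1%g].
have sumk (c : {ffun 'I_g -> 'F_p}) j : \sum_i c i * k i (rho j) = c j.
  rewrite (bigD1 j)//= k_rho eqxx mulr1 big1 ?addr0// => i ij.
  by rewrite k_rho (negbTE ij) mulr0.
have comb_l (c : {ffun 'I_g -> 'F_p}) f : locally_constant f ->
    locally_constant (fun u => f u - \sum_i c i * k i u).
  move=> fl; apply: (@locally_constant_op2 p F f _ (fun s t => s - t)) => //.
  apply: locally_constant_sum => i.
  by apply: (@locally_constant_op2 p F _ (fun=> 0) (fun b _ => _ * b)) => //; exact: locally_constant_cst.
exists a; split.
  (* The coefficients [a] are chosen so that [q] vanishes at the relators. The zeros of [q] in [N]
     form a closed normal subgroup, thus [q] vanishes on [N], and [h] minus the combination of the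
     [k i] descends to the quotient. *)
  pose q u := h u - \sum_i a i * k i u - h 1%g.
  have ql : locally_constant q.
    apply: (@locally_constant_op2 p F _ (fun=> h 1%g) (fun s t => s - t)).
      exact: comb_l.
    exact: locally_constant_cst.
  have E5 (t t' s s' w : 'F_p) : t + t' - w - (s + s') - w = (t - s - w) + (t' - s' - w).
    by rewrite opprD [RHS]addrACA [X in _ = X + _]addrACA [RHS]addrA [X in X - _ = _]addrAC.
  have qr u n : cn_set N n -> q (u * n)%g = q u + q n.
    move=> Nn; rewrite /q (hr _ _ Nn) -E5 -big_split /=.
    by congr (_ - _ - _); apply: eq_bigr => i _; rewrite (kr _ _ Nn) mulrDr.
  have qL u n : cn_set N n -> q (n * u)%g = q n + q u.
    move=> Nn; rewrite /q (hL _ _ Nn) -E5 -big_split /=.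
    by congr (_ - _ - _); apply: eq_bigr => i _; rewrite (kL _ _ Nn) mulrDr.
  have q1 : q 1%g = 0.
    by rewrite /q big1 ?subr0 ?subrr// => i _; rewrite k1 mulr0.
  have qN n : cn_set N n -> q n = 0.
    have Msub : closed_subgroup [set n | cn_set N n /\ q n = 0]%classic.
      split=> [||u v [Nu qu] [Nv qv]]; [|by split=> //; exact: cn_1|].
        rewrite (_ : [set n | _] = cn_set N `&` q @^-1` [set 0])%classic//.
        apply: closedI; first by case: (cn_subgroup N).
        exact: locally_constant_closed.
      have NV : cn_set N (v^-1)%g := cn_V Nv; split; first exact: cn_M.
      rewrite (qr _ _ NV) qu add0r; apply: (@addrI _ (q v)).
      by rewrite -(qr _ _ NV) mulgV q1 qv addr0.
    have Mconj : conj_invariant [set n | cn_set N n /\ q n = 0]%classic.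
      move=> u v [Nu qu]; split; first exact: cn_J.
      apply: (@addrI _ (q v)); rewrite -(qr _ _ (cn_J v Nu)) -conjgC (qL _ _ Nu).
      by rewrite qu add0r addr0.
    move=> Nn; have : closed_normal_closure (range rho) `<=` (ClosedNormal Msub Mconj : set F).
      apply: closed_normal_closure_min => _ [j _ <-]; split.
        by apply: sub_closed_normal_closure; exists j.
      by rewrite /q sumk ffunE opprB [h _ + _]addrC subrK subrr.
    by move=> /(_ _ Nn)[].
  pose w u := h u - \sum_i a i * k i u.
  have wE u : w (qrepr (qpi N u)) = w u.
    apply: (qrepr_invariant (h := w)) => v n Nn; apply: (@addIr _ (- h 1%g)).
    by rewrite -![LHS]/(q _) (qr _ _ Nn) (qN _ Nn) addr0.
  exists (fun c => w (qrepr c)).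
    apply: locally_constant_quot; rewrite (_ : _ \o _ = w); first exact: comb_l.
    by apply/funext => u; exact: wE.
  apply/funext => -[c d]; have [[u ->] [v ->]] := (qpi_surj c, qpi_surj d).
  by rewrite -qpiM !wE hE' bsum -del_lin.
(* For uniqueness, the [f] below is a homomorphism to 'F_p, so it vanishes on the Frattini subgroup;
   its values at 1 and at [rho j] determine [a' j]. *)
move=> a' [kk kkl kkE].
have kkE' u v : del h (u, v) - \sum_i a' i * del (k i) (u, v) = del (kk \o qpi N) (u, v).
  have := congr1 (fun k => k (qpi N u, qpi N v)) kkE.
  by rewrite /= hE' bsum => ->; rewrite /del /= qpiM.
have E6 (t t' s s' w w' : 'F_p) : t' - w + t = s' - w' + s -> w - w' = (t - s) + (t' - s').
  by move=> E; rewrite {1}(E3 t t' w) {1}(E3 s s' w') E opprB addrA subrK opprD addrACA.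
pose f u := h u - \sum_i a' i * k i u - kk (qpi N u).
have fl : locally_constant f.
  apply: (@locally_constant_op2 p F _ _ (fun s t => s - t)); first exact: comb_l.
  by apply: locally_constant_comp kkl; exact: qpi_continuous.
have fM u v : f (u * v)%g = f u + f v.
  by apply: E6; have := kkE' u v; rewrite -del_lin.
have fPhi := locally_constant_morph_Frattini p_prime fl fM.
apply/ffunP => j; rewrite ffunE.
have f1 := fPhi _ (cn_1 _); have fj := fPhi _ (rhoP j).
have Nj : cn_set N (rho j) by apply: sub_closed_normal_closure; exists j.
move: f1 fj; rewrite /f sumk.
rewrite ((qpi_eq1 _ _).2 Nj) ((qpi_eq1 _ _).2 (cn_1 _)).
rewrite big1 => [|i _]; last by rewrite k1 mulr0.
rewrite subr0 => /eqP; rewrite subr_eq0 => /eqP <- /eqP.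
by rewrite subr_eq0 => /eqP <-; rewrite opprB addrC subrK.
Qed.

End Presented.

End Presentations.

(** * The matrix of relator exponents *)

Section ReductionModP.
Variables (p m : nat).
Hypotheses (p_prime : prime p) (m_gt0 : (0 < m)%N).
Local Notation Z := 'Z_(p ^ m).
Local Open Scope ring_scope.

(** ['Z_1] has two elements, so the levels have to start at [m = 1]. *)
Lemma pX_gt1 : (1 < p ^ m)%N.
Proof. by rewrite -(expn0 p) ltn_exp2l// prime_gt1. Qed.

Definition modp (a : Z) : 'F_p := (a : nat)%:R.

Lemma modp_natr k : modp k%:R = k%:R.
Proof.
rewrite /modp (val_Zp_nat pX_gt1) [in RHS](divn_eq k (p ^ m)) natrD natrM.
by rewrite natrX pchar_Fp_0// expr0n -[(m == 0)%N]negbK -lt0n m_gt0 mulr0 add0r.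
Qed.

Lemma modpD : {morph modp : a b / a + b}.
Proof.
by move=> a b; rewrite -(natr_Zp a) -(natr_Zp b) -natrD !modp_natr natrD.
Qed.

Lemma modp0 : modp 0 = 0. Proof. exact: (modp_natr 0). Qed.

Lemma modpN : {morph modp : a / - a}.
Proof. by move=> a; apply: (@addrI _ (modp a)); rewrite -modpD !subrr modp0. Qed.

Lemma modp_unit a : modp a != 0 -> a \is a GRing.unit.
Proof.
move=> a0; rewrite -(natr_Zp a) (unitZpE _ pX_gt1) coprimeXl// prime_coprime//.
by apply: contra a0 => /dvdnP[k E]; rewrite /modp E natrM pchar_Fp_0// mulr0.
Qed.

Section RowSpace.
Variables (g : nat) (A : 'M[Z]_g).
Hypothesis detA : \det A != 0.

(** Multiplying by the adjugate shows that [\det A] kills each coordinate of [v]; as it is nonzero,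
    no coordinate is a unit. *)
Lemma modp_left_kernel (v : 'rV[Z]_g) i : v *m A = 0 -> modp (v 0 i) = 0.
Proof.
move=> vA; apply/eqP; apply: contraNT detA => /modp_unit vi.
have : v *m (A *m \adj A) = 0 by rewrite mulmxA vA mul0mx.
rewrite mul_mx_adj mul_mx_scalar => /rowP/(_ i); rewrite !mxE => /eqP.
by rewrite mulrC mulrI_eq0 //; exact: mulrI.
Qed.

(** Coefficients with respect to the rows of [A] are unique only modulo [p], by [modp_left_kernel].
    Outside the row space the value is the default 0. *)
Definition row_coef (i : 'I_g) (w : 'rV[Z]_g) : 'F_p :=
  modp (odflt 0 [pick c : 'rV[Z]_g | c *m A == w] 0 i).

Lemma row_coefE i (c : 'rV[Z]_g) : row_coef i (c *m A) = modp (c 0 i).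
Proof.
rewrite /row_coef; case: pickP => [d /eqP dA|/(_ c)]; last by rewrite eqxx.
apply/eqP; rewrite -subr_eq0 -modpN -modpD; apply/eqP.
have := @modp_left_kernel (d - c) i; rewrite !mxE; apply.
by rewrite mulmxBl dA subrr.
Qed.

(** The choice is made from a predicate that depends only on the coset of [v], which gives
    [row_rep_eq]. *)
Definition row_rep (v : 'rV[Z]_g) : 'rV[Z]_g :=
  odflt 0 [pick w | [exists c : 'rV[Z]_g, v - w == c *m A]].

Lemma row_repP v : exists c, v - row_rep v = c *m A.
Proof.
rewrite /row_rep; case: pickP => [w /existsP[c /eqP wE]|/(_ v)]; first by exists c.
by move=> /existsP[]; exists 0; rewrite subrr mul0mx.
Qed.

Lemma row_rep_eq v c : row_rep (v + c *m A) = row_rep v.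
Proof.
rewrite /row_rep; congr odflt; apply: eq_pick => w.
apply/existsP/existsP => -[d /eqP dE].
  by exists (d - c); rewrite mulmxBl -dE addrAC addrK.
by exists (d + c); rewrite mulmxDl -dE addrAC.
Qed.

(* A coordinate modulo [p] with respect to the rows of [A], extended from the row
   space to all vectors through a choice of coset representatives. *)
Definition row_coord (i : 'I_g) (v : 'rV[Z]_g) : 'F_p :=
  row_coef i (v - row_rep v) - row_coef i (- row_rep 0).

Lemma row_coordD i v c : row_coord i (v + c *m A) = row_coord i v + modp (c 0 i).
Proof.
have [d dE] := row_repP v.
rewrite /row_coord row_rep_eq addrAC dE -mulmxDl !row_coefE mxE modpD.
by rewrite addrAC.
Qed.

Lemma row_coord0 i : row_coord i 0 = 0.
Proof. by rewrite /row_coord sub0r subrr. Qed.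

Lemma row_coordE i c : row_coord i (c *m A) = modp (c 0 i).
Proof. by rewrite -[c *m A]add0r row_coordD row_coord0 add0r. Qed.

End RowSpace.
End ReductionModP.

(** * Abelianizations and powers in commutative pro-p groups *)

Section Abelianization.
Variable p : nat.
Hypothesis p_prime : prime p.
Local Open Scope group_scope.

Lemma quot_derived_commute (G : topGroupType) (a b : quot (derived G)) : a * b = b * a.
Proof.
have [[u ->] [v ->]] := (qpi_surj a, qpi_surj b).
rewrite -!qpiM; apply/qpi_eq; rewrite invgM -mulgA.
have -> : (v^-1 * (u^-1 * (v * u))) = [~ v, u] by rewrite commgEl /conjg.
by apply: sub_closed_gen; exists v => //; exists u.
Qed.

Lemma derived_morph (G H : topGroupType) (f : G -> H) (x : G) : continuous f ->
  {morph f : x y / x * y} -> cn_set (derived G) x -> cn_set (derived H) (f x).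
Proof.
move=> fc fM; apply: (closed_gen_min (B := cn_preimage fc fM (derived H))).
  exact: cn_subgroup.
move=> _ [a _ [b _ <-]]; rewrite /= (morph_gR fM); apply: sub_closed_gen.
by exists (f a) => //; exists (f b).
Qed.

Lemma derived_exponent_iso (G H : topGroupType) n : isomorphic G H ->
  (forall a : quot (derived H), a ^+ n = 1) -> forall a : quot (derived G), a ^+ n = 1.
Proof.
move=> [f [fM fc [h [fK hK hc]]]] Hn a; have [u ->] := qpi_surj a.
have hM : {morph h : x y / x * y} by move=> x y; apply: (can_inj fK); rewrite fM !hK.
rewrite -(morph_gX (@qpiM _ _)); apply/qpi_eq1.
rewrite -[u]fK -(morph_gX hM); apply: (derived_morph hc hM).
by apply/qpi_eq1; rewrite (morph_gX (@qpiM _ (derived H))).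
Qed.

Lemma pro_p_uniform_exponent (G : topGroupType) (N : closedNormal G) : pro_p p G ->
  open (N : set G) -> exists n, forall x, cn_set N (x ^+ (p ^ n)).
Proof.
move=> Gp oN; have [n cG] := Gp.2 N oN; exists n => x; apply/qpi_eq1.
have finG := open_normal_finite (pro_p_compact Gp) oN.
rewrite (morph_gX (@qpiM _ N)) -((card_fin_of finG _).1 cG) -cardsT.
exact: (@expg_cardG (fin_of finG) [set: fin_of finG]%G (qpi N x : fin_of finG)
  (finset.in_setT _)).
Qed.

(** By iteration [y ^+ (p ^ k)] is a [p ^ (k + n)]-th power for all [n], hence lies in every open
    normal subgroup. *)
Lemma pro_p_divisible_eq1 (G : topGroupType) k : pro_p p G ->
  (forall y : G, exists z, y ^+ (p ^ k) = z ^+ (p ^ k.+1)) -> forall y : G, y ^+ (p ^ k) = 1.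
Proof.
move=> Gp Gk y.
have yn n : exists z, y ^+ (p ^ k) = z ^+ (p ^ (k + n)).
  elim: n => [|n [z ->]]; first by exists y; rewrite addn0.
  have [t zt] := Gk z; exists t.
  by rewrite expnD expgnA zt -expgnA -expnD addSnnS.
apply: contrapT => y1.
have [U oU UC] := open_normal_sep p_prime Gp (closed_set1 (x := 1) (pro_p_hausdorff Gp)) y1.
have [n Un] := pro_p_uniform_exponent Gp oU.
have [z yz] := yn n; apply: (UC (y ^+ (p ^ k))^-1); last by rewrite /= mulgV.
by apply: cn_V; rewrite yz addnC expnD expgnA; exact: cn_X.
Qed.

Section Commutative.
Variable G : topGroupType.
Hypotheses (Gp : pro_p p G) (GC : forall a b : G, a * b = b * a).

Lemma expgMn_comm n : {morph (fun a : G => a ^+ n) : a b / a * b}.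
Proof. by move=> a b; apply: expgMn; exact: GC. Qed.

Lemma expg_continuous n : continuous (fun a : G => a ^+ n).
Proof.
elim: n => [|n IH]; first by under eq_fun do rewrite expg0; move=> a; exact: cvg_cst.
under eq_fun do rewrite expgS; move=> a.
apply: (@continuous_comp _ _ _ (fun a : G => (a, a ^+ n)) (fun ab : G * G => ab.1 * ab.2)).
  by apply: cvg_pair; [exact: cvg_id|exact: IH].
exact: mulg_continuous.
Qed.

Lemma powers_subproof n :
  closed_subgroup (range (fun a : G => a ^+ n)) /\ conj_invariant (range (fun a : G => a ^+ n)).
Proof.
split=> [|_ y [x _ <-]]; last by exists (x ^ y) => //; rewrite conjXg.
apply: (closed_subgroup_image (@expg_continuous n) (@expgMn_comm n)).
- exact: pro_p_compact Gp.
- exact: pro_p_hausdorff Gp.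
- exact: closed_subgroupT.
Qed.

Definition powers n : closedNormal G :=
  ClosedNormal (powers_subproof n).1 (powers_subproof n).2.

Lemma powersE n a : cn_set (powers n) (a ^+ n).
Proof. by exists a. Qed.

End Commutative.

Lemma prodgM_comm (G : groupType) (GC : forall a b : G, a * b = b * a) (I : Type)
    (r : seq I) (a b : I -> G) :
  \prod_(i <- r) (a i * b i) = (\prod_(i <- r) a i) * (\prod_(i <- r) b i).
Proof.
elim: r => [|i r IH]; first by rewrite !big_nil mulg1.
by rewrite !big_cons IH -!mulgA; congr (_ * _); rewrite !mulgA (GC (b i)).
Qed.

Lemma prodg_delta (G : groupType) (I : eqType) (r : seq I) (i : I) (a : G) : uniq r ->
  \prod_(j <- r) (if j == i then a else 1) = if i \in r then a else 1.
Proof.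
elim: r => [|j r IH] /=; first by rewrite big_nil.
move=> /andP[jr /IH rE]; rewrite big_cons rE inE eq_sym.
by case: eqP => [->|_]; rewrite ?(negbTE jr) ?mulg1 ?mul1g.
Qed.

End Abelianization.

Section Presentation.
Variable p : nat.
Hypotheses (p_prime : prime p) (p_odd : odd p).
Variables (g : nat) (F : topGroupType) (x : 'I_g -> F).
Hypothesis F_free : free_pro_p p x.
Local Open Scope ring_scope.

Lemma disc_row_pro_p m : (0 < m)%N -> pro_p p (disc 'rV['Z_(p ^ m)]_g).
Proof.
move=> m_gt0; apply: disc_pro_p => //.
by rewrite card_mx card_ord (Zp_cast (pX_gt1 p_prime m_gt0)) -expnM pnatX pnat_id.
Qed.

(* [level m u] is the vector of the exponents of [u] modulo [p ^ m] in the
   abelianization of the free group. *)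
Definition level m (u : F) : 'rV['Z_(p ^ m)]_g :=
  if pselect (0 < m)%N is left m_gt0 then
    ofdisc (projT1 (cid (free_lift F_free (fun i => todisc (delta_mx 0 i))
      (disc_row_pro_p m_gt0))) u)
  else 0.

Section Level.
Variable m : nat.
Hypothesis m_gt0 : (0 < m)%N.

Lemma level_spec : [/\ continuous (fun u => todisc (level m u)),
  {morph (fun u => todisc (level m u)) : u v / (u * v)%g} &
  forall i, level m (x i) = delta_mx 0 i].
Proof.
rewrite /level; case: pselect => // m0; case: cid => f [fc fM fx] /=.
rewrite (_ : (fun u => todisc (ofdisc (f u))) = f); last by apply/funext => u; rewrite ofdiscK.
by split=> // i; rewrite fx todiscK.
Qed.

Lemma levelM u v : level m (u * v)%g = level m u + level m v.
Proof.
have [_ lM _] := level_spec; have := lM u v => /(congr1 (@ofdisc _)).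
by rewrite ofdiscM !todiscK.
Qed.

Lemma level1 : level m 1%g = 0.
Proof. by apply: (@addrI _ (level m 1%g)); rewrite -levelM mulg1 addr0. Qed.

Lemma levelV u : level m (u^-1)%g = - level m u.
Proof. by apply: (@addrI _ (level m u)); rewrite -levelM mulgV level1 subrr. Qed.

Lemma level_comm u v : level m [~ u, v]%g = 0.
Proof. by rewrite commgEl /conjg !levelM !levelV [level m u + _]addrC addKr addNr. Qed.

Lemma levelX u n : level m (u ^+ n)%g = level m u *+ n.
Proof. by elim: n => [|n IH]; rewrite ?level1// expgS levelM IH mulrS. Qed.

Lemma level_continuous : continuous (fun u => todisc (level m u)).
Proof. by case: level_spec. Qed.

Lemma level_x i : level m (x i) = delta_mx 0 i. Proof. by case: level_spec. Qed.

Lemma open_level (A : set 'rV['Z_(p ^ m)]_g) : open (level m @^-1` A).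
Proof.
rewrite (_ : level m @^-1` A = (fun u => todisc (level m u)) @^-1` (@ofdisc _ @^-1` A)).
  by have /continuousP := level_continuous; apply; exact: disc_open.
by apply/seteqP; split=> u /=; rewrite todiscK.
Qed.

Lemma closed_level (A : set 'rV['Z_(p ^ m)]_g) : closed (level m @^-1` A).
Proof. by rewrite -openC preimage_setC; exact: open_level. Qed.

End Level.

Variable rho : 'I_g -> F.
Hypothesis rhoP : forall i, cn_set (lower_pcentral F p 1) (rho i).
Local Notation N := (closed_normal_closure (range rho)).
Local Notation G := (quot N : topGroupType).

Definition level_mx m : 'M['Z_(p ^ m)]_g := \matrix_i level m (rho i).

Section Row.
Variable m : nat.
Hypothesis m_gt0 : (0 < m)%N.

Lemma relators_level u : cn_set N u -> exists c, level m u = c *m level_mx m.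
Proof.
pose S := level m @^-1` [set v | exists c, v = c *m level_mx m]%classic.
have Ssub : closed_subgroup S.
  split; first exact: closed_level.
    by exists 0; rewrite level1// mul0mx.
  move=> a b [c cE] [d dE]; exists (c - d); rewrite levelM// levelV// cE dE.
  by rewrite mulmxBl.
have Sconj : conj_invariant S.
  move=> a b [c cE]; exists c; rewrite /conjg !levelM// levelV// cE.
  by rewrite addrCA addNr addr0.
have := closed_normal_closure_min (N := ClosedNormal Ssub Sconj) (A := range rho).
move=> H /H; apply => _ [i _ <-]; exists (delta_mx 0 i).
by rewrite -rowE rowK.
Qed.

(** An exponent [n] of the abelianization puts [n] times each basis vector in the row space. Taking
    determinants, [n ^ g] is a multiple of [\det (level_mx m)], and it is nonzero modulo [p ^ m] by
    the size condition. *)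
Lemma det_of_exponent n : (p ^ m > n ^ g)%N -> (0 < n)%N ->
  (forall a : quot (derived G), a ^+ n = 1)%g -> \det (level_mx m) != 0.
Proof.
move=> n_lt n_gt0 Gn.
pose C : set G := [set a | exists c, level m (qrepr a) = c *m level_mx m].
have CE u : C (qpi N u) <-> exists c, level m u = c *m level_mx m.
  have /qpi_eq Nu : qpi N u = qpi N (qrepr (qpi N u)) by rewrite qreprK.
  have [d dE] := relators_level Nu.
  have lE : level m (qrepr (qpi N u)) = level m u + d *m level_mx m.
    by rewrite -dE -levelM// mulKVg.
  rewrite /C /= lE; split=> -[c cE]; last by exists (c + d); rewrite cE mulmxDl.
  by exists (c - d); rewrite mulmxBl -cE addrK.
have Csub : closed_subgroup C.
  split.
  - apply/closed_qpi.
    rewrite (_ : _ @^-1` C = level m @^-1` [set v | exists c, v = c *m level_mx m])%classic.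
      exact: closed_level.
    by apply/seteqP; split=> u /CE.
  - by rewrite -(morph_g1 (@qpiM _ N)); apply/CE; exists 0; rewrite level1// mul0mx.
  - move=> a b; have [[u ->] [v ->]] := (qpi_surj a, qpi_surj b).
    move=> /CE[c cE] /CE[d dE]; rewrite -(morph_gV (@qpiM _ N)) -qpiM; apply/CE.
    by exists (c - d); rewrite levelM// levelV// cE dE mulmxBl.
have dC a : cn_set (derived G) a -> C a.
  apply: closed_gen_min => // _ [b _ [c _ <-]].
  have [[u ->] [v ->]] := (qpi_surj b, qpi_surj c).
  rewrite -(morph_gR (@qpiM _ N)); apply/CE; exists 0.
  by rewrite level_comm// mul0mx.
have xC i : exists c : 'rV_g, n%:R *: (delta_mx 0 i : 'rV['Z_(p ^ m)]_g) = c *m level_mx m.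
  rewrite scaler_nat -(level_x m_gt0) -levelX//; apply/CE; apply: dC.
  by apply/qpi_eq1; rewrite (morph_gX (@qpiM _ N)) (morph_gX (@qpiM _ _)).
have [B BE] : exists B, n%:R%:M = B *m level_mx m.
  exists (\matrix_i projT1 (cid (xC i))); apply/row_matrixP => i.
  rewrite row_mul rowK; case: cid => c /= <-.
  by rewrite rowE mul_mx_scalar.
apply/eqP => det0; have := congr1 determinant BE.
rewrite det_scalar det_mulmx det0 mulr0 -natrX => /(congr1 (@nat_of_ord _)).
rewrite (val_Zp_nat (pX_gt1 p_prime m_gt0)) modn_small// => /eqP.
by rewrite expn_eq0 -[n == 0%N]negbK -lt0n n_gt0.
Qed.

Hypothesis detR : \det (level_mx m) != 0.

(* By Cramer's rule, the [d]-th powers of the generators of the abelianization are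
   [p ^ m]-th powers, where [d] represents the determinant. If [p ^ k] is the
   [p]-part of [d] then [k < m], so all [p ^ k]-th powers are [p ^ k.+1]-th powers,
   and hence trivial in a pro-p group. *)
Lemma finite_abelianization : finite_set [set: quot (derived G)].
Proof.
set K := quot (derived G) : topGroupType.
pose q u : K := qpi (derived G) (qpi N u).
have Gp := quot_pro_p p_prime N F_free.1.
have Kp : pro_p p K := quot_pro_p p_prime _ Gp.
have KC : forall a b : K, (a * b = b * a)%g := @quot_derived_commute G.
have qM : {morph q : u v / (u * v)%g} by move=> u v; rewrite /q !qpiM.
have qc : continuous q.
  move=> u; apply: (@continuous_comp _ _ _ (qpi N) (qpi (derived G)));
  exact: qpi_continuous.
have qT : range q = setT.
  apply/seteqP; split=> // a _; have [b ->] := qpi_surj a; have [u ->] := qpi_surj b.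
  by exists u.
have qgen : top_generates (q @` range x).
  exact: top_generates_image qc qM qT (free_gen p_prime F_free).
pose B := quot (powers Kp KC (p ^ m)) : topGroupType.
have Bp : pro_p p B := quot_pro_p p_prime _ Kp.
have BC (a b : B) : (a * b = b * a)%g.
  have [[u ->] [v ->]] := (qpi_surj a, qpi_surj b).
  by rewrite -!qpiM KC.
have BX (a : B) : (a ^+ (p ^ m) = 1)%g.
  have [u ->] := qpi_surj a; rewrite -(morph_gX (@qpiM _ _)).
  by apply/qpi_eq1; exact: powersE.
pose qB : K -> B := qpi _; pose y i := qB (q (x i)).
(* In [B] all [p ^ m]-th powers are trivial, so exponents modulo [p ^ m] make sense there. By
   [thetaE], the image in [B] of an element of the free group depends only on its [level]. *)
pose theta (v : 'rV['Z_(p ^ m)]_g) : B := (\prod_(i <- enum 'I_g) y i ^+ (v 0%R i : nat))%g.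
have thetaM v w : theta (v + w) = (theta v * theta w)%g.
  rewrite /theta -(prodgM_comm BC); apply: eq_bigr => i _; rewrite mxE -expgnDr /=.
  move: (_ + _)%N => n; rewrite (Zp_cast (pX_gt1 p_prime m_gt0)).
  by rewrite {2}(divn_eq n (p ^ m)) expgnDr mulnC expgnA BX expg1n mul1g.
have theta0 : theta 0 = 1%g.
  by apply: (@mulgI _ (theta 0)); rewrite -thetaM addr0 mulg1.
have thetaX v n : theta (v *+ n) = (theta v ^+ n)%g.
  by elim: n => [|n IH]; rewrite ?theta0// mulrS thetaM IH expgS.
have theta_e i : theta (delta_mx 0 i) = y i.
  rewrite /theta (eq_bigr (fun j => if j == i then y i else 1%g)) => [|j _].
    by rewrite prodg_delta ?enum_uniq// mem_enum.
  by rewrite !mxE /=; case: eqP => // ->; rewrite /= modn_small ?expg1.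
have thetaE u : qB (q u) = theta (level m u).
  have lc := level_continuous m_gt0.
  suff /(congr1 (fun f => f u)) : qB \o q = theta \o level m by [].
  apply: (free_hom_eq p_prime F_free (pro_p_hausdorff Bp)).
  - move=> v; apply: (@continuous_comp _ _ _ q qB); first exact: qc.
    exact: qpi_continuous.
  - rewrite (_ : _ \o _ = (theta \o @ofdisc _) \o (fun v => todisc (level m v))).
      by move=> v; apply: continuous_comp; [exact: lc|exact: disc_continuous].
    by apply/funext => v /=; rewrite todiscK.
  - by move=> v w /=; rewrite qM /qB qpiM.
  - by move=> v w /=; rewrite levelM// thetaM.
  - by move=> i /=; rewrite level_x// theta_e.
have theta_row c : theta (c *m level_mx m) = 1%g.
  rewrite mulmx_sum_row; apply: (big_ind (fun v => theta v = 1%g)) => //.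
    by move=> v w vE wE; rewrite thetaM vE wE mulg1.
  move=> i _; rewrite rowK -(natr_Zp (c 0 i)) scaler_nat thetaX -thetaE /q.
  have /qpi_eq1 -> : cn_set N (rho i) by apply: sub_closed_normal_closure; exists i.
  by rewrite (morph_g1 (@qpiM _ _)) /qB (morph_g1 (@qpiM _ _)) expg1n.
pose d : nat := \det (level_mx m).
have yd i : (y i ^+ d = 1)%g.
  rewrite -theta_e -thetaX -scaler_nat natr_Zp -mul_mx_scalar -mul_adj_mx mulmxA.
  exact: theta_row.
have d_gt0 : (0 < d)%N by rewrite lt0n; apply: contra detR => /eqP d0; apply/eqP/val_inj.
have d_lt : (d < p ^ m)%N.
  by rewrite -[X in (_ < X)%N](Zp_cast (pX_gt1 p_prime m_gt0)); exact: ltn_ord.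
have [d' pd' dE] := pfactor_coprime p_prime d_gt0; set k := logn p d in dE.
have k_lt : (k < m)%N.
  rewrite -(ltn_exp2l _ _ (prime_gt1 p_prime)); apply: leq_ltn_trans d_lt.
  by rewrite dE leq_pmull// lt0n; apply: contraTneq d_gt0 => d0; rewrite dE d0.
have xd i : cn_set (powers Kp KC (p ^ m)) (q (x i) ^+ d)%g.
  by apply/qpi_eq1; rewrite (morph_gX (@qpiM _ (powers Kp KC (p ^ m)))); exact: yd.
have Kd (a : K) : exists z, (a ^+ d = z ^+ (p ^ m))%g.
  have : cn_set (cn_preimage (expg_continuous (n := d)) (expgMn_comm KC d) (powers Kp KC (p ^ m))) a.
    suff : closed_gen (q @` range x) a by apply: closed_gen_min; [exact: cn_subgroup|
      move=> _ [_ [i _ <-] <-]; exact: xd].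
    by rewrite qgen.
  by move=> [z _ <-]; exists z.
(* Bezout for [d'] and [p] gives [d * s = t * p ^ k.+1 + p ^ k]; since [a ^+ d] is a [p ^ m]-th
   power with [k < m], this writes [a ^+ (p ^ k)] as a quotient of two [p ^ k.+1]-th powers. *)
have Kk (a : K) : exists z, (a ^+ (p ^ k) = z ^+ (p ^ k.+1))%g.
  have d'_gt0 : (0 < d')%N by rewrite lt0n; apply: contraTneq d_gt0 => d0; rewrite dE d0.
  have [z zE] := Kd a; case: (egcdnP p d'_gt0) => s t stE _.
  rewrite gcdnC (eqP pd') in stE.
  exists (z ^+ (p ^ (m - k.+1) * s) * (a ^+ t)^-1)%g.
  rewrite (expgMn_comm KC) expgVn -!expgnA.
  have -> : (z ^+ (p ^ (m - k.+1) * s * p ^ k.+1) = a ^+ (d * s))%g.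
    by rewrite [RHS]expgnA zE -[RHS]expgnA mulnAC -expnD subnK.
  have -> : (d * s = t * p ^ k.+1 + p ^ k)%N.
    by rewrite dE mulnAC [(d' * s)%N]mulnC stE mulnDl mul1n expnS mulnA.
  by rewrite expgnDr [X in (X * _)%g]KC mulgK.
have qfin : finite_set (q @` range x) by exact/finite_image/finite_image/finite_finset.
(* The central subgroup is P_0(K), all of [K], with exponent [p ^ k]; the quotient is trivial. *)
apply: (finite_central_extension (N := lower_pcentral K p 0) (p := p ^ k) _ _ _
  (pro_p_hausdorff Kp) qfin qgen).
- by rewrite expn_gt0 prime_gt0.
- by move=> a b _; exact: KC.
- by move=> a _; exact: (pro_p_divisible_eq1 p_prime Kp Kk).
- by apply: (Q_finite p_prime Kp _ 0); exists (q @` range x).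
Qed.

(** The row coordinates of the exponent vector are the functions dual to the relators that
    [presented_r_eq] asks for. *)
Lemma presented_r_eq_det : r_eq p G g.
Proof.
pose k i u : 'F_p := row_coord (level_mx m) i (level m u).
have kE i u n : cn_set N n -> exists2 c, level m n = c *m level_mx m &
    k i (u * n)%g = k i u + modp (c 0 i) /\ k i n = modp (c 0 i).
  move=> /relators_level[c cE]; exists c => //.
  by rewrite /k levelM// cE row_coordD// row_coordE.
apply: (@presented_r_eq p p_prime g F x F_free rho rhoP k).
- move=> i a; exact: (open_level m_gt0 [set v | row_coord (level_mx m) i v = a]%classic).
- by move=> i u n /(kE i u)[c _ [-> ->]].
- move=> i u n /(kE i u)[c _ [kun ->]].
  have -> : k i (n * u)%g = k i (u * n)%g.
    by rewrite /k (levelM m_gt0 n) (levelM m_gt0 u) [level m n + _]addrC.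
  by rewrite kun; exact: addrC.
- move=> i j; have Nj : cn_set N (rho j) by apply: sub_closed_normal_closure; exists j.
  rewrite /k (_ : level m (rho j) = delta_mx 0 j *m level_mx m); last by rewrite -rowE rowK.
  by rewrite row_coordE// mxE eqxx /= -(modp_natr p_prime m_gt0).
Qed.

End Row.

Lemma presented_pro_p : pro_p p G. Proof. exact: quot_pro_p F_free.1. Qed.

Lemma presented_fg : finitely_generated G.
Proof.
exists (qpi N @` range x); first exact/finite_image/finite_image/finite_finset.
apply: top_generates_image (free_gen p_prime F_free);
  [exact: qpi_continuous|exact: qpiM|exact: qpi_range].
Qed.

Variable s : F -> F.
Hypotheses (sM : {morph s : u v / (u * v)%g}) (sc : continuous s).
Hypotheses (sx : forall i, s (x i) = (x i)^-1%g) (s_rho : forall i, s (rho i) = (rho i)^-1%g).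

Lemma relators_invariant u : cn_set N u -> cn_set N (s u).
Proof.
apply: (closed_normal_closure_min (N := cn_preimage sc sM N)) => _ [i _ <-].
rewrite /cn_preimage /= s_rho; apply: (cn_V (N := N)).
by apply: sub_closed_normal_closure; exists i.
Qed.

Lemma presented_GI : exists2 t : G -> G, GI_automorphism t & t \o qpi N = qpi N \o s.
Proof.
apply: (@GI_quotient p F G (qpi N) s F_free.1 (free_GI p_prime F_free sM sc sx)).
- exact: qpi_continuous.
- exact: qpiM.
- exact: qpi_range.
- by move=> f; exact: qpi_factor_continuous.
- by move=> u /qpi_eq1 Nu; apply/qpi_eq1; exact: relators_invariant.
Qed.

Lemma presented_schur m : (0 < m)%N -> \det (level_mx m) != 0 -> schur_sigma p G.
Proof.
move=> m_gt0 detR; split.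
- exact: presented_pro_p.
- exact: presented_fg.
- exact: (finite_abelianization m_gt0).
- exists g; split; last exact: presented_r_eq_det detR.
  exact: (presented_d_eq p_prime F_free rhoP).
- by have [t tGI _] := presented_GI; exists t.
Qed.

Lemma presented_det_neq0 (H : topGroupType) : isomorphic G H ->
  finite_set [set: quot (derived H)] -> exists2 m, (0 < m)%N & \det (level_mx m) != 0.
Proof.
move=> GH finD; pose n := #|{: fin_of finD}|.
have n_gt0 : (0 < n)%N by apply/card_gt0P; exists (1%g : fin_of finD).
exists (n ^ g).+1 => //; apply: (det_of_exponent _ _ n_gt0) => //.
  by apply: leq_trans (ltn_expl _ (prime_gt1 p_prime)); rewrite ltnW.
apply: (derived_exponent_iso GH) => a; rewrite /n -cardsT.
exact: (@expg_cardG (fin_of finD) [set: fin_of finD]%G (a : fin_of finD)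
  (finset.in_setT _)).
Qed.

End Presentation.

(** * Presented groups are almost surely Schur sigma-groups *)

Section DeterminantCount.
Variables (p : nat).
Hypothesis p_prime : prime p.
Local Open Scope ring_scope.

Lemma det_shift_poly (R : comNzRingType) g (B : 'M[R]_g) :
  exists P : {poly R}, [/\ P`_g = 1, (size P <= g.+1)%N & forall t, P.[t] = \det (B + t%:M)].
Proof.
exists (char_poly (- B)); split.
- by have /monicP := char_poly_monic (- B); rewrite /lead_coef size_char_poly.
- by rewrite size_char_poly.
- move=> t; rewrite -[LHS]/(horner_eval t _) /char_poly -det_map_mx; congr determinant.
  apply/matrixP => i j; rewrite /char_poly_mx !mxE /= /horner_eval.
  by rewrite hornerD hornerN hornerMn hornerX hornerC opprK addrC.
Qed.

(* With more than [g] roots, a Vandermonde determinant would be a nonzero natural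
   number less than [p ^ m] that vanishes modulo [p ^ m]. *)
Lemma sparse_roots m g n (P : {poly 'Z_(p ^ m)}) (s : seq nat) : (0 < m)%N ->
  ((p * n) ^ (g.+1 * g.+1) < p ^ m)%N ->
  P`_g = 1 -> (size P <= g.+1)%N -> sorted ltn s -> all (fun j => j < n)%N s ->
  {in s, forall j, P.[(p * j)%:R] = 0} -> (size s <= g)%N.
Proof.
move=> m_gt0 mn Pg Ps s_sorted s_lt sP; rewrite leqNgt; apply/negP => gs.
have sE i : (i < g.+1)%N -> nth 0%N s i \in s.
  by move=> ig; apply: mem_nth; exact: leq_trans ig gs.
pose a : 'rV['Z_(p ^ m)]_g.+1 := \row_i (p * nth 0%N s i)%:R.
pose c : 'rV['Z_(p ^ m)]_g.+1 := \row_i P`_i.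
have cV : c *m Vandermonde g.+1 a = 0.
  apply/rowP => j; rewrite !mxE -[RHS](sP (nth 0%N s j)); last exact: sE.
  rewrite (horner_coef_wide _ Ps); apply: eq_bigr => i _; rewrite !mxE.
  by [].
(* The last entry of this product is the Vandermonde determinant itself, as [P] has coefficient 1 in
   degree [g]. *)
have : c *m (Vandermonde g.+1 a *m \adj (Vandermonde g.+1 a)) = 0 by rewrite mulmxA cV mul0mx.
rewrite mul_mx_adj mul_mx_scalar => /rowP/(_ ord_max); rewrite !mxE Pg mulr1.
rewrite det_Vandermonde.
pose e (i j : nat) := (p * nth 0%N s j - p * nth 0%N s i)%N.
have lt_s (i j : 'I_g.+1) : (i < j)%N -> (nth 0%N s i < nth 0%N s j)%N.
  by move=> ij; apply: (sorted_ltn_nth ltn_trans) => //; rewrite inE; apply: leq_trans gs.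
have -> : \prod_(i < g.+1) \prod_(j < g.+1 | (i < j)%N) (a 0 j - a 0 i) =
    (\prod_(i < g.+1) \prod_(j < g.+1 | (i < j)%N) e i j)%N%:R.
  rewrite natr_prod; apply: eq_bigr => i _; rewrite natr_prod; apply: eq_bigr => j ij.
  by rewrite !mxE natrB// leq_mul2l ltnW ?orbT// lt_s.
move=> /(congr1 (@nat_of_ord _)); rewrite (val_Zp_nat (pX_gt1 p_prime m_gt0)) modn_small.
  move/eqP; apply/negP; rewrite -lt0n; apply: prodn_gt0 => i; apply: prodn_cond_gt0 => j ij.
  by rewrite /e subn_gt0 ltn_mul2l prime_gt0// lt_s.
apply: leq_ltn_trans mn.
(* Each difference is at most [p * n], and the pairs that do not occur in the Vandermonde product
   are padded with the factor [p * n]. *)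
have -> : ((p * n) ^ (g.+1 * g.+1) = \prod_(i < g.+1) \prod_(j < g.+1) (p * n))%N.
  by rewrite !prod_nat_const !card_ord expnM.
apply: leq_prod => i _; rewrite big_mkcond; apply: leq_prod => j _; case: ifP => ij.
  rewrite /e (leq_trans (leq_subr _ _))// leq_mul2l ltnW ?orbT//.
  by apply: (allP s_lt); apply: sE.
rewrite muln_gt0 prime_gt0//=.
have : (nth 0%N s 0 < n)%N by apply: (allP s_lt); exact: sE.
exact: leq_trans.
Qed.

Definition rows_in (T : finType) g (S : {set 'rV[T]_g}) : {set 'M[T]_g} :=
  [set B | [forall i, row i B \in S]].

(* The shifts of [B] by the scalar matrices [p * j], for [j < n], stay in the family,
   and at most [g] of them are singular since [\det (B + t%:M)] is monic of degree [g]
   in [t]. *)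
Lemma det0_count m g n (S : {set 'rV['Z_(p ^ m)]_g}) : (0 < m)%N ->
  ((p * n) ^ (g.+1 * g.+1) < p ^ m)%N ->
  (forall v i j, v \in S -> v - (p * j)%:R *: delta_mx 0 i \in S) ->
  (n * #|[set B in rows_in S | \det B == 0%R]%SET| <= g * #|rows_in S|)%N.
Proof.
move=> m_gt0 mn SB; set M := rows_in S; set Z := [set B in M | _]%SET.
pose t (j : nat) : 'Z_(p ^ m) := (p * j)%:R.
have ZM (j : 'I_n) : (#|Z| <= #|[set B in M | \det (B + (t j)%:M) == 0%R]%SET|)%N.
  rewrite -(card_imset (f := fun B => B - (t j)%:M)); last by move=> B C /addIr.
  apply/subset_leq_card/fintype.subsetP => _ /imsetP[B /[!inE] /andP[/forallP BS B0] ->].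
  rewrite subrK B0 andbT; apply/forallP => i; rewrite raddfB /=.
  by rewrite [row i _%:M]rowE mul_mx_scalar; apply: SB.
apply: (@leq_trans (\sum_(j < n) #|[set B in M | \det (B + (t j)%:M) == 0%R]%SET|)).
  by rewrite -[X in (X * _)%N]card_ord -sum_nat_const; apply: leq_sum => j _; exact: ZM.
(* Double counting of the pairs of a matrix and a shift that makes it singular. *)
have -> : (\sum_(j < n) #|[set B in M | \det (B + (t j)%:M) == 0%R]%SET| =
    \sum_(B in M) #|[set j : 'I_n | \det (B + (t j)%:M) == 0%R]%SET|)%N.
  have e1 (j : 'I_n) : (#|[set B in M | \det (B + (t j)%:M) == 0%R]%SET| =
      \sum_(B in M) (\det (B + (t j)%:M) == 0%R))%N.
    by rewrite -sum1dep_card big_mkcondr; apply: eq_bigr => B _; case: ifP.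
  have e2 (B : 'M['Z_(p ^ m)]_g) : (#|[set j : 'I_n | \det (B + (t j)%:M) == 0%R]%SET| =
      \sum_(j < n) (\det (B + (t j)%:M) == 0%R))%N.
    by rewrite -sum1dep_card big_mkcond; apply: eq_bigr => j _; case: ifP.
  by rewrite (eq_bigr _ (fun j _ => e1 j)) (eq_bigr _ (fun B _ => e2 B)) exchange_big.
rewrite mulnC -sum_nat_const; apply: leq_sum => B _.
have [P [Pg Ps PE]] := det_shift_poly B.
set J := [set j : 'I_n | _]%SET.
pose s := [seq val j | j <- enum J].
have -> : #|J| = size s by rewrite size_map cardE.
apply: (sparse_roots m_gt0 mn Pg Ps).
- rewrite /s sorted_map; apply: sorted_filter; first by move=> ? ? ?; exact: ltn_trans.
  by rewrite -enumT -sorted_map val_enum_ord iota_ltn_sorted.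
- by apply/allP => _ /mapP[j _ ->]; exact: ltn_ord.
- by move=> _ /mapP[j + ->]; rewrite mem_enum inE PE => /eqP.
Qed.

End DeterminantCount.

Section AlmostSurelySchur.
Variables (p : nat).
Hypotheses (p_prime : prime p) (p_odd : odd p).
Variables (g : nat) (F : topGroupType) (x : 'I_g -> F).
Hypothesis F_free : free_pro_p p x.
Variable s : {multiplicative F -> F}.
Hypotheses (sc : continuous s) (sx : forall i, s (x i) = (x i)^-1%g).
Variables (R : realType) (mu : probability (X p s) R).
Hypothesis mu_unif : uniform_on_levels mu.
Local Open Scope ring_scope.

Definition relators (r : g.-tuple (X p s)) (i : 'I_g) : F := \val (tnth r i).

(* These are the relators presenting a Schur sigma-group: see [presented_schur] and
   [presented_det_neq0]. *)
Definition nondegenerate : set (g.-tuple (X p s)) :=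
  [set r | exists2 m, (0 < m)%N & \det (level_mx p_prime F_free (relators r) m) != 0].

Local Notation lev := (level p_prime F_free).
Local Notation lmx r := (level_mx p_prime F_free (relators r)).

Let sM : {morph s : u v / (u * v)%g} := @gmulfM _ _ s.

Section Level.
Variable m : nat.
Hypothesis m_gt0 : (0 < m)%N.
Local Notation A := (disc 'rV['Z_(p ^ m)]_g).
Let f u : A := todisc (lev m u).
Let sA (a : A) : A := (a^-1)%g.

Let Ap : finite_pgroup p A.
Proof.
apply: disc_finite_pgroup => //.
by rewrite card_mx card_ord (Zp_cast (pX_gt1 p_prime m_gt0)) -expnM pnatX pnat_id.
Qed.
Let AC (a b : A) : (a * b = b * a)%g.
Proof. by apply: (can_inj (@ofdiscK _)); rewrite !ofdiscM; exact: addrC. Qed.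
Let sAM : {morph sA : a b / (a * b)%g}.
Proof. by move=> a b; rewrite /sA invgM AC. Qed.
Let fc : continuous f. Proof. exact: level_continuous. Qed.
Let fM : {morph f : u v / (u * v)%g}. Proof. by move=> u v; rewrite /f levelM// -todiscM. Qed.
Let fs : f \o s = sA \o f.
Proof.
apply: (free_hom_eq p_prime F_free).
- exact: pro_p_hausdorff (disc_row_pro_p p_prime g m_gt0).
- by move=> u; apply: continuous_comp; [exact: sc|exact: fc].
- move=> u; apply: (@continuous_comp _ _ _ f sA); [exact: fc|exact: disc_continuous].
- by move=> u v /=; rewrite sM fM.
- by move=> u v /=; rewrite fM sAM.
- by move=> i /=; rewrite sx (morph_gV fM).
Qed.

Let fT : range f = setT.
Proof.
apply/seteqP; split=> // a _; rewrite -[a]ofdiscK (row_sum_delta (ofdisc a)).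
apply: (big_ind (fun v => range f (todisc v))).
- by exists 1%g => //; rewrite /f level1.
- move=> v w [u _ uv] [u' _ uw]; exists (u * u')%g => //.
  by rewrite fM uv uw todiscM.
- move=> i _; rewrite -(natr_Zp (ofdisc a 0 i)) scaler_nat.
  exists (x i ^+ (ofdisc a 0 i : nat))%g => //.
  by rewrite /f levelX// level_x.
Qed.

Let A_lower n a : cn_set (lower_pcentral A p n) a -> exists w, ofdisc a = w *+ (p ^ n).
Proof.
elim: n a => [|n IH] a; first by move=> _; exists (ofdisc a); rewrite mulr1n.
pose B : set A := [set a : A | exists w : 'rV_g, ofdisc a = w *+ (p ^ n.+1)]%classic.
suff H : cn_set (lower_pcentral A p n.+1) `<=` B by exact: H.
apply: closed_gen_min => {a}.
  split; first by rewrite -openC; exact: disc_open.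
    by exists 0; rewrite (morph_g1 (@ofdiscM _)) mul0rn.
  move=> a b [v aE] [w bE]; exists (v - w).
  by rewrite ofdiscM (morph_gV (@ofdiscM _)) aE bE mulrnBl.
move=> _ [[a _ [b _ <-]]|[b /IH[w bE] <-]].
  exists 0; rewrite mul0rn (_ : [~ a, b] = 1)%g ?(morph_g1 (@ofdiscM _))//.
  by apply/eqP/commgP; exact: AC.
exists w; rewrite (morph_gX (@ofdiscM _)) FinRing.zmodXgE bE -mulrnA.
by rewrite expnSr.
Qed.

Let A_class : lower_pcentral A p m = [set 1%g]%classic :> set A.
Proof.
apply/seteqP; split=> [a /A_lower[w aE]|_ ->]; last exact: (cn_1 (lower_pcentral A p m)).
apply: (can_inj (@ofdiscK _)); rewrite aE (morph_g1 (@ofdiscM _)) -scaler_nat.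
suff -> : (p ^ m)%:R = 0 :> 'Z_(p ^ m) by rewrite scale0r.
by apply: val_inj; rewrite /= (val_Zp_nat (pX_gt1 p_prime m_gt0)) modnn.
Qed.


Let S : {set 'rV['Z_(p ^ m)]_g} := [set v | `[< X_level p sA 1 (todisc v) >]]%SET.
Local Notation M := (rows_in S).

Lemma measurable_level_mx B : measurable [set r : g.-tuple (X p s) | lmx r m = B].
Proof.
rewrite (_ : [set r | _] = tuple_box (fun i => [set r : X p s | lev m (\val r) = row i B])).
  apply: measurable_tuple_box => i.
  apply: (X_measurable_preimage (A := lev m @^-1` [set row i B]%classic)).
  exact: open_level.
apply/seteqP; split=> [r /= <- i|r rB]; first by rewrite rowK.
by apply/row_matrixP => i; rewrite rowK; exact: rB.
Qed.

(** By [tuple_X_law], applied to row vectors modulo [p ^ m] with inversion as automorphism, the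
    level matrix is uniform on the matrices with rows in [S]. *)
Lemma level_mx_det0 : tuple_prod mu g [set r | \det (lmx r m) = 0] =
  (#|[set B in M | \det B == 0]%SET|%:R / #|M|%:R : R)%:E.
Proof.
pose q : R := #|` fset_set (X_level p sA 1)|%:R ^- g.
have lmxM r : lmx r m \in M.
  rewrite inE; apply/forallP => i; rewrite rowK inE; apply/asboolP; split=> //.
  exact: (lower_pcentral_morph fc fM (proj1 (set_valP (tnth r i)))).
have law (Y : {set 'M['Z_(p ^ m)]_g}) : Y \subset M ->
    tuple_prod mu g [set r | lmx r m \in Y] = (#|Y|%:R * q)%:E.
  move=> YM; rewrite (_ : [set r | _] = (fun r => lmx r m) @^-1` [set` Y])//.
  rewrite measure_fibers; [|exact: finite_finset|exact: measurable_level_mx].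
  rewrite (eq_fsbigr (fun=> q%:E)) => [|B /set_mem /= BY]; last first.
    have := fintype.subsetP YM _ BY; rewrite inE => /forallP BS.
    rewrite -(tuple_X_law p_prime p_odd F_free sc sx mu_unif Ap A_class sAM fc fM fT fs
      (h := fun i => todisc (row i B))) => [|i]; last by have := BS i; rewrite inE => /asboolP.
    congr (tuple_prod mu g _); apply/seteqP; split=> [r /= <- i|r rB /=].
      by rewrite rowK.
    by apply/row_matrixP => i; rewrite rowK; apply: (can_inj (@todiscK _)); exact: rB.
  rewrite fsbig_finite/=; last exact: finite_finset.
  rewrite sumEFin big_const_seq count_predT iter_addr_0 card_fset_set_finType.
  rewrite mulr_natl; congr ((_ *+ _)%:E); apply: eq_card => B; rewrite inE.
  by apply/asboolP/idP.
have qE : #|M|%:R * q = 1.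
  apply: EFin_inj; rewrite -law// -[RHS](probability_setT (tuple_prod mu g)).
  by congr (tuple_prod mu g _); apply/seteqP; split=> r //= _; exact: lmxM.
have M0 : #|M|%:R != 0 :> R by apply: contra_eq_neq qE => ->; rewrite mul0r eq_sym oner_eq0.
rewrite (_ : [set r | _] = [set r | lmx r m \in [set B in M | \det B == 0]%SET]).
  rewrite law; last by apply/fintype.subsetP => B; rewrite inE => /andP[].
  by congr (_ * _)%:E; apply: (mulfI M0); rewrite qE mulfV.
apply/seteqP; split=> r /=; rewrite inE lmxM; first by move=> ->; rewrite eqxx.
by move=> /eqP.
Qed.

Lemma measurable_level_preimage (Y : set 'M['Z_(p ^ m)]_g) :
  measurable [set r : g.-tuple (X p s) | Y (lmx r m)].
Proof.
rewrite (_ : [set r | _] = \bigcup_(B in Y) [set r | lmx r m = B]).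
  by apply: fin_bigcup_measurable => [|B _]; [exact: finite_finset|exact: measurable_level_mx].
by apply/seteqP; split=> [r Yr|r [B YB /= ->]//]; exists (lmx r m).
Qed.

Lemma level_mx_det0_le n : ((p * n) ^ (g.+1 * g.+1) < p ^ m)%N ->
  (n%:R%:E * tuple_prod mu g [set r | \det (lmx r m) = 0%R] <= g%:R%:E :> \bar R)%E.
Proof.
move=> mn; rewrite level_mx_det0 lee_fin mulrA.
have [->|M0] := eqVneq #|M| 0%N; first by rewrite invr0 mulr0 ler0n.
rewrite ler_pdivrMr ?ltr0n ?lt0n// -!natrM ler_nat.
apply: det0_count => // v i j; move=> vS.
have [Pv _] : X_level p sA 1 (todisc v) by move: vS; rewrite inE => /asboolP.
rewrite inE; apply/asboolP; split=> //.
(* A shift by a multiple of [p] is a [p]-th power in the group of row vectors, so it stays in the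
   Frattini subgroup. *)
have -> : todisc (v - (p * j)%:R *: delta_mx 0 i) =
    (todisc v * ((todisc (j%:R *: delta_mx 0 i)%R) ^+ p)^-1)%g :> A.
  apply: (can_inj (@ofdiscK _)).
  rewrite ofdiscM (morph_gV (@ofdiscM _)) (morph_gX (@ofdiscM _)) !todiscK.
  by rewrite FinRing.zmodXgE scaler_nat scaler_nat mulnC mulrnA.
by apply: cn_M => //; apply: cn_V; exact: (@lower_pcentralX A p 0).
Qed.

End Level.

Lemma measurable_nondegenerate : measurable nondegenerate.
Proof.
rewrite (_ : nondegenerate = \bigcup_m [set r | \det (lmx r m.+1) <> 0]).
  apply: bigcupT_measurable => m.
  exact: (@measurable_level_preimage m.+1 isT [set B | \det B <> 0]).
apply/seteqP; split=> [r [[//|m] _ rm]|r [m _ /= rm]]; first by exists m => //; exact/eqP.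
by exists m.+1 => //; apply/eqP.
Qed.

(** The complement lies in the event of a zero determinant at every level, so its probability [e]
    satisfies [n * e <= g] for each [n], at a level large enough for [level_mx_det0_le]. An [n]
    beyond [g / e] contradicts [e > 0]. *)
Lemma nondegenerate_as : tuple_prod mu g nondegenerate = 1%E.
Proof.
have mN := measurable_nondegenerate.
suff : tuple_prod mu g (~` nondegenerate) = 0%E.
  move=> N0; have := probability_setC (tuple_prod mu g) mN; rewrite N0 => /eqP.
  by rewrite eq_sym sube_eq// ?fin_num_measure// add0e => /eqP <-.
have fN : tuple_prod mu g (~` nondegenerate) \is a fin_num by rewrite fin_num_measure//; exact: measurableC.
apply/eqP; rewrite eq_le measure_ge0 andbT leNgt; apply/negP.
rewrite -(fineK fN) lte_fin; set e := fine _ => e_gt0.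
pose n := (Num.bound (g%:R / e)).+1.
have [m m_gt0 mn] : exists2 m, (0 < m)%N & ((p * n) ^ (g.+1 * g.+1) < p ^ m)%N.
  by exists ((p * n) ^ (g.+1 * g.+1)).+1 => //; apply: ltn_trans (ltn_expl _ (prime_gt1 p_prime)).
have := level_mx_det0_le m_gt0 mn; apply/negP; rewrite -ltNge.
apply: (@lt_le_trans _ _ (n%:R%:E * e%:E)%E).
  rewrite -EFinM lte_fin -ltr_pdivrMr//.
  apply: lt_trans (_ : (Num.bound (g%:R / e))%:R < _); last by rewrite ltr_nat.
  by rewrite archi_boundP// divr_ge0// ltW.
apply: lee_wpmul2l; first by rewrite lee_fin ler0n.
rewrite fineK//; apply: le_measure; rewrite ?inE.
- exact: measurableC.
- exact: (measurable_level_preimage m_gt0 [set B | \det B = 0]).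
- move=> r /= rN; apply: contrapT => /eqP rm; apply: rN; exists m => //.
Qed.

End AlmostSurelySchur.

(** * Total mass *)

Section CohenLenstraMass.
Variables (R : realType) (p : nat).
Hypotheses (p_prime : prime p) (p_odd : odd p).
Local Open Scope ring_scope.
Let q : R := p%:R^-1.

Let p_gt0 : 0 < p%:R :> R. Proof. by rewrite ltr0n prime_gt0. Qed.
Let p_neq0 : p%:R != 0 :> R. Proof. by rewrite gt_eqF. Qed.
Let q_gt0 : 0 < q. Proof. by rewrite invr_gt0. Qed.
Let q_le : 3 * q <= 1.
Proof.
rewrite ler_pdivrMr// mul1r ler_nat; case: p p_odd (prime_gt1 p_prime) => [|[|[|]]]//.
Qed.

Lemma euler_prod_add k d :
  euler_prod q (k + d) = euler_prod q k * \prod_(i < d) (1 - q ^+ (k + d - i)).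
Proof.
rewrite (reindex_inj rev_ord_inj) /=.
under eq_bigr => i _ do rewrite -addnBA ?leq_subr// subKn//.
elim: d => [|d IH]; first by rewrite big_ord0 mulr1 addn0.
by rewrite addnS euler_prodS IH big_ord_recr /= mulrA addnS.
Qed.

Lemma prod_free_tuples k d : (\prod_(i < d) (p ^ (k + d) - p ^ i))%N%:R =
  q ^- ((k + d) * d) * (euler_prod q (k + d) / euler_prod q k) :> R.
Proof.
rewrite euler_prod_add mulrAC divff ?mul1r ?gt_eqF ?euler_prod_gt0//.
rewrite natr_prod exprM -!exprVn /q invrK.
rewrite -[X in _ ^+ X](card_ord d) -prodr_const -big_split; apply: eq_bigr => i _ /=.
have id : (i <= k + d)%N by rewrite ltnW// ltn_addl.
rewrite natrB; last by rewrite leq_pexp2l// prime_gt0.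
rewrite !natrX mulrBr mulr1 /q exprVn -exprB ?unitfE//.
- by rewrite subKn.
- exact: leq_subr.
Qed.

Lemma mu_CLE g : mu_CL p R g = q ^+ (g ^ 2) * euler_prod q g ^- 2 * euler_limit q.
Proof.
rewrite /mu_CL -[p%:R ^- _]exprVn -/q; congr (_ * _ * _).
  rewrite /euler_prod -prodrXl -prodfV; apply: eq_bigr => j _.
  by rewrite exprVn.
congr (limn _); apply/funext => n; rewrite /euler_prod; apply: eq_bigr => j _.
by rewrite exprVn.
Qed.

Lemma mu_CL_ge0 g : 0 <= mu_CL p R g.
Proof.
rewrite mu_CLE; apply: mulr_ge0; last exact/ltW/euler_limit_gt0.
by rewrite mulr_ge0// ?exprn_ge0 ?invr_ge0 ?exprn_ge0// ltW// euler_prod_gt0.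
Qed.

Lemma mu_CL_durfee d k : mu_CL p R (k + d) * (\prod_(i < d) (p ^ (k + d) - p ^ i))%N%:R =
  euler_limit q * durfee_term q d k.
Proof.
have e_neq0 n : euler_prod q n != 0 by rewrite gt_eqF// euler_prod_gt0.
rewrite prod_free_tuples mu_CLE /durfee_term.
(* The first factor cancels against the generating tuples; the second is the numerator of the Durfee
   term. *)
have -> : q ^+ ((k + d) ^ 2) = q ^+ ((k + d) * d) * q ^+ (k * (k + d)).
  by rewrite -exprD [(k * _)%N]mulnC -mulnDr [(d + k)%N]addnC.
set E := euler_limit q; set a := q ^+ _; set b := q ^+ _.
have a_neq0 : a != 0 by rewrite expf_neq0// gt_eqF.
set e1 := euler_prod q (k + d); set e2 := euler_prod q k.
have -> : a * b * e1 ^- 2 * E * (a^-1 * (e1 / e2)) =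
   (a / a) * (e1 / e1) * (E * (b / (e2 * e1))).
  rewrite expr2 !invfM; move: a^-1 e1^-1 e2^-1 => a' e1' e2'; lra.
by rewrite (divff a_neq0) (divff (e_neq0 (k + d)%N)) !mul1r.
Qed.

Lemma mu_CL_mass d : (\sum_(0 <= g <oo) (mu_CL p R g)%:E *
  (\prod_(i < d) (p ^ g - p ^ i))%N%:R%:E = 1)%E.
Proof.
have E_gt0 : 0 < euler_limit q := euler_limit_gt0 q_gt0 q_le.
(* The factor of index [i = g] vanishes for ranks below [d], so the series starts at [g = d], with
   [k = g - d] as the Durfee index. *)
have z g : (g < d)%N -> (\prod_(i < d) (p ^ g - p ^ i))%N = 0%N.
  by move=> gd; rewrite (bigD1 (Ordinal gd))//= subnn mul0n.
apply/cvg_lim => //; rewrite -(cvg_shiftn d) /=.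
rewrite (_ : (fun n => _) = (fun n => (euler_limit q * \sum_(k < n) durfee_term q d k)%:E)).
  apply: cvg_EFin; first exact: nearW.
  rewrite -(mulfV (lt0r_neq0 E_gt0)).
  by apply: cvgMr; exact: cvg_durfee.
apply/funext => n; rewrite addnC (@big_cat_nat _ _ _ d)//= ?leq_addr//.
rewrite big_nat_cond big1 ?add0e => [|g]; last first.
  by rewrite andbT => /= gd; rewrite z// mule0.
rewrite -{1}[d]add0n big_addn addKn big_mkord mulr_sumr -sumEFin; apply: eq_bigr => k _.
by rewrite -EFinM mu_CL_durfee.
Qed.

End CohenLenstraMass.

(** * Transfer along isomorphisms *)

Section TransferAlongIso.

Local Open Scope group_scope.

Section Transfer.
Variable p : nat.
Hypothesis p_prime : prime p.

Lemma d_eq_iso (G H : topGroupType) n : isomorphic G H -> d_eq p G n -> d_eq p H n.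
Proof.
move=> [f [fM fc [h [fK hK hc]]]] [b bZ bP].
have hM : {morph h : x y / x * y} by move=> x y; apply: (can_inj fK); rewrite fM !hK.
exists (fun i => b i \o h) => [i|z [zl zM]].
  have [bl bM] := bZ i; split; first exact: locally_constant_comp.
  by move=> x y /=; rewrite hM bM.
have [|a [aE a_uniq]] := bP (z \o f).
  split; first exact: locally_constant_comp.
  by move=> x y /=; rewrite fM zM.
exists a; split=> [|a' a'E].
  apply/funext => t; rewrite -[in z t](hK t).
  exact: (congr1 (fun k => k (h t)) aE).
apply: a_uniq; apply/funext => t; rewrite -[RHS](congr1 (fun k => k (f t)) a'E) /=.
by congr (_ - _)%R; apply: eq_bigr => i _; rewrite fK.
Qed.

Lemma Q_lift (G P : topGroupType) c (f : G -> P) : continuous f ->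
  {morph f : x y / x * y} -> lower_pcentral P p c = [set 1]%classic :> set P ->
  exists2 k : Q p c G -> P, continuous k /\ {morph k : x y / x * y} &
    forall x, k (qpi (lower_pcentral G p c) x) = f x.
Proof.
move=> fc fM Pc; apply: qpi_lift => // x Px.
by have := lower_pcentral_morph fc fM Px; rewrite Pc.
Qed.

Lemma Q_iso (G H : topGroupType) c : pro_p p G -> pro_p p H -> isomorphic G H ->
  isomorphic (Q p c G) (Q p c H).
Proof.
move=> Gp Hp [f [fM fc [h [fK hK hc]]]].
have hM : {morph h : x y / x * y} by move=> x y; apply: (can_inj fK); rewrite fM !hK.
have [||k [kc kM] kE] := @Q_lift G _ c (qpi (lower_pcentral H p c) \o f) _ _ (Q_lower1 p_prime Hp c).
- by move=> x; apply: continuous_comp; [exact: fc|exact: qpi_continuous].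
- by move=> x y /=; rewrite fM qpiM.
have [||l [lc lM] lE] := @Q_lift H _ c (qpi (lower_pcentral G p c) \o h) _ _ (Q_lower1 p_prime Gp c).
- by move=> x; apply: continuous_comp; [exact: hc|exact: qpi_continuous].
- by move=> x y /=; rewrite hM qpiM.
exists k; split=> //; exists l; split=> // a; have [x ->] := qpi_surj a.
  by rewrite kE lE /= fK.
by rewrite lE kE /= hK.
Qed.

(** This makes a condition on [Q p c] of the presented group depend on finitely many values of the
    relators modulo P_c(F), hence measurable. Each of the two groups maps to the other because its
    relators die there. *)
Lemma Q_presented (F : topGroupType) (I : Type) (rho rho' : I -> F) c : pro_p p F ->
  (forall i, qpi (lower_pcentral F p c) (rho i) = qpi (lower_pcentral F p c) (rho' i)) ->
  isomorphic (Q p c (quot (closed_normal_closure (range rho)) : topGroupType))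
    (Q p c (quot (closed_normal_closure (range rho')) : topGroupType)).
Proof.
move=> Fp.
have half (s s' : I -> F) : (forall i, qpi (lower_pcentral F p c) (s i) =
      qpi (lower_pcentral F p c) (s' i)) ->
    let G := quot (closed_normal_closure (range s)) : topGroupType in
    let G' := quot (closed_normal_closure (range s')) : topGroupType in
    exists2 k : Q p c G -> Q p c G', continuous k /\ {morph k : x y / x * y} &
      forall u, k (qpi (lower_pcentral G p c) (qpi _ u)) = qpi (lower_pcentral G' p c) (qpi _ u).
  move=> ss' G G'.
  have G'p : pro_p p G' := quot_pro_p p_prime _ Fp.
  pose f u : Q p c G' := qpi (lower_pcentral G' p c) (qpi (closed_normal_closure (range s')) u).
  have fM : {morph f : u v / u * v} by move=> u v; rewrite /f !qpiM.
  have fc : continuous f.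
    by move=> u; apply: (@continuous_comp _ _ _ (qpi _) (qpi _)); exact: qpi_continuous.
  have G'1 := Q_lower1 p_prime G'p c.
  have fN u : cn_set (closed_normal_closure (range s)) u -> f u = 1.
    have hG' := @quot_hausdorff p p_prime G' G'p (lower_pcentral G' p c).
    pose T1 := ClosedNormal (closed_subgroup_set1 hG') (@conj_invariant_set1 _).
    apply: (closed_normal_closure_min (N := cn_preimage fc fM T1)) => _ [i _ <-] /=.
    rewrite -(mulKVg (s' i) (s i)) fM (_ : f (s' i) = 1) ?mul1g.
      have /esym/qpi_eq Pi := ss' i.
      by have := lower_pcentral_morph fc fM Pi; rewrite G'1.
    rewrite /f (_ : qpi _ (s' i) = 1) ?(morph_g1 (@qpiM _ _))//.
    by apply/qpi_eq1; apply: sub_closed_normal_closure; exists i.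
  have [l [lc lM] lE] := qpi_lift fc fM fN.
  have [k kP kE] := Q_lift lc lM G'1.
  by exists k => // u; rewrite kE lE.
move=> ss'; have [k [kc kM] kE] := half _ _ ss'.
have [|l [lc lM] lE] := half rho' rho; first by move=> i; rewrite ss'.
exists k; split=> //; exists l; split=> // a; have [b ->] := qpi_surj a;
  have [u ->] := qpi_surj b.
- by rewrite kE lE.
- by rewrite lE kE.
Qed.

Lemma level_GI (G P : topGroupType) c : pro_p p G -> (exists s : G -> G, GI_automorphism s) ->
  isomorphic (Q p c G) P -> exists t : P -> P, GI_automorphism t.
Proof.
move=> Gp [s sGI] [f fiso]; have [fM fc [f' [fK f'K f'c]]] := fiso.
pose q := f \o qpi (lower_pcentral G p c).
have [|||||t tGI _] := @GI_quotient p G P q s Gp sGI; last by exists t.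
- by move=> x; apply: continuous_comp; [exact: qpi_continuous|exact: fc].
- by move=> x y; rewrite /q /= qpiM fM.
- apply/seteqP; split=> // y _; have [x fx] := qpi_surj (f' y).
  by exists x => //; rewrite /q /= -fx f'K.
- by move=> k; apply: isomorphic_quotient_map fiso _ => l; exact: qpi_factor_continuous.
- move=> x fx1; have /qpi_eq1 Px : qpi (lower_pcentral G p c) x = 1.
    by apply: (can_inj fK); rewrite (morph_g1 fM).
  rewrite /q /= (_ : qpi _ (s x) = 1) ?(morph_g1 fM)//; apply/qpi_eq1.
  by apply: lower_pcentral_morph Px; [exact: GI_continuous|exact: GI_morph].
Qed.

(** Conjugacy of GI-automorphisms is used at finite class, so both counts are compared with the
    count from [Q p c G]. *)
Lemma counting_Sur_iso (R : realType) (G G' H : topGroupType) c (s : G -> G) (s' : G' -> G')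
    (sH : H -> H) : odd p -> pro_p p G -> pro_p p G' -> isomorphic G G' ->
  GI_automorphism s -> GI_automorphism s' ->
  lower_pcentral H p c = [set 1]%classic :> set H ->
  counting (Sur s sH) = counting (Sur s' sH) :> \bar R.
Proof.
move=> p_odd Gp G'p GG' sGI s'GI Hc.
have Qp : pro_p p (Q p c G) := quot_pro_p p_prime _ Gp.
have [|t tGI] := level_GI Gp _ (isomorphic_refl (Q p c G)); first by exists s.
rewrite (counting_Sur_level p_prime p_odd R sH Gp Qp (isomorphic_refl _) sGI tGI Hc).
apply/esym/(counting_Sur_level p_prime p_odd R sH G'p Qp _ s'GI tGI Hc).
by apply: Q_iso => //; exact: isomorphic_sym.
Qed.

End Transfer.

(** * Finite groups are countably many up to isomorphism *)

Section Code.

(** The entries are ranks in the enumeration of [T], so tables of different groups can be compared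
    and encoded by natural numbers. *)
Definition group_table (T : finGroupType) : seq (seq nat) :=
  [seq [seq nat_of_ord (enum_rank (x * y)) | y <- enum T] | x <- enum T].

Lemma group_tableE (T : finGroupType) (x y : T) :
  nth 0%N (nth [::] (group_table T) (enum_rank x)) (enum_rank y) = enum_rank (x * y).
Proof.
have rank_lt (z : T) : (enum_rank z < size (enum T))%N by rewrite -cardE.
by rewrite (nth_map x)// (nth_map x)// !nth_enum_rank.
Qed.

Lemma group_table_iso (T T' : finGroupType) : group_table T = group_table T' ->
  exists2 f : T -> T', {morph f : x y / x * y} &
    exists2 h : T' -> T, cancel f h & cancel h f.
Proof.
move=> TT'; have sT : #|T| = #|T'|.
  by rewrite !cardT; have := congr1 size TT'; rewrite !size_map.
pose f x := enum_val (cast_ord sT (enum_rank x)).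
pose h x := enum_val (cast_ord (esym sT) (enum_rank x)).
have fr x : enum_rank (f x) = enum_rank x :> nat by rewrite enum_valK.
exists f => [x y|].
  by apply/enum_rank_inj/val_inj; rewrite /= fr -!group_tableE !fr TT'.
by exists h => x; rewrite /f /h enum_valK ?cast_ordK ?cast_ordKV enum_rankK.
Qed.

Definition group_code (P : topGroupType) : nat :=
  if pselect (finite_set [set: P]) is left finP then choice.pickle (group_table (fin_of finP))
  else 0%N.

Lemma group_code_iso (P P' : topGroupType) : (forall A : set P, open A) ->
  (forall A : set P', open A) -> finite_set [set: P] -> finite_set [set: P'] ->
  group_code P = group_code P' -> isomorphic P P'.
Proof.
move=> dP dP' fP fP'; rewrite /group_code.
case: pselect => // finP; case: pselect => // finP' /(pcan_inj choice.pickleK).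
move=> /group_table_iso[f fM [h fK hK]].
exists f; split=> //; first exact: discrete_continuous.
by exists h; split=> //; exact: discrete_continuous.
Qed.

End Code.

Section Classes.
Variable C : topGroupType -> Prop.

Lemma class_eq (a b : isoclass C) : isomorphic (class_repr a) (class_repr b) -> a = b.
Proof.
move=> ab; rewrite -[a]reprK -[b]reprK; apply/eqmodP.
by apply/asboolP.
Qed.

Lemma class_repr_pi (G : topGroupType) (CG : C G) :
  isomorphic (class_repr (\pi_(isoclass C)%qT (Groups CG))) G.
Proof.
rewrite /class_repr.
have /eqmodP/asboolP := reprK (\pi_(isoclass C)%qT (Groups CG)).
exact.
Qed.

Lemma class_reprP (a : isoclass C) : C (class_repr a).
Proof. exact: groupsP. Qed.

End Classes.

End TransferAlongIso.

(** * Contribution of a fixed rank *)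

Local Open Scope ring_scope.
Local Open Scope ereal_scope.

Section EqMeasurable.
Import HBNNSimple.

(** The integral is defined through simple functions, whose fibres are measurable. This lets a
    genuine measure replace the set function [mu_BBH]. *)
Lemma eq_measurable_integral d (T : measurableType d) (R : realType) (m1 m2 : set T -> \bar R)
    (D : set T) (f : T -> \bar R) :
  (forall A, measurable A -> m1 A = m2 A) -> \int[m1]_(x in D) f x = \int[m2]_(x in D) f x.
Proof.
move=> m12.
have sE (h : {nnsfun T >-> R}) : sintegral m1 h = sintegral m2 h.
  by apply: eq_fsbigr => r _; congr (_ * _); apply: m12; exact: measurable_funPTI.
rewrite /integral; congr (ereal_sup _ - ereal_sup _);
  by apply/seteqP; split=> _ [h hf <-]; exists h.
Qed.

End EqMeasurable.

Lemma probability1_setI d (T : measurableType d) (R : realType) (P : probability T R)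
    (A B : set T) : measurable A -> measurable B -> P A = 1 -> P (A `&` B) = P B.
Proof.
move=> mA mB A1; apply/eqP; rewrite eq_le; apply/andP; split.
  by apply: le_measure; rewrite ?inE//; exact: measurableI.
have A0 : P (~` A) = 0 by rewrite probability_setC// A1 subee.
have mC := measurableC mA; have mI := measurableI _ _ mA mB.
apply: (@le_trans _ _ (P ((A `&` B) `|` ~` A))).
  apply: le_measure; rewrite ?inE//; first exact: measurableU.
  by move=> t Bt; have [At|At] := pselect (A t); [left|right].
apply: le_trans (measureU2 _ mI mC) _.
by rewrite -[leRHS]adde0 -A0.
Qed.

Lemma counting_setI (T : choiceType) (R : realType) (A B : set T) : finite_set A ->
  counting (A `&` B) = \sum_(a \in A) (\1_B a : R)%R%:E.
Proof.
move=> finA; have finAB : finite_set (A `&` B) by exact: finite_setIl.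
transitivity (\sum_(a \in A) if a \in B then 1%:E else 0%:E : \bar R); last first.
  by apply: eq_fsbigr => a _; rewrite indicE; case: (a \in B).
rewrite -fsbig_mkcondr fsbig_finite//= sumEFin big_const_seq count_predT iter_addr_0.
by rewrite /counting asboolT.
Qed.

Definition Sur_count (R : realType) p (H : topGroupType) (sH : H -> H) (a : schur_space p) : \bar R :=
  counting (Sur (@fixed_GI (class_repr a)) sH).

Section RankG.
Variables (p : nat) (p_prime : prime p) (p_odd : odd p) (g : nat).
Variables (F : topGroupType) (x : 'I_g -> F) (F_free : free_pro_p p x).
Variable s : {multiplicative F -> F}.
Hypotheses (s_continuous : continuous s) (s_inv : forall i, s (x i) = ((x i)^-1)%g).
Local Notation T := (g.-tuple (X p s)).
Local Notation nd := (nondegenerate p_prime F_free (s := s)).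

Definition presented_by (r : T) : topGroupType :=
  quot (closed_normal_closure [set \val (tnth r i) | i in [set: 'I_g]]).

Let sM : {morph s : u v / (u * v)%g} := @gmulfM _ _ s.

Let rhoP (r : T) i : cn_set (lower_pcentral F p 1) (relators r i).
Proof. exact: (proj1 (set_valP (tnth r i))). Qed.

Let s_rho (r : T) i : s (relators r i) = ((relators r i)^-1)%g.
Proof. exact: (proj2 (set_valP (tnth r i))). Qed.

Lemma presented_by_pro_p (r : T) : pro_p p (presented_by r).
Proof. exact: (presented_pro_p p_prime F_free). Qed.

Lemma presented_by_schur (r : T) : nd r -> schur_sigma p (presented_by r).
Proof.
move=> [m m_gt0 detR].
exact: (presented_schur (rhoP r) sM s_continuous s_inv (s_rho r) m_gt0 detR).
Qed.

Lemma presented_by_d_eq (r : T) : d_eq p (presented_by r) g.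
Proof. exact: (presented_d_eq p_prime F_free (rhoP r)). Qed.

Lemma presented_by_nondegenerate (r : T) (H : topGroupType) : isomorphic (presented_by r) H ->
  schur_sigma p H -> nd r.
Proof.
move=> GH [_ _ finD _ _].
by have [m m_gt0 detR] := presented_det_neq0 p_prime F_free GH finD; exists m.
Qed.

(* The value is junk when [r] does not present a Schur sigma-group. *)
Definition presented_class (r : T) : schur_space p :=
  if pselect (schur_sigma p (presented_by r)) is left h
  then \pi_(isoclass (schur_sigma p))%qT (Groups h)
  else \pi_(isoclass (schur_sigma p))%qT (Groups (schur_sigma_trivial p)).

Lemma presented_class_iso (r : T) : nd r ->
  isomorphic (class_repr (presented_class r)) (presented_by r).
Proof.
move=> /presented_by_schur h; rewrite /presented_class; case: pselect => // h'.
exact: class_repr_pi.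
Qed.

Lemma presented_class_degenerate (r : T) : ~ nd r -> presented_class r =
  \pi_(isoclass (schur_sigma p))%qT (Groups (schur_sigma_trivial p)).
Proof.
rewrite /presented_class; case: pselect => // h []; exact: presented_by_nondegenerate (isomorphic_refl _) h.
Qed.

(** The left side is the event in the definition of [mu_BBH]. An isomorphism with a Schur
    sigma-group forces [r] to be nondegenerate, through the finite abelianization, and the rank is
    always [g]. *)
Lemma presented_in_class (A : set (schur_space p)) :
  [set r : T | exists2 a : schur_space p, A a &
    d_eq p (class_repr a) g /\ isomorphic (presented_by r) (class_repr a)] =
  nd `&` presented_class @^-1` A.
Proof.
apply/seteqP; split=> [r [a Aa [_ ra]]|r [rn Ar]].
  have rn : nd r := presented_by_nondegenerate ra (class_reprP _).
  split=> //=; rewrite (_ : presented_class r = a)//; apply: class_eq.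
  exact: isomorphic_trans (presented_class_iso rn) ra.
exists (presented_class r) => //; have rE := isomorphic_sym (presented_class_iso rn).
by split=> //; apply: d_eq_iso rE _; exact: presented_by_d_eq.
Qed.

(** [Q p c F] is finite, so [S] is a finite union of boxes. *)
Lemma measurable_X_proj_dependent c (S : set T) :
  (forall r r', (forall i, X_proj c (tnth r i) = X_proj c (tnth r' i)) -> S r -> S r') ->
  measurable S.
Proof.
move=> Sdep.
have finQ : finite_set [set: Q p c F].
  by apply: Q_finite => //; [exact: F_free.1|exact: (free_fg p_prime F_free)].
pose Y := [set y : {ffun 'I_g -> fin_of finQ} |
  exists2 r, S r & forall i, X_proj c (tnth r i) = y i].
have -> : S = \bigcup_(y in Y) tuple_box (fun i => X_proj (s := s) c @^-1` [set (y i : Q p c F)]).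
  apply/seteqP; split=> [r Sr|r [y [r' Sr' ry] rE]].
    exists [ffun i => X_proj c (tnth r i) : fin_of finQ].
      by exists r => // i; rewrite ffunE.
    by move=> i /=; rewrite ffunE.
  by apply: Sdep Sr' => i; rewrite ry; exact/esym/rE.
apply: fin_bigcup_measurable => [|y _]; first exact: finite_finset.
by apply: measurable_tuple_box => i; exact: (X_proj_measurable p_prime F_free).
Qed.

Lemma measurable_presented_level c (P : topGroupType) :
  measurable [set r : T | isomorphic (Q p c (presented_by r)) P].
Proof.
apply: (@measurable_X_proj_dependent c) => r r' rr'; apply: isomorphic_trans.
apply: (Q_presented p_prime F_free.1).
by move=> i; have := rr' i; rewrite /X_proj qpiE => ->.
Qed.

Hypothesis mnd : measurable nd.

Lemma measurable_presented_class : measurable_fun [set: T] presented_class.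
Proof.
apply: (@measurability _ _ T (schur_space p) setT presented_class (@Omega_gen p)) => //.
move=> _ [_ [c [P [Pp ->]]] <-]; rewrite setTI.
pose L := [set r : T | isomorphic (Q p c (presented_by r)) P].
pose c0 := \pi_(isoclass (schur_sigma p))%qT (Groups (schur_sigma_trivial p)).
(* All degenerate tuples have the class [c0], so their part of the preimage is everything or
   nothing. *)
have -> : presented_class @^-1` [set a | isomorphic (Q p c (class_repr a)) P] =
    (nd `&` L) `|` (~` nd `&` [set _ | isomorphic (Q p c (class_repr c0)) P]).
  have QE r : nd r -> isomorphic (Q p c (class_repr (presented_class r))) (Q p c (presented_by r)).
    move=> rn; apply: Q_iso => //; last exact: presented_class_iso.
      by have [] := class_reprP (presented_class r).
    exact: presented_by_pro_p.
  apply/seteqP; split=> [r /= rP|r [[rn Lr]|[rn /= c0P]] /=].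
  - have [rn|rn] := pselect (nd r).
      by left; split=> //; apply: isomorphic_trans rP; apply: isomorphic_sym; exact: QE.
    by right; split=> //; move: rP; rewrite (presented_class_degenerate rn).
  - exact: isomorphic_trans (QE _ rn) Lr.
  - by rewrite presented_class_degenerate.
apply: measurableU; first by apply: measurableI => //; exact: measurable_presented_level.
apply: measurableI; first exact: measurableC.
have [h|h] := pselect (isomorphic (Q p c (class_repr c0)) P).
  by rewrite (_ : [set _ | _] = setT)//; apply/seteqP; split.
by rewrite (_ : [set _ | _] = set0)//; apply/seteqP; split.
Qed.

Section Target.
Variables (R : realType) (H : topGroupType) (c : nat) (sH : H -> H).
Hypotheses (Hp : finite_pgroup p H)
  (Hc : lower_pcentral H p c = [set 1%g]%classic :> set H) (sH_GI : GI_automorphism sH).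

Lemma finite_Sur : finite_set (Sur s sH).
Proof.
have := counting_Sur_free p_prime p_odd F_free sM s_continuous s_inv Hp sH_GI R.
by rewrite /counting; case: ifPn => // /asboolP.
Qed.

Lemma Sur_presented (r : T) : nd r ->
  counting (Sur (@fixed_GI (class_repr (presented_class r))) sH) =
  counting [set f | Sur s sH f /\ forall i, f (relators r i) = 1%g] :> \bar R.
Proof.
move=> rn; have [t tGI ts] := presented_GI p_prime F_free sM s_continuous s_inv (s_rho r).
have [cp _ _ _ cGI] := class_reprP (presented_class r).
rewrite (counting_Sur_iso p_prime R sH p_odd cp (presented_by_pro_p r)
  (presented_class_iso rn) (fixed_GI_P cGI) tGI Hc).
rewrite -(@counting_Sur_precomp _ _ _ (qpi _) s t sH (@qpi_continuous _ _) (@qpiM _ _)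
  (qpi_range _) _ (esym ts) R); last by move=> f; exact: qpi_factor_continuous.
congr counting; apply/seteqP; split=> f [Sf fr]; split=> //.
  by move=> i; apply: fr; apply/qpi_eq1; apply: sub_closed_normal_closure; exists i.
have [fc fM _ _] := Sf.
have hH := pro_p_hausdorff (finite_pgroup_pro_p p_prime Hp).
pose T1 := ClosedNormal (closed_subgroup_set1 hH) (@conj_invariant_set1 _).
move=> u /qpi_eq1; apply: (closed_normal_closure_min (N := cn_preimage fc fM T1)).
by move=> _ [i _ <-]; exact: fr.
Qed.

Variable mu : probability (X p s) R.
Hypotheses (mu_unif : uniform_on_levels mu) (nd1 : tuple_prod mu g nd = 1).

Lemma expectation_Sur :
  measurable_fun [set: T] (@Sur_count R p H sH \o presented_class) ->
  \int[tuple_prod mu g]_r (@Sur_count R p H sH \o presented_class) r =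
  (\prod_(i < gen_rank p H) (p ^ g - p ^ i))%N%:R%:E.
Proof.
move=> mf; have sHM := GI_morph sH_GI.
pose box (f : F -> H) : set T := [set r | Sur s sH f /\ forall i, f (relators r i) = 1%g].
have boxE f : Sur s sH f -> box f = tuple_box (fun=> [set r : X p s | f (\val r) = 1%g]).
  by move=> Sf; apply/seteqP; split=> r //= [].
have mbox f : measurable (box f).
  have [Sf|nSf] := pselect (Sur s sH f); last first.
    by rewrite (_ : box f = set0)//; apply/seteqP; split=> r // [].
  rewrite boxE//; apply: measurable_tuple_box => i; have [fc _ _ _] := Sf.
  apply: (X_measurable_preimage (A := f @^-1` [set 1%g]%classic)).
  by have /continuousP := fc; apply; case: Hp.
have Pbox f : Sur s sH f ->
    tuple_prod mu g (box f) = (#|` fset_set (X_level p sH 1)|%:R ^- g : R)%R%:E.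
  move=> Sf; rewrite boxE//; have [fc fM fT fs] := Sf.
  apply: (tuple_X_law p_prime p_odd F_free s_continuous s_inv mu_unif Hp Hc sHM fc fM fT fs
    (h := fun=> 1%g)).
  move=> _; split; first exact: (cn_1 (lower_pcentral H p 1)).
  by rewrite (morph_g1 sHM) invg1.
(* Off a null set the integrand is a finite sum of indicators, one for each equivariant surjection
   from the free group, and can be integrated term by term. *)
rewrite (@ae_eq_integral _ _ _ (tuple_prod mu g) setT
  (fun r => \sum_(f \in Sur s sH) (\1_(box f) r : R)%R%:E))//; last 2 first.
- rewrite (_ : (fun r => _) =
      (fun r => \sum_(f <- fset_set (Sur s sH)) (\1_(box f) r : R)%R%:E)); last first.
    by apply/funext => r; rewrite fsbig_finite//; exact: finite_Sur.
  apply: emeasurable_sum => f; apply/measurable_EFinP; exact: measurable_indic.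
- exists (~` nd); split; first exact: measurableC.
    by have := probability_setC (tuple_prod mu g) mnd; rewrite nd1 subee.
  move=> r; apply: contra_not => rn _; rewrite /Sur_count /= Sur_presented//.
  rewrite -[X in counting X]/(Sur s sH `&` [set f | forall i, f (relators r i) = 1%g]).
  rewrite counting_setI; last exact: finite_Sur.
  apply: eq_fsbigr => f /set_mem Sf; rewrite !indicE; congr (_%:R%:E); congr nat_of_bool.
  by apply/idP/idP; rewrite !inE; [move=> fr; split|move=> []].
rewrite ge0_integral_fsum//; last 2 first.
- by move=> f; apply/measurable_EFinP; exact: measurable_indic.
- exact: finite_Sur.
rewrite (eq_fsbigr (fun=> (#|` fset_set (X_level p sH 1)|%:R ^- g : R)%R%:E)); last first.
  by move=> f /set_mem Sf; rewrite integral_indic// setIT; exact: Pbox.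
have := counting_Sur_free p_prime p_odd F_free sM s_continuous s_inv Hp sH_GI R.
rewrite fsbig_finite/=; last exact: finite_Sur.
rewrite /counting asboolT; last exact: finite_Sur.
rewrite sumEFin big_const_seq count_predT iter_addr_0 => -[/eqP].
rewrite eqr_nat => /eqP ->; congr (_%:E).
rewrite -[LHS]mulr_natl natrM natrX mulrAC divff ?mul1r//.
rewrite expf_neq0// pnatr_eq0 -lt0n cardfs_gt0; apply/fset0Pn; exists 1%g.
rewrite in_fset_set; last by apply: sub_finite_set (finite_pgroup_finite Hp).
rewrite inE; split; first exact: (cn_1 (lower_pcentral H p 1)).
by rewrite (morph_g1 sHM) invg1.
Qed.

End Target.
End RankG.

(** * Decomposition along ancestors *)

Section Main.
Variables (R : realType) (p : nat) (p_prime : prime p) (p_odd : odd p).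
Variables (H : topGroupType) (c : nat) (sH : H -> H).
Hypotheses (Hp : finite_pgroup p H) (Hclass : has_pclass p H c) (sH_GI : GI_automorphism sH).

Let Hc : lower_pcentral H p c = [set 1%g]%classic :> set H. Proof. by case: Hclass. Qed.

Local Notation f := (@Sur_count R p H sH).

Lemma ancestor_GI (P : topGroupType) : ancestor p P -> exists t : P -> P, GI_automorphism t.
Proof. by move=> [_ [G [n [[Gp _ _ _ GGI] /isomorphic_sym]]]]; exact: level_GI. Qed.

Definition ancestor_code (a : ancestor_class p c) : nat := group_code (class_repr a).

Lemma ancestor_code_inj : injective ancestor_code.
Proof.
move=> a b ab; apply: class_eq.
have [[[dP _] _] _] := class_reprP a; have [[[dP' _] _] _] := class_reprP b.
have [[fP _] _] := class_reprP a; have [[fP' _] _] := class_reprP b.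
exact: group_code_iso (finite_pgroup_finite fP) (finite_pgroup_finite fP') ab.
Qed.

(** Indexed by codes in [nat], so that countable additivity applies directly; a number that codes no
    ancestor gives the empty set. *)
Definition level_class (n : nat) : set (schur_space p) :=
  [set x | exists2 a : ancestor_class p c, ancestor_code a = n &
     isomorphic (Q p c (class_repr x)) (class_repr a)].

Lemma level_class_code (a : ancestor_class p c) : level_class (ancestor_code a) =
  [set x | isomorphic (Q p c (class_repr x)) (class_repr a)].
Proof.
apply/seteqP; split=> x /=; last by exists a.
by move=> [b /ancestor_code_inj ->].
Qed.

Lemma measurable_level_class n : measurable (level_class n).
Proof.
have [[a an]|nan] := pselect (exists a : ancestor_class p c, ancestor_code a = n).
  rewrite -an level_class_code; apply: sub_sigma_algebra; exists c, (class_repr a).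
  by split=> //; have [[]] := class_reprP a.
rewrite (_ : level_class n = set0)//; apply/seteqP; split=> x //= [a an _].
by apply: nan; exists a.
Qed.

Lemma trivIset_level_class : trivIset setT level_class.
Proof.
move=> i j _ _ [x [[a <- xa] [b <- xb]]]; congr ancestor_code; apply: class_eq.
exact: isomorphic_trans (isomorphic_sym xa) xb.
Qed.

Lemma Sur_count_level (a : ancestor_class p c) x :
  isomorphic (Q p c (class_repr x)) (class_repr a) ->
  f x = counting (Sur (@fixed_GI (class_repr a)) sH).
Proof.
move=> xa; have [xp _ _ _ xGI] := class_reprP x; have [aA _] := class_reprP a.
have ap := finite_pgroup_pro_p p_prime (proj1 aA).
by apply: (counting_Sur_level p_prime p_odd R sH xp ap xa) => //; apply: fixed_GI_P => //;
  exact: ancestor_GI.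
Qed.

(** A surjection onto [H] would give [Q p c] of the representative class exactly [c], by
    [Sur_pclass]; it would then be an ancestor of class [c], which puts [x] in a level class. *)
Lemma Sur_count_outside x : ~ (\bigcup_n level_class n) x -> f x = 0.
Proof.
move=> nx; have xS := class_reprP x; have [xp xfg _ _ xGI] := xS.
pose P := Q p c (class_repr x); have [t tGI] := level_GI xp xGI (isomorphic_refl P).
have Pp : pro_p p P := quot_pro_p p_prime _ xp.
rewrite /Sur_count (counting_Sur_level p_prime p_odd R sH xp Pp (isomorphic_refl _)
  (fixed_GI_P xGI) tGI Hc).
have [S0|/set0P Sn0] := eqVneq (Sur t sH) set0.
  by rewrite S0 /counting asboolT// fset_set0 cardfs0.
have Pc : has_pclass p P c.
  apply: Sur_pclass Pp _ Hclass Sn0 (Q_lower1 p_prime xp c).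
  exact: pro_p_hausdorff (finite_pgroup_pro_p p_prime Hp).
have PA : ancestor p P.
  split; first exact: Q_finite_pgroup.
  by exists (class_repr x), c; split=> //; exact: isomorphic_refl.
exfalso; apply: nx.
pose a : ancestor_class p c :=
  \pi_(isoclass (fun P => ancestor p P /\ has_pclass p P c))%qT (Groups (conj PA Pc)).
by exists (ancestor_code a) => //; exists a => //; exact/isomorphic_sym/class_repr_pi.
Qed.

Lemma Sur_count_ge0 x : 0 <= f x.
Proof. by rewrite /Sur_count /counting; case: ifP => // _; rewrite lee_fin. Qed.

Lemma Sur_count_const n x y : level_class n x -> level_class n y -> f x = f y.
Proof.
move=> [a <- xa] [b /ancestor_code_inj ba yb]; subst b.
by rewrite (Sur_count_level xa) (Sur_count_level yb).
Qed.

(** [f] is constant on each of the countably many level classes, and 0 outside them. *)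
Lemma measurable_Sur_count : measurable_fun [set: schur_space p] f.
Proof.
move=> _ Y mY; rewrite setTI.
pose K := [set n | exists2 x, level_class n x & Y (f x)].
have mU : measurable (\bigcup_n level_class n).
  by apply: bigcupT_measurable => n; exact: measurable_level_class.
rewrite (_ : f @^-1` Y = (\bigcup_(n in K) level_class n) `|`
    (~` (\bigcup_n level_class n) `&` [set _ | Y 0])).
  apply: measurableU; first by apply: bigcup_measurable => n _; exact: measurable_level_class.
  apply: measurableI; first exact: measurableC.
  have [h|h] := pselect (Y 0).
    by rewrite (_ : [set _ | _] = setT)//; apply/seteqP; split.
  by rewrite (_ : [set _ | _] = set0)//; apply/seteqP; split.
apply/seteqP; split=> [x /= Yx|x [[n [y ny Yy] nx]|[nx Y0]]] /=.
- have [[n _ nx]|nx] := pselect ((\bigcup_n level_class n) x).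
    by left; exists n => //; exists x.
  by right; split=> //=; rewrite -(Sur_count_outside nx).
- by rewrite (Sur_count_const nx ny).
- by rewrite Sur_count_outside.
Qed.

Lemma integral_level_class (m : {measure set (schur_space p) -> \bar R}) a :
  \int[m]_(x in level_class (ancestor_code a)) f x =
  counting (Sur (@fixed_GI (class_repr a)) sH) * m (level_class (ancestor_code a)).
Proof.
rewrite -integral_cst; last exact: measurable_level_class.
apply: eq_integral => x /set_mem; rewrite level_class_code => xa.
by rewrite (Sur_count_level xa).
Qed.

Lemma integral_Sur_count (m : {measure set (schur_space p) -> \bar R}) :
  \int[m]_x f x = \esum_(a in [set: ancestor_class p c])
    (m [set x | isomorphic (Q p c (class_repr x)) (class_repr a)] *
     counting (Sur (@fixed_GI (class_repr a)) sH)).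
Proof.
have mU : measurable (\bigcup_n level_class n).
  by apply: bigcupT_measurable => n; exact: measurable_level_class.
pose v n := \int[m]_(x in level_class n) f x.
have v0 n : 0 <= v n by apply: integral_ge0 => x _; exact: Sur_count_ge0.
transitivity (\int[m]_(x in \bigcup_n level_class n) f x).
  rewrite [RHS]integral_mkcond; apply: eq_integral => x _; rewrite patchE.
  by case: ifPn => // /negP nx; apply: Sur_count_outside => xU; apply: nx; rewrite inE.
have mL := measurable_level_class.
rewrite ge0_integral_bigcup//; last 3 first.
- by apply: measurable_funTS; exact: measurable_Sur_count.
- by move=> x _; exact: Sur_count_ge0.
- exact: trivIset_level_class.
rewrite nneseries_esumT//.
(* Numbers that are not codes contribute integrals over the empty set. *)
transitivity (\esum_(n in range ancestor_code) v n).
  rewrite [RHS]esum_mkcond; apply: eq_esum => n _; case: ifPn => // /negP nn.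
  rewrite /v (_ : level_class n = set0) ?integral_set0//.
  by apply/seteqP; split=> x //= [a an _]; apply: nn; rewrite inE; exists a.
rewrite esum_image; last by move=> a b _ _; exact: ancestor_code_inj.
by apply: eq_esum => a _; rewrite /v integral_level_class level_class_code muleC.
Qed.

End Main.

Theorem theorem4p1 (R : realType) (p : nat) (p_prime : prime p) (p_odd : odd p)
  (F : nat -> topGroupType) (x : forall g : nat, 'I_g -> F g)
  (F_free : forall g : nat, free_pro_p p (x g))
  (s : forall g : nat, {multiplicative F g -> F g})
  (s_continuous : forall g : nat, continuous (s g))
  (s_inv : forall (g : nat) (i : 'I_g), s g (x g i) = ((x g i)^-1)%g)
  (mu : forall g : nat, probability (X p (s g)) R)
  (mu_uniform : forall g : nat, uniform_on_levels (mu g))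
  (H : topGroupType) (c : nat) (sH : H -> H)
  (H_pgroup : finite_pgroup p H) (H_class : has_pclass p H c)
  (sH_GI : GI_automorphism sH) :
  \int[mu_BBH mu]_(G in [set: schur_space p])
      (counting (Sur (@fixed_GI (class_repr G)) sH) : \bar R)
    = \esum_(G in [set: ancestor_class p c])
        (mu_BBH_level mu c (class_repr G) *
         counting (Sur (@fixed_GI (class_repr G)) sH))
  /\
  \esum_(G in [set: ancestor_class p c])
      (mu_BBH_level mu c (class_repr G) *
       counting (Sur (@fixed_GI (class_repr G)) sH)) = 1.
Proof.
have mnd g := measurable_nondegenerate p_prime (F_free g) (s := s g).
have nd1 g := nondegenerate_as p_prime p_odd (F_free g) (s_continuous g) (s_inv g) (mu_uniform g).
have mcl g := measurable_presented_class (s_continuous g) (s_inv g) (mnd g).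
pose cl g : {mfun g.-tuple (X p (s g)) >-> schur_space p} :=
  HB.pack_for {mfun g.-tuple (X p (s g)) >-> schur_space p} (@presented_class p g (F g) (s g))
    (isMeasurableFun.Build _ _ _ _ _ (mcl g)).
pose k g : {nonneg R} := NngNum (mu_CL_ge0 R p_prime p_odd g).
pose nu : {measure set (schur_space p) -> \bar R} :=
  mseries (fun g => mscale (k g) (distribution (tuple_prod (mu g) g) (cl g))) 0.
(* [mu_BBH] is a mere set function, which agrees with the measure [nu] on Omega. *)
have nuE (A : set (schur_space p)) : measurable A -> mu_BBH mu A = nu A.
  move=> mA; rewrite /mu_BBH /nu /= /mseries; apply: eq_eseriesr => g _.
  rewrite /mscale /= /distribution /pushforward; congr (_ * _).
  have -> : [set r | exists2 a : schur_space p, A a &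
      d_eq p (class_repr a) g /\ isomorphic (presented r) (class_repr a)] =
      nondegenerate p_prime (F_free g) (s := s g) `&` presented_class (s := s g) @^-1` A.
    exact: (presented_in_class p_prime (F_free g) (s_continuous g) (s_inv g)).
  apply: probability1_setI; [exact: mnd| |exact: nd1].
  by have := mcl g measurableT _ mA; rewrite setTI.
have mS := measurable_Sur_count (R := R) p_prime p_odd sH H_pgroup H_class.
have intE : \int[mu_BBH mu]_(G in [set: schur_space p])
    (counting (Sur (@fixed_GI (class_repr G)) sH) : \bar R) = \int[nu]_a Sur_count R sH a.
  exact: eq_measurable_integral.
have esumE : \esum_(G in [set: ancestor_class p c])
    (mu_BBH_level mu c (class_repr G) * counting (Sur (@fixed_GI (class_repr G)) sH)) =
    \int[nu]_a Sur_count R sH a.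
  rewrite (integral_Sur_count p_prime p_odd sH H_pgroup H_class).
  apply: eq_esum => a _; rewrite /mu_BBH_level nuE//.
  by rewrite -level_class_code; exact: measurable_level_class.
rewrite intE esumE; split=> //.
rewrite ge0_integral_measure_series//; last by move=> a _; exact: Sur_count_ge0.
rewrite -[RHS](mu_CL_mass R p_prime p_odd (gen_rank p H)); apply: eq_eseriesr => g _.
rewrite ge0_integral_mscale//; last by move=> a _; exact: Sur_count_ge0.
congr (_ * _); rewrite (ge0_integral_pushforward (mcl g))//; last first.
  by move=> a _; exact: Sur_count_ge0.
have [Hc _] := H_class.
rewrite preimage_setT (expectation_Sur p_odd (s_continuous g) (s_inv g) (mnd g) H_pgroup Hc
  sH_GI (mu_uniform g) (nd1 g))//.
by apply: measurableT_comp; [exact: mS|exact: mcl].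
Qed.
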